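(* Let the static kernel $g$ satisfy Assumption G and let the kernels $k,\ell$ satisfy Assumption F (both stated in the context). Let $\mathcal Y\subset\mathcal H$ be bounded under both the RKHS norm $\|\cdot\|_{\mathcal H}$ and the norm $\|\cdot\|_{\mathcal N}$ of $\mathcal C^{\mathcal N}(\mathcal X)$. Then $\mathcal Y$ is relatively compact with respect to the $\mathcal C^{\mathcal N}$ topology.
   Context: **Path spaces.** Fix $T>0$, $\mathbb T=[0,T]$, $d,e\in\mathbb N_0$, $p>1$, $\alpha\in(0,1)$. For $q\ge1$ and $\gamma:[t,t']\to\mathbb R^e$, $|\gamma|_{q\text{-var};[t,t']}=\big(\sup\sum_i|\gamma_{t_{i+1}}-\gamma_{t_i}|^q\big)^{1/q}$ (sup over partitions of $[t,t']$) and $\|\gamma\|_{q\text{-var};[t,t']}=|\gamma_t|+|\gamma|_{q\text{-var};[t,t']}$. $\mathrm{BV}_t=\mathrm{BV}([t,T],\mathbb R^e)$ is the set of continuous paths $[t,T]\to\mathbb R^e$ of finite 1-variation with one strictly monotone coordinate; this coordinate is denoted $\gamma^0$ and the remaining $\mathbb R^{e-1}$-valued path $\check\gamma$. Let $$\Omega=\{(t,x,\gamma)\in\mathbb T\times\mathbb R^d\times \mathrm{BV}_0:\ \check\gamma_s=\check\gamma_0\ \text{for all } s\le t\},$$ with distance $\boldsymbol d((t,x,\gamma),(\bar t,\bar x,\bar\gamma))=|t-\bar t|+|x-\bar x|+\|\gamma-\bar\gamma\|_{p\text{-var};\mathbb T}$. **Compact domain.** $\mathcal X$ is a fixed compact subset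 of $(\Omega,\boldsymbol d)$ on which the 1-variation norms of the paths are bounded by some $R>0$; typically $\mathcal X=\{(t,x,\gamma)\in\mathbb T\times\prod_{i=1}^d[a_i,b_i]\times \mathrm{BV}_0:\gamma\in B_t(R)\}$, where $B_t(R)$ is the set of $\gamma\in\mathrm{BV}_0$ with $\check\gamma_s=\check\gamma_0$ for $s\le t$ and whose 1-variation plus $\alpha$-Hölder norm is at most $R$. **Derivatives.** $\partial_t u$ is the right time derivative, with the convention $\partial_tu(T,x,\gamma)=0$; $\partial_x$ is the usual spatial derivative. Only functionals depending on the path through $[t,T]$ are considered: $u(t,x,\gamma)=u_{t,x}(\gamma^0|_{[t,T]},\check\gamma|_{[t,T]})$. The pathwise derivative in direction $\eta\in \mathrm{BV}_0$ is $$\widehat\partial^{\eta}_\gamma u(t,x,\gamma)=\lim_{\varepsilon\to0}\frac{u_{t,x}(\gamma^0|_{[t,T]},(\check\gamma+\varepsilon\check\eta)|_{[t,T]})-u_{t,x}(\gamma^0|_{[t,T]},\check\gamma|_{[t,T]})}{\varepsilon},$$ and $\widehat\partial^{\eta\bar\eta}_\gamma$ is the iterated derivative. Elements of $\mathcal H$ are differentiated using that the kernel $\kappa$ below is defined on all of $\mathbb T\times\mathbb R^d\times\mathrm{BV}_0$. Let $\mathcal N=\{(n_1,n_2,n_3)\in\mathbb N_0^3: n_1\le1,n_2=n_3=0,\text{ or } n_1=0,n_2+n_3\le2\}$. $\mathcal C^{\mathcal N}(\mathcal X)$ is the space of functionals whose derivatives $\partial_t^{n_1}\partial_x^{n_2}\widehat\partial_\gamma^{\boldsymbol\eta}$,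 $(n_1,n_2,n_3)\in\mathcal N$, $\boldsymbol\eta\in(\mathrm{BV}_0)^{n_3}$, exist and are continuous on $\mathcal X$, with norm $$\|h\|_{\mathcal N}=\sum_{\partial\in\mathscr D}\sup\{|\partial h(\omega)|:\omega\in\mathcal X,\ \eta,\bar\eta\in \mathrm{BV}_0,\ \|\eta\|_{1\text{-var};\mathbb T}\vee\|\bar\eta\|_{1\text{-var};\mathbb T}\le1\},$$ $\mathscr D=\{\mathrm{id},\partial_t,\partial_x,\partial_x^2,\widehat\partial^\eta_\gamma\partial_x,\widehat\partial^\eta_\gamma,\widehat\partial^{\eta\bar\eta}_\gamma\}$. **Signature kernels.** For a Hilbert space $V$, $\overline{T(V)}$ is the Hilbert space completion of the algebraic direct sum $\bigoplus_{n\ge0}V^{\otimes n}$ with inner product $\sum_n\langle a_n,b_n\rangle_{V^{\otimes n}}$. The signature $S(\gamma)_{t,t'}\in\overline{T(V)}$ of a continuous bounded variation path is the sequence of its iterated Riemann–Stieltjes integrals over $t<t_1<\dots<t_m<t'$, with zeroth term 1. Let $g:\mathbb R^e\times\mathbb R^e\to\mathbb R$ be a kernel with RKHS $\mathcal H_g$ and Lipschitz feature map $v\mapsto g(v,\cdot)$, and $\gamma^g_u=g(\gamma_u,\cdot)\in\mathcal H_g$. Set $\kappa^g_{\mathrm{sig}}(\gamma,\tau)=\langle S(\gamma^g)_{0,T},S(\tau^g)_{0,T}\rangle_{\overline{T(\mathcal H_g)}}$, $\kappa^{g,\ell}_{\mathrm{sig}}(\gamma,\tau)=\ell(\gamma_0,\tau_0)\,\kappa^g_{\mathrm{sig}}(\gamma-\gamma_0,\tau-\tau_0)$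 and $$\kappa((s,x,\gamma),(t,y,\tau))=k((s,x),(t,y))\,\kappa^{g,\ell}_{\mathrm{sig}}(\gamma,\tau),$$ where $k,\ell$ are cc-universal kernels on $\mathbb R^{d+1},\mathbb R^e$ (continuous, symmetric, positive semidefinite, with RKHS dense in the continuous functions on every compact set, in uniform norm). $\mathcal H$ is the RKHS of $\kappa$ restricted to $\mathcal X\times\mathcal X$. **Assumption G.** $g$ is four times differentiable and, for all $0\le n,m\le4$, $\sup_{x,y\in\mathbb R^e}\big(\sum_{|I|=n,|J|=m}|\partial^n_{x^I}\partial^m_{y^J}g(x,y)|^2\big)^{1/2}<\infty$. **Assumption F.** The feature maps $\varphi(x)=\ell(x,\cdot)$ (into the RKHS of $\ell$) and $\chi(x)=k(x,\cdot)$ (into the RKHS of $k$) are bounded, Lipschitz continuous, twice differentiable, with bounded, Lipschitz continuous derivatives. *)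

(* Defs.v *)
From HB Require Import structures.
From mathcomp Require Import all_boot all_order all_algebra.
From mathcomp Require Import all_classical all_reals all_analysis.

Set Implicit Arguments.
Unset Strict Implicit.
Unset Printing Implicit Defensive.

Import Order.TTheory GRing.Theory Num.Theory.
Import numFieldNormedType.Exports.

Local Open Scope classical_set_scope.
Local Open Scope ring_scope.

(* Paths are total functions on R; every notion below only looks at their
   values on the relevant interval. *)
Notation pathT R e := (R -> 'rV[R]_e).

(* The norm of the library on row vectors is the max norm; |.| on R^n is the
   Euclidean one. *)
Definition enorm (R : realType) (n : nat) (v : 'rV[R]_n) : R :=
  Num.sqrt (\sum_(i < n) v 0 i ^+ 2).

Definition pvar_sum (R : realType) (e : nat) (q a b : R) (c : pathT R e)
    (s : seq R) : R :=
  \sum_(0 <= i < size s)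
    (enorm (c (nth b (a :: s) i.+1) - c (nth b (a :: s) i))) `^ q.

Definition pvar (R : realType) (e : nat) (q a b : R) (c : pathT R e) : \bar R :=
  poweR (ereal_sup [set (pvar_sum q a b c s)%:E | s in itv_partition a b]) q^-1.

Definition pvar_norm (R : realType) (e : nat) (q a b : R) (c : pathT R e) :
    \bar R :=
  ((enorm (c a))%:E + pvar q a b c)%E.

(* The strictly monotone coordinate gamma^0 is the coordinate of index 0 (so BV
   is empty if e = 0). *)
Definition BV (R : realType) (e : nat) (a b : R) : set (pathT R e) :=
  [set c | [/\ {within `[a, b], continuous c}, (pvar 1 a b c < +oo)%E &
    exists2 i : 'I_e, nat_of_ord i = 0%N &
      {in `[a, b] &, {homo (fun s => c s 0 i) : x y / x < y}} \/
      {in `[a, b] &, {homo (fun s => c s 0 i) : x y /~ x < y}}]].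

(* The remaining coordinates are seen in R^e by setting coordinate 0 to 0, so
   that (gamma^0, \check gamma + eps \check eta) is
   gamma + eps *: checkp eta. *)
Definition check (R : realType) (e : nat) (v : 'rV[R]_e) : 'rV[R]_e :=
  \row_(i < e) if nat_of_ord i == 0%N then 0 else v 0 i.

Definition checkp (R : realType) (e : nat) (c : pathT R e) : pathT R e :=
  fun s => check (c s).

(* Triples (t, x, gamma). T and p are phantom parameters, which determine the
   topology put on the type. *)
Record state (R : realType) (T p : R) (d e : nat) := State {
  st_t : R;
  st_x : 'rV[R]_d;
  st_path : pathT R e }.

Definition Omega (R : realType) (T p : R) (d e : nat) : set (state T p d e) :=
  [set w | [/\ 0 <= st_t w <= T, BV 0 T (st_path w) &
    forall s, 0 <= s <= st_t w ->
      checkp (st_path w) s = checkp (st_path w) 0]].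

Definition dist_state (R : realType) (T p : R) (d e : nat)
    (w v : state T p d e) : \bar R :=
  (`|st_t w - st_t v|%:E + (enorm (st_x w - st_x v))%:E
   + pvar_norm p 0 T (st_path w \- st_path v)%R)%E.

Definition state_open (R : realType) (T p : R) (d e : nat) :
    set_system (state T p d e) :=
  [set A | forall w, A w -> exists2 eps : R, 0 < eps &
     forall v, (dist_state w v < eps%:E)%E -> A v].

Lemma state_openT (R : realType) (T p : R) (d e : nat) :
  @state_open R T p d e setT.
Proof. by move=> w _; exists 1. Qed.

Lemma state_openI (R : realType) (T p : R) (d e : nat) :
  setI_closed (@state_open R T p d e).
Proof.
move=> A B oA oB w [Aw Bw].
have [a a0 Ha] := oA _ Aw; have [b b0 Hb] := oB _ Bw.
exists (Num.min a b); first by rewrite lt_min a0 b0.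
move=> v vab; split; [apply: Ha|apply: Hb]; apply: lt_le_trans vab _;
  by rewrite lee_fin ge_min lexx ?orbT.
Qed.

Lemma state_openU (R : realType) (T p : R) (d e : nat) (I : Type)
  (f : I -> set (state T p d e)) :
  (forall i, state_open (f i)) -> state_open (\bigcup_i f i).
Proof.
move=> of_ w [i _ fw]; have [a a0 Ha] := of_ i _ fw.
by exists a => // v /Ha; exists i.
Qed.

HB.instance Definition _ (R : realType) (T p : R) (d e : nat) :=
  gen_eqMixin (state T p d e).
HB.instance Definition _ (R : realType) (T p : R) (d e : nat) :=
  gen_choiceMixin (state T p d e).
HB.instance Definition _ (R : realType) (T p : R) (d e : nat) :=
  isOpenTopological.Build (state T p d e) (@state_openT R T p d e)
    (@state_openI R T p d e) (@state_openU R T p d e).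

(* Functionals are functions of all triples. Their derivatives are evaluated on
   the compact domain, using values around it. *)

Inductive direction (R : realType) (d e : nat) :=
  | Dx of 'I_d
  | Dpath of pathT R e.
Arguments Dx {R d e}.
Arguments Dpath {R d e}.

Definition admissible (R : realType) (T : R) (d e : nat)
    (dir : direction R d e) : Prop :=
  if dir is Dpath eta then BV 0 T eta else True.

Definition move_state (R : realType) (T p : R) (d e : nat)
    (w : state T p d e) (dir : direction R d e) (eps : R) : state T p d e :=
  match dir with
  | Dx i => State T p (st_t w) (st_x w + eps *: delta_mx 0 i) (st_path w)
  | Dpath eta =>
      State T p (st_t w) (st_x w)
        (fun s => st_path w s + eps *: checkp eta s)
  end.

Definition derivable_dir (R : realType) (T p : R) (d e : nat) (dir : direction R d e)
    (u : state T p d e -> R) (w : state T p d e) : Prop :=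
  derivable (fun eps : R => u (move_state w dir eps)) 0 1.

Definition Ddir (R : realType) (T p : R) (d e : nat) (dir : direction R d e)
    (u : state T p d e -> R) : state T p d e -> R :=
  fun w => derive1 (fun eps : R => u (move_state w dir eps)) 0.

(* The iterated derivative Ddir dir' (Ddir dir u) exists at w: as Ddir is total, the
   existence of the inner derivative near w has to be required too. *)
Definition derivable_dir2 (R : realType) (T p : R) (d e : nat)
    (dir dir' : direction R d e) (u : state T p d e -> R)
    (w : state T p d e) : Prop :=
  (\forall eps \near (0 : R), derivable_dir dir u (move_state w dir' eps)) /\
  derivable_dir dir' (Ddir dir u) w.

Definition time_quotient (R : realType) (T p : R) (d e : nat)
    (u : state T p d e -> R) (w : state T p d e) (h : R) : R :=
  (u (State T p (st_t w + h) (st_x w) (st_path w)) - u w) / h.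

Definition derivable_time (R : realType) (T p : R) (d e : nat)
    (u : state T p d e -> R) (w : state T p d e) : Prop :=
  st_t w < T -> cvg (time_quotient u w h @[h --> 0^'+]).

Definition Dt (R : realType) (T p : R) (d e : nat)
    (u : state T p d e -> R) : state T p d e -> R :=
  fun w => if st_t w < T then lim (time_quotient u w h @[h --> 0^'+]) else 0.

(* For the second-order derivatives both orders of d_x and the pathwise
   derivative are required. The value of d_t at time T is the conventional 0, so
   that continuity at T would exclude even u(t, x, gamma) = t: the continuity of
   d_t is asked for on the part t < T of X, where d_t is a derivative. *)
Definition is_CN (R : realType) (T p : R) (d e : nat)
    (X : set (state T p d e)) (u : state T p d e -> R) : Prop :=
  [/\ {within X, continuous u},
      (forall w, X w -> derivable_time u w) /\
        {within X `&` [set w | st_t w < T], continuous (Dt u)},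
      forall dir : direction R d e, admissible T dir ->
        (forall w, X w -> derivable_dir dir u w) /\
        {within X, continuous (Ddir dir u)} &
      forall dir dir' : direction R d e,
        admissible T dir -> admissible T dir' ->
        (forall w, X w -> derivable_dir2 dir dir' u w) /\
        {within X, continuous (Ddir dir' (Ddir dir u))}].

(* Adding 0 only makes the supremum over the empty set equal to 0. *)
Definition sup_over (R : realType) (T p : R) (d e : nat)
    (X : set (state T p d e))
    (F : state T p d e -> pathT R e -> pathT R e -> R) : \bar R :=
  ereal_sup (0%E |` [set y | exists w eta eta',
    [/\ X w,
        BV 0 T eta /\ (pvar_norm 1 0 T eta <= 1)%E,
        BV 0 T eta' /\ (pvar_norm 1 0 T eta' <= 1)%E &
        y = (F w eta eta')%:E]]).

Definition normN (R : realType) (T p : R) (d e : nat)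
    (X : set (state T p d e)) (u : state T p d e -> R) : \bar R :=
  let N_id := sup_over X (fun w _ _ => `|u w|) in
  let N_t := sup_over X (fun w _ _ => `|Dt u w|) in
  let N_x := sup_over X (fun w _ _ =>
    Num.sqrt (\sum_(i < d) (Ddir (Dx i) u w) ^+ 2)) in
  let N_xx := sup_over X (fun w _ _ =>
    Num.sqrt (\sum_(i < d) \sum_(j < d) (Ddir (Dx j) (Ddir (Dx i) u) w) ^+ 2)) in
  let N_xpath := sup_over X (fun w eta _ =>
    Num.sqrt (\sum_(i < d) (Ddir (Dpath eta) (Ddir (Dx i) u) w) ^+ 2)) in
  let N_path := sup_over X (fun w eta _ => `|Ddir (Dpath eta) u w|) in
  let N_pathpath := sup_over X (fun w eta eta' =>
    `|Ddir (Dpath eta') (Ddir (Dpath eta) u) w|) in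
  (N_id + N_t + N_x + N_xx + N_xpath + N_path + N_pathpath)%E.

Record CN (R : realType) (T p : R) (d e : nat) (X : set (state T p d e)) := MkCN {
  CN_fun :> state T p d e -> R;
  CN_prop : is_CN X CN_fun }.

Definition CN_open (R : realType) (T p : R) (d e : nat)
    (X : set (state T p d e)) : set_system (CN X) :=
  [set A | forall u : CN X, A u -> exists2 eps : R, 0 < eps &
     forall v : CN X, (normN X (fun w => v w - u w)%R < eps%:E)%E -> A v].

Lemma CN_openT (R : realType) (T p : R) (d e : nat)
  (X : set (state T p d e)) : @CN_open R T p d e X setT.
Proof. by move=> w _; exists 1. Qed.

Lemma CN_openI (R : realType) (T p : R) (d e : nat)
  (X : set (state T p d e)) : setI_closed (@CN_open R T p d e X).
Proof.
move=> A B oA oB w [Aw Bw].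
have [a a0 Ha] := oA _ Aw; have [b b0 Hb] := oB _ Bw.
exists (Num.min a b); first by rewrite lt_min a0 b0.
move=> v vab; split; [apply: Ha|apply: Hb]; apply: lt_le_trans vab _;
  by rewrite lee_fin ge_min lexx ?orbT.
Qed.

Lemma CN_openU (R : realType) (T p : R) (d e : nat)
  (X : set (state T p d e)) (I : Type) (f : I -> set (CN X)) :
  (forall i, CN_open (f i)) -> CN_open (\bigcup_i f i).
Proof.
move=> of_ w [i _ fw]; have [a a0 Ha] := of_ i _ fw.
by exists a => // v /Ha; exists i.
Qed.

HB.instance Definition _ (R : realType) (T p : R) (d e : nat)
  (X : set (state T p d e)) := gen_eqMixin (CN X).
HB.instance Definition _ (R : realType) (T p : R) (d e : nat)
  (X : set (state T p d e)) := gen_choiceMixin (CN X).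
HB.instance Definition _ (R : realType) (T p : R) (d e : nat)
  (X : set (state T p d e)) :=
  isOpenTopological.Build (CN X) (@CN_openT R T p d e X)
    (@CN_openI R T p d e X) (@CN_openU R T p d e X).

(* A real Hilbert space: a complete normed space whose norm comes from an inner
   product. *)
Record hilbert (R : realType) := Hilbert {
  hilbert_sort :> completeNormedModType R;
  inner : hilbert_sort -> hilbert_sort -> R;
  innerC : forall u v, inner u v = inner v u;
  inner_linear : forall a u v w,
    inner (a *: u + v) w = a * inner u w + inner v w;
  inner_norm : forall u, inner u u = `|u| ^+ 2 }.

(* The RKHS of K (unique up to isometry): a Hilbert space of functions on S,
   through the injective linear map rk_ev, with the reproducing property.
   rk_sec s is the feature K(s, .). *)
Record rkhs (R : realType) (S : Type) (K : S -> S -> R) := Rkhs {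
  rk_space :> hilbert R;
  rk_ev : rk_space -> S -> R;
  rk_sec : S -> rk_space;
  rk_linear : forall a f h s, rk_ev (a *: f + h) s = a * rk_ev f s + rk_ev h s;
  rk_inj : forall f, (forall s, rk_ev f s = 0) -> f = 0;
  rk_secE : forall s s', rk_ev (rk_sec s) s' = K s s';
  rk_repr : forall f s, inner f (rk_sec s) = rk_ev f s }.

Definition restrict_kernel (R : realType) (S : Type) (K : S -> S -> R)
    (X : set S) : {s : S | X s} -> {s : S | X s} -> R :=
  fun a b => K (sval a) (sval b).
Arguments restrict_kernel {R S} K X.

(* The canonical extension to S of a function h of the RKHS of K restricted to
   X: the function s |-> <h, K(s, .)|_X>. It agrees with h on X, and it is
   sum_i c_i K(s_i, .) on S if h is sum_i c_i K(s_i, .) on X. *)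
Definition rk_extend (R : realType) (S : Type) (K : S -> S -> R) (X : set S)
    (H : rkhs (restrict_kernel K X)) (h : H) : S -> R :=
  fun s => inner h
    (xget 0 [set f : H | forall a, rk_ev f a = K s (sval a)]).

Definition psd_kernel (R : realType) (S : Type) (K : S -> S -> R) : Prop :=
  (forall s s', K s s' = K s' s) /\
  (forall (n : nat) (a : 'I_n -> R) (s : 'I_n -> S),
    0 <= \sum_(i < n) \sum_(j < n) a i * a j * K (s i) (s j)).

Definition cc_universal (R : realType) (n : nat)
    (K : 'rV[R]_n -> 'rV[R]_n -> R) (H : rkhs K) : Prop :=
  [/\ continuous (fun z : 'rV[R]_n * 'rV[R]_n => K z.1 z.2),
      psd_kernel K &
      forall (A : set 'rV[R]_n) (f : 'rV[R]_n -> R), compact A ->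
        {within A, continuous f} -> forall eps : R, 0 < eps ->
        exists h : H, forall x, A x -> `|f x - rk_ev h x| < eps].

(* The completion of the direct sum of the V^{(x) n}, described (up to isometry)
   by the unit of V^{(x) 0} and the product a, v |-> a (x) v. The axioms say that
   <v_1 (x) .. (x) v_n, w_1 (x) .. (x) w_m> is 0 if n <> m and the product of the
   <v_i, w_i> otherwise, and that elementary tensors span a dense subspace. *)
Record tensor_algebra (R : realType) (V : hilbert R) := TensorAlgebra {
  ta_space :> hilbert R;
  ta_one : ta_space;
  ta_mul : ta_space -> V -> ta_space;
  ta_mul_linearl : forall c a b v,
    ta_mul (c *: a + b) v = c *: ta_mul a v + ta_mul b v;
  ta_mul_linearr : forall c a v w,
    ta_mul a (c *: v + w) = c *: ta_mul a v + ta_mul a w;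
  ta_inner11 : inner ta_one ta_one = 1;
  ta_inner1M : forall a v, inner ta_one (ta_mul a v) = 0;
  ta_innerMM : forall a b v w,
    inner (ta_mul a v) (ta_mul b w) = inner a b * inner v w;
  ta_dense : closure [set z | exists (n : nat) (c : 'I_n -> R)
      (s : 'I_n -> seq V),
      z = \sum_(i < n) c i *: foldl ta_mul ta_one (s i)] = setT }.

(* The Riemann-Stieltjes integral of F (x) dX over [a, b]. *)
Definition RS_sum (R : realType) (V : hilbert R) (TV : tensor_algebra V)
    (F : R -> TV) (X : R -> V) (a b : R) (s : seq R) (xi : nat -> R) : TV :=
  \sum_(0 <= i < size s)
    ta_mul (F (xi i)) (X (nth b (a :: s) i.+1) - X (nth b (a :: s) i)).

Definition is_RS_integral (R : realType) (V : hilbert R)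
    (TV : tensor_algebra V) (F : R -> TV) (X : R -> V) (a b : R) (I : TV) :
    Prop :=
  forall eps : R, 0 < eps -> exists2 del : R, 0 < del &
    forall (s : seq R) (xi : nat -> R), itv_partition a b s ->
      (forall i, (i < size s)%N ->
         nth b (a :: s) i.+1 - nth b (a :: s) i < del /\
         nth b (a :: s) i <= xi i <= nth b (a :: s) i.+1) ->
      `|RS_sum F X a b s xi - I| < eps.

Definition RS_integral (R : realType) (V : hilbert R)
    (TV : tensor_algebra V) (F : R -> TV) (X : R -> V) (a b : R) : TV :=
  xget 0 [set I | is_RS_integral F X a b I].

Fixpoint sig_level (R : realType) (V : hilbert R) (TV : tensor_algebra V)
    (X : R -> V) (a : R) (m : nat) : R -> TV :=
  match m with
  | 0%N => fun _ => ta_one TV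
  | m'.+1 => fun b => RS_integral (sig_level TV X a m') X a b
  end.

Definition signature (R : realType) (V : hilbert R) (TV : tensor_algebra V)
    (X : R -> V) (a b : R) : TV :=
  limn (series (fun m => sig_level TV X a m b)).

Definition kappa_sig (R : realType) (T : R) (e : nat)
    (g : 'rV[R]_e -> 'rV[R]_e -> R) (Hg : rkhs g) (TV : tensor_algebra Hg)
    (c c' : pathT R e) : R :=
  inner (signature TV (fun s => rk_sec Hg (c s)) 0 T)
        (signature TV (fun s => rk_sec Hg (c' s)) 0 T).

Definition kappa_sig_l (R : realType) (T : R) (e : nat)
    (g : 'rV[R]_e -> 'rV[R]_e -> R) (Hg : rkhs g) (TV : tensor_algebra Hg)
    (l : 'rV[R]_e -> 'rV[R]_e -> R) (c c' : pathT R e) : R :=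
  l (c 0) (c' 0) *
  kappa_sig T TV (fun s => c s - c 0) (fun s => c' s - c' 0).

Definition time_space (R : realType) (d : nat) (t : R) (x : 'rV[R]_d) :
    'rV[R]_(1 + d) :=
  row_mx (const_mx t) x.

Definition kappa (R : realType) (T p : R) (d e : nat)
    (g : 'rV[R]_e -> 'rV[R]_e -> R) (Hg : rkhs g) (TV : tensor_algebra Hg)
    (k : 'rV[R]_(1 + d) -> 'rV[R]_(1 + d) -> R)
    (l : 'rV[R]_e -> 'rV[R]_e -> R) (w v : state T p d e) : R :=
  k (time_space (st_t w) (st_x w)) (time_space (st_t v) (st_x v)) *
  kappa_sig_l T TV l (st_path w) (st_path v).

(* n-fold (Frechet) differentiability, for a finite-dimensional V. *)
Fixpoint ndifferentiable (R : realType) (V W : normedModType R) (n : nat)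
    (f : V -> W) : Prop :=
  match n with
  | 0%N => True
  | n'.+1 => (forall x, differentiable f x) /\
             forall v, ndifferentiable n' ('D_v f)
  end.

Definition mixed_partial (R : realType) (e : nat)
    (g : 'rV[R]_e -> 'rV[R]_e -> R) (I J : seq 'I_e) :
    'rV[R]_e -> 'rV[R]_e -> R :=
  foldr (fun i f x y => 'D_(delta_mx 0 i) (f ^~ y) x)
    (foldr (fun j f x y => 'D_(delta_mx 0 j) (f x) y) g J) I.

Definition assumptionG (R : realType) (e : nat)
    (g : 'rV[R]_e -> 'rV[R]_e -> R) : Prop :=
  [/\ ndifferentiable 4 (fun z : 'rV[R]_e * 'rV[R]_e => g z.1 z.2),
      (forall (j : 'I_e) (J : seq 'I_e), (size J < 4)%N -> forall x y,
         derivable (mixed_partial g [::] J x) y (delta_mx 0 j)),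
      (forall (i : 'I_e) (I J : seq 'I_e), (size I < 4)%N ->
         (size J <= 4)%N -> forall x y,
         derivable (mixed_partial g I J ^~ y) x (delta_mx 0 i)) &
      forall n m : nat, (n <= 4)%N -> (m <= 4)%N ->
        exists C : R, forall x y,
        Num.sqrt (\sum_(I : n.-tuple 'I_e) \sum_(J : m.-tuple 'I_e)
          `|mixed_partial g I J x y| ^+ 2) <= C].

Definition assumptionF (R : realType) (n : nat) (V : normedModType R)
    (f : 'rV[R]_n -> V) : Prop :=
  [/\ [bounded f x | x in setT],
      lipschitz f,
      ndifferentiable 2 f,
      exists C : R, forall v x y,
        `|'D_v f x| <= C * `|v| /\
        `|'D_v f x - 'D_v f y| <= C * `|v| * `|x - y| &
      exists C : R, forall v w x y,
        `|'D_w ('D_v f) x| <= C * `|v| * `|w| /\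
        `|'D_w ('D_v f) x - 'D_w ('D_v f) y| <= C * `|v| * `|w| * `|x - y|].

(* Main.v *)
(* Write rk_extend h w = <h, Phi w>, with Phi w the section of the kernel at w.
   By the Schur product theorem Phi factors through a bounded trilinear map of
   the features of k and l and of the signature. Iterated finite differences of
   Phi are bounded by the sizes of the increments: for the static features this
   is the mean value theorem, and for the signature it is proved on its discrete
   approximations, the products of the 1 + dX_i over uniform grids. Hence
   Phi is twice differentiable in the directions of time, space and path, with
   quadratic remainders, and its derivatives are continuous.
   All the derivatives of Phi entering the norm of C^N are moreover uniformly
   approximated, over X and the unit directions, by combinations of bounded
   weight of finitely many vectors, hence of finitely many sections K(a, .). So
   for every eps there are finitely many points a_q of X and weights c_q with
     ||h||_N <= eps ||h||_H + sum_q c_q |h(a_q)|  (up to a constant).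
   An ultrafilter on the closure of Y converges pointwise on X; the limit is a
   bounded functional on the span of the sections, thus an element of H, and the
   inequality turns pointwise convergence into convergence in C^N. *)

Require Import Defs.
From HB Require Import structures.
From mathcomp Require Import all_boot all_order all_algebra.
From mathcomp Require Import ring lra.
From mathcomp Require Import all_classical all_reals all_analysis.

Set Implicit Arguments.
Unset Strict Implicit.
Unset Printing Implicit Defensive.

Import Order.TTheory GRing.Theory Num.Theory.
Import numFieldNormedType.Exports.

Local Open Scope classical_set_scope.
Local Open Scope ring_scope.

(** * Hilbert spaces and reproducing kernels *)

(** Derivatives are taken in the bare vector space of pairs (time and space, path), without a norm.
    Smoothness is measured by [bdiff] against a [control]: a time change for which the path and both
    directions are Lipschitz. A second derivative with quadratic remainder costs third differences.
    The features of [k] and [l] have them by Assumption F. The signature sees the feature of [g]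
    only through its increments, and an increment is already one difference, so fourth differences
    are needed there: this is where the order 4 of Assumption G is used. Continuity cannot be
    measured in 1-variation: for [p > 1] the distance controls the sup norm of a difference of paths
    but not its 1-variation. Hence discrete signatures are compared by Abel summation, in sup norm
    and under a common bound on the variations. In the approximation by finitely many vectors,
    weights proportional to the increments of the path are decisive: Riemann sums have arbitrarily
    many terms, but their total weight stays below the variation. *)

Section SequenceLimits.
Context (R : realType) (V : normedModType R).
Implicit Types (u : nat -> V) (l : V).

Lemma cvg_seqP u l : u @ \oo --> l <->
  forall e : R, 0 < e -> exists N, forall n, (N <= n)%N -> `|u n - l| < e.
Proof.
split=> [/cvgrPdist_lt ul e /ul [N _ HN]|H].
  by exists N => n Nn; rewrite distrC; exact: HN.
apply/cvgrPdist_lt => e /H [N HN]; exists N => // n /= Nn.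
by rewrite distrC; exact: HN.
Qed.

Lemma le_of_eps (x y : R) : (forall e, 0 < e -> x <= y + e) -> x <= y.
Proof. by move=> H; apply/ler_addgt0Pr. Qed.

Lemma norm_lim_le u l (b : R) N :
  u @ \oo --> l -> (forall n, (N <= n)%N -> `|u n| <= b) -> `|l| <= b.
Proof.
move=> /cvg_seqP ul ub; apply: le_of_eps => e /ul [M HM].
have /HM h : (M <= maxn M N)%N by rewrite leq_maxl.
have /ub h' : (N <= maxn M N)%N by rewrite leq_maxr.
have : `|l| <= `|u (maxn M N)| + `|u (maxn M N) - l|.
  by rewrite (le_trans _ (ler_normB _ _))// opprB addrCA subrr addr0.
by move=> /le_trans -> //; rewrite lerD// ltW.
Qed.

Lemma cvg_seq_le0 u l (b : nat -> R) : (forall n, `|u n - l| <= b n) ->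
  b @ \oo --> (0 : R) -> u @ \oo --> l.
Proof.
move=> ub /cvgrPdist_lt b0; apply/cvg_seqP => e /b0 [N _ HN].
exists N => n /HN; rewrite /= sub0r normrN => /(le_lt_trans (ler_norm _)).
exact: le_lt_trans.
Qed.
End SequenceLimits.

Lemma cauchy_seq_cvg (R : realType) (V : completeNormedModType R) (u : nat -> V) :
  (forall e : R, 0 < e -> exists N, forall m n, (N <= m)%N -> (N <= n)%N ->
     `|u m - u n| <= e) ->
  exists l : V, u @ \oo --> l.
Proof.
move=> H; suff: cvg (u @ \oo) by move=> c; exists (lim (u @ \oo)).
apply: cauchy_cvg; apply/cauchyP => e e0.
have [N HN] := H (e / 2) ltac:(by rewrite divr_gt0).
exists (u N), N => // n /= Nn; rewrite -ball_normE /ball_ /=.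
by rewrite (le_lt_trans (HN _ _ _ Nn))// ltr_pdivrMr// ltr_pMr// ltr1n.
Qed.

Lemma cvg_harmonicM (R : realType) (C : R) :
  (fun n : nat => C / n.+1%:R) @ \oo --> (0 : R).
Proof.
by rewrite -(mulr0 C); apply: cvgMr; exact: cvg_harmonic.
Qed.

Lemma cvg_geometricM (R : realType) (C : R) :
  (fun n : nat => C * 2^-1 ^+ n) @ \oo --> (0 : R).
Proof.
rewrite -(mulr0 C); apply: cvgMr; apply: cvg_expr.
by rewrite ger0_norm ?invr_ge0// invf_lt1// ltr1n.
Qed.

Section HilbertTheory.
Context (R : realType) (V : hilbert R).
Implicit Types (u v w : V) (a : R).

Lemma innerDl u v w : inner (u + v) w = inner u w + inner v w.
Proof. by rewrite -[u in LHS]scale1r inner_linear mul1r. Qed.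
Lemma inner0l w : inner 0 w = 0.
Proof. by have := innerDl 0 0 w; rewrite addr0 => /eqP; rewrite -subr_eq subrr => /eqP <-. Qed.
Lemma innerZl a u w : inner (a *: u) w = a * inner u w.
Proof. by rewrite -[a *: u]addr0 inner_linear inner0l addr0. Qed.
Lemma innerNl u w : inner (- u) w = - inner u w.
Proof. by rewrite -scaleN1r innerZl mulN1r. Qed.
Lemma innerBl u v w : inner (u - v) w = inner u w - inner v w.
Proof. by rewrite innerDl innerNl. Qed.
Lemma innerDr u v w : inner w (u + v) = inner w u + inner w v.
Proof. by rewrite innerC innerDl ![inner _ w]innerC. Qed.
Lemma inner0r w : inner w 0 = 0.
Proof. by rewrite innerC inner0l. Qed.
Lemma innerZr a u w : inner w (a *: u) = a * inner w u.
Proof. by rewrite innerC innerZl innerC. Qed.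
Lemma innerNr u w : inner w (- u) = - inner w u.
Proof. by rewrite innerC innerNl innerC. Qed.
Lemma innerBr u v w : inner w (u - v) = inner w u - inner w v.
Proof. by rewrite innerDr innerNr. Qed.
Lemma inner_suml I (s : seq I) (P : pred I) (F : I -> V) w :
  inner (\sum_(i <- s | P i) F i) w = \sum_(i <- s | P i) inner (F i) w.
Proof.
by apply: (big_morph (fun x => inner x w)) => [x y|]; rewrite ?innerDl ?inner0l.
Qed.
Lemma inner_sumr I (s : seq I) (P : pred I) (F : I -> V) w :
  inner w (\sum_(i <- s | P i) F i) = \sum_(i <- s | P i) inner w (F i).
Proof. by rewrite innerC inner_suml; apply: eq_bigr => i _; rewrite innerC. Qed.

Lemma inner_ge0 u : 0 <= inner u u.
Proof. by rewrite inner_norm exprn_ge0. Qed.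

Lemma inner_CS u v : `|inner u v| <= `|u| * `|v|.
Proof.
have [->|v0] := eqVneq v 0; first by rewrite inner0r normr0 mulr_ge0.
have nv : 0 < `|v| by rewrite normr_gt0.
rewrite -(@ler_pXn2r _ 2)// ?nnegrE ?mulr_ge0//.
rewrite real_normK ?num_real// exprMn.
have := inner_ge0 (`|v| ^+ 2 *: u - inner u v *: v).
rewrite innerBl !innerBr !innerZl !innerZr !inner_norm (innerC v u).
have nv2 : 0 < `|v| ^+ 2 by rewrite exprn_gt0.
set b := inner u v; set p := `|v| ^+ 2 in nv2 *; set q := `|u| ^+ 2 => h.
rewrite -(ler_pM2l nv2) -subr_ge0; apply: le_trans h _; lra.
Qed.

Lemma inner_ge_norm u v : inner u v <= `|u| * `|v|.
Proof. exact: le_trans (ler_norm _) (inner_CS u v). Qed.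

Lemma parallelogram u v :
  `|u - v| ^+ 2 = 2 * `|u| ^+ 2 + 2 * `|v| ^+ 2 - `|u + v| ^+ 2.
Proof.
rewrite -!inner_norm innerBl !innerBr innerDl !innerDr (innerC v u); lra.
Qed.

Lemma cvg_inner (u : nat -> V) l w :
  u @ \oo --> l -> (fun n => inner (u n) w) @ \oo --> inner l w.
Proof.
move=> /cvg_seqP ul; apply/cvg_seqP => e e0.
have w1 : 0 < `|w| + 1 by rewrite ltr_wpDl.
have [N HN] := ul (e / (`|w| + 1)) ltac:(by rewrite divr_gt0).
exists N => n /HN h; rewrite -innerBl (le_lt_trans (inner_CS _ _))//.
rewrite ltr_pdivlMr// in h; apply: le_lt_trans h.
by rewrite ler_wpM2l// lerDl.
Qed.

Lemma inner_ext u v : (forall w, inner u w = inner v w) -> u = v.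
Proof.
move=> e; apply/eqP; rewrite -subr_eq0 -normr_eq0 -sqrf_eq0 -inner_norm.
by rewrite innerBl e subrr.
Qed.

Definition innerE := (innerDl, innerBl, innerNl, innerZl, inner0l).

End HilbertTheory.

(* Linear identities between vectors are checked after pairing with an arbitrary
   vector. *)
Ltac hring := apply: inner_ext => ?; rewrite !innerE; ring.

Section TensorAlgebraTheory.
Context (R : realType) (V : hilbert R) (TV : tensor_algebra V).
Implicit Types (a b : TV) (v w : V) (c : R).

Lemma ta_norm_mul a v : `|ta_mul a v| = `|a| * `|v|.
Proof.
apply/eqP; rewrite -(@eqrXn2 _ 2)// ?mulr_ge0//; apply/eqP.
by rewrite -inner_norm ta_innerMM !inner_norm exprMn.
Qed.
Lemma ta_norm1 : `|ta_one TV| = 1.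
Proof.
apply/eqP; rewrite -(@eqrXn2 _ 2)//; apply/eqP.
by rewrite -inner_norm ta_inner11 expr1n.
Qed.
Lemma ta_mulDl a b v : ta_mul (a + b) v = ta_mul a v + ta_mul b v.
Proof. by rewrite -[a in LHS]scale1r ta_mul_linearl scale1r. Qed.
Lemma ta_mulDr a v w : ta_mul a (v + w) = ta_mul a v + ta_mul a w.
Proof. by rewrite -[v in LHS]scale1r ta_mul_linearr scale1r. Qed.
Lemma ta_mul0l v : ta_mul (0 : TV) v = 0.
Proof. by apply/normr0_eq0; rewrite ta_norm_mul normr0 mul0r. Qed.
Lemma ta_mul0r a : ta_mul a 0 = 0.
Proof. by apply/normr0_eq0; rewrite ta_norm_mul normr0 mulr0. Qed.
Lemma ta_mulZl c a v : ta_mul (c *: a) v = c *: ta_mul a v.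
Proof. by rewrite -[c *: a]addr0 ta_mul_linearl ta_mul0l addr0. Qed.
Lemma ta_mulZr c a v : ta_mul a (c *: v) = c *: ta_mul a v.
Proof. by rewrite -[c *: v]addr0 ta_mul_linearr ta_mul0r addr0. Qed.
Lemma ta_mulBl a b v : ta_mul (a - b) v = ta_mul a v - ta_mul b v.
Proof. by rewrite ta_mulDl -scaleN1r ta_mulZl scaleN1r. Qed.
Lemma ta_mulBr a v w : ta_mul a (v - w) = ta_mul a v - ta_mul a w.
Proof. by rewrite ta_mulDr -scaleN1r ta_mulZr scaleN1r. Qed.
Lemma ta_mul_sumr I (s : seq I) (P : pred I) (F : I -> V) a :
  ta_mul a (\sum_(i <- s | P i) F i) = \sum_(i <- s | P i) ta_mul a (F i).
Proof. by apply: (big_morph (ta_mul a)) => [x y|]; rewrite ?ta_mulDr ?ta_mul0r. Qed.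
Lemma ta_mul_suml I (s : seq I) (P : pred I) (F : I -> TV) v :
  ta_mul (\sum_(i <- s | P i) F i) v = \sum_(i <- s | P i) ta_mul (F i) v.
Proof. by apply: (big_morph (fun x => ta_mul x v)) => [x y|]; rewrite ?ta_mulDl ?ta_mul0l. Qed.
End TensorAlgebraTheory.

Section RKHS.
Context (R : realType) (S : Type) (K : S -> S -> R) (H : rkhs K).

Definition rk_comb (s : seq (R * S)) : H := \sum_(p <- s) p.1 *: rk_sec H p.2.

Lemma inner_sec (a b : S) : inner (rk_sec H a) (rk_sec H b) = K a b.
Proof. by rewrite rk_repr rk_secE. Qed.

Lemma inner_comb (h : H) s : inner h (rk_comb s) = \sum_(p <- s) p.1 * rk_ev h p.2.
Proof. by rewrite inner_sumr; apply: eq_bigr => p _; rewrite innerZr rk_repr. Qed.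

(* The element is obtained as the minimizer of |v|^2 - 2 f(v) over the span of
   the sections, on which f is a bounded functional. *)
Lemma rk_bounded_functional (f : S -> R) (M : R) : 0 <= M ->
  (forall s, `|\sum_(p <- s) p.1 * f p.2| <= M * `|rk_comb s|) ->
  exists h : H, [/\ forall a, rk_ev h a = f a, `|h| <= M &
    forall e : R, 0 < e -> exists s, `|h - rk_comb s| < e].
Proof.
move=> M0 fM.
pose y (s : seq (R * S)) := \sum_(p <- s) p.1 * f p.2.
pose Q s := `|rk_comb s| ^+ 2 - 2 * y s.
pose E := range Q.
(* Completing the square: [Q s] is at least [|v|^2 - 2 M |v|] for [v = rk_comb s]. *)
have QM s : - M ^+ 2 <= Q s.
  have := fM s; rewrite -/(y s) /Q ler_norml => /andP[_ h].
  have := sqr_ge0 (`|rk_comb s| - M); nra.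
have hE : has_inf E by split; [exists (Q [::]), [::]|exists (- M ^+ 2) => _ [s _ <-]].
pose I := inf E.
have IQ s : I <= Q s by apply: ge_inf; [case: hE|exists s].
have /choice[sn Hsn] : forall n, exists s, Q s < I + n.+1%:R^-1.
  move=> n; have [] := @inf_adherent _ E n.+1%:R^-1 ltac:(by rewrite invr_gt0) hE.
  by move=> _ [s _ <-] h; exists s.
have comb_cat s t : rk_comb (s ++ t) = rk_comb s + rk_comb t by rewrite /rk_comb big_cat.
have y_cat s t : y (s ++ t) = y s + y t by rewrite /y big_cat.
(* At the midpoint of two nearly minimal combinations [Q] is still at least [I]; by the
   parallelogram law the minimizing sequence is then Cauchy. *)
pose half (s : seq (R * S)) := [seq (p.1 / 2, p.2) | p <- s].
have comb_half s : rk_comb (half s) = 2^-1 *: rk_comb s.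
  rewrite /rk_comb /half big_map scaler_sumr; apply: eq_bigr => p _ /=.
  by rewrite scalerA mulrC.
have y_half s : y (half s) = y s / 2.
  rewrite /y /half big_map mulr_suml; apply: eq_bigr => p _ /=.
  by rewrite mulrAC.
pose v n := rk_comb (sn n).
have vmn m n : `|v m - v n| ^+ 2 <= 2 * m.+1%:R^-1 + 2 * n.+1%:R^-1.
  rewrite parallelogram.
  have := IQ (half (sn m ++ sn n)).
  rewrite {1}/Q comb_half y_half y_cat comb_cat normrZ ger0_norm ?invr_ge0//.
  rewrite exprMn -/(v m) -/(v n).
  have := Hsn m; have := Hsn n; rewrite /Q -/(v m) -/(v n).
  move: (y _) (y _) (_ ^+ 2) (_ ^+ 2) (`|_ + _| ^+ 2) => y1 y2 a b c.
  have -> : 2^-1 ^+ 2 = 4^-1 :> R by rewrite exprVn -natrX.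
  move: (m.+1%:R^-1) (n.+1%:R^-1) => r1 r2; lra.
have [h vh] : exists h : H, v @ \oo --> h.
  apply: cauchy_seq_cvg => e e0.
  have e20 : 0 < e ^+ 2 / 4 by rewrite divr_gt0// exprn_gt0.
  have := @cvg_harmonic R => /cvgrPdist_lt /(_ _ e20) [N _ HN].
  exists N => m n Nm Nn; rewrite -(@ler_pXn2r _ 2)// ?nnegrE ?(ltW e0)//.
  have := HN _ Nm; have := HN _ Nn; rewrite /harmonic /= !sub0r !normrN !ger0_norm//.
  have := vmn m n; move: (m.+1%:R^-1) (n.+1%:R^-1) (e ^+ 2) (_ ^+ 2) => a b c d; lra.
(* Euler-Lagrange equation: adding [t] times the section at [a] cannot bring [Q] below [I], so
   [2 t dl <= t^2 k] for all [t], where [dl] is the defect at [a]. A small multiple of [dl] as [t]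
   forces [dl = 0]. *)
have ev a : rk_ev h a = f a.
  pose k := K a a; have k0 : 0 <= k by rewrite /k -inner_sec inner_ge0.
  pose dl := f a - rk_ev h a.
  have D t : 2 * t * dl <= t ^+ 2 * k.
    apply: le_of_eps => e e0.
    have t1 : 0 < 2 * `|t| + 1 by rewrite ltr_wpDl// mulr_ge0.
    have /cvg_seqP := @cvg_inner _ _ v h (rk_sec H a) vh.
    move=> /(_ (e / 2 / (2 * `|t| + 1))) [|N1 HN1]; first by rewrite !divr_gt0.
    have := @cvg_harmonic R => /cvgrPdist_lt /(_ (e / 2)) [|N2 _ HN2].
      by rewrite divr_gt0.
    pose n := maxn N1 N2.
    have := HN1 n (leq_maxl _ _); have := HN2 n (leq_maxr _ _).
    rewrite /harmonic /= sub0r normrN ger0_norm// !rk_repr => h2.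
    rewrite ltr_pdivlMr// => h1.
    have := IQ (sn n ++ [:: (t, a)]); have := Hsn n.
    rewrite /Q comb_cat y_cat -/(v n).
    have -> : rk_comb [:: (t, a)] = t *: rk_sec H a by rewrite /rk_comb big_seq1.
    have -> : y [:: (t, a)] = t * f a by rewrite /y big_seq1.
    rewrite -!inner_norm innerDl !innerDr !innerZl !innerZr inner_sec.
    rewrite (innerC (rk_sec H a)) -/k !rk_repr.
    move: (inner (v n) (v n)) (y _) => vv yy.
    have : 2 * t * (rk_ev (v n) a - rk_ev h a) <= e / 2.
      apply: le_trans (ler_norm _) _; rewrite !normrM ger0_norm//.
      rewrite mulrC; apply: le_trans (ltW h1); rewrite ler_wpM2l//; lra.
    rewrite /dl expr2; move: (rk_ev (v n) a) (rk_ev h a) (n.+1%:R^-1) h2 => x1 x2 x3.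
    nra.
  apply/eqP; rewrite eq_sym -subr_eq0 -/dl; apply/eqP.
  have k1 : 0 < k + 1 by rewrite ltr_wpDl.
  (* Dividing by [k + 1] rather than [k] covers [k = 0] as well. *)
  have := D (dl / (k + 1)).
  have -> : 2 * (dl / (k + 1)) * dl = 2 * dl ^+ 2 / (k + 1) by rewrite expr2; field; lra.
  have -> : (dl / (k + 1)) ^+ 2 * k = (dl ^+ 2 * k / (k + 1)) / (k + 1).
    by rewrite expr2; field; lra.
  rewrite ler_pM2r ?invr_gt0// ler_pdivlMr// => h1.
  apply/eqP; rewrite -sqrf_eq0 eq_le sqr_ge0 andbT; have := sqr_ge0 dl; nra.
have approx e : 0 < e -> exists s, `|h - rk_comb s| < e.
  move=> e0; have /cvg_seqP /(_ _ e0) [N /(_ _ (leqnn N)) HN] := vh.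
  by exists (sn N); rewrite distrC.
exists h; split => //.
(* [|h|^2] is approximated by [inner h (rk_comb s) = y s], which is at most [M |rk_comb s|], hence
   nearly at most [M |h|]. *)
have [->|h0] := eqVneq h 0; first by rewrite normr0.
have nh : 0 < `|h| by rewrite normr_gt0.
rewrite -(ler_pM2l nh) -expr2; apply: le_of_eps => e e0.
have p0 : 0 < `|h| + M by rewrite ltr_wpDr.
have [s hs] := approx (e / (`|h| + M)) ltac:(by rewrite divr_gt0).
move: hs; rewrite ltr_pdivlMr// => hs.
have -> : `|h| ^+ 2 = inner h (h - rk_comb s) + y s.
  rewrite innerBr inner_norm inner_comb /y.
  rewrite (eq_bigr (fun p => p.1 * f p.2)) ?subrK// => p _.
  by rewrite ev.
have h1 := inner_ge_norm h (h - rk_comb s).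
have := fM s; rewrite -/(y s) ler_norml => /andP[_ h2].
have h3 : `|rk_comb s| <= `|h| + `|h - rk_comb s|.
  by rewrite distrC addrC -{1}(subrK h (rk_comb s)) ler_normD.
move: h1 h2 h3 hs M0 nh; move: (inner _ _) (y s) `|rk_comb s| `|h| `|_ - _| => a b c g d.
nra.
Qed.

(** Evaluation at [h] of the sections is a bounded functional, and the element representing it is
    approximated by combinations; [rk_inj] identifies this element with [h]. *)
Lemma rk_comb_dense (h : H) (e : R) : 0 < e -> exists s, `|h - rk_comb s| < e.
Proof.
move=> e0; have [] := @rk_bounded_functional (rk_ev h) `|h|.
- by [].
- by move=> s; rewrite -inner_comb; exact: inner_CS.
move=> h' [evh' _ /(_ _ e0)]; suff -> : h' = h by [].
apply/eqP; rewrite -subr_eq0; apply/eqP/rk_inj => s.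
by rewrite -rk_repr innerBl !rk_repr evh' subrr.
Qed.

End RKHS.

(** * Positive matrices: the Schur product theorem and a trilinear Cauchy-Schwarz inequality *)

Section SchurProduct.
Context (R : realType).

Definition psdm n (M : 'I_n -> 'I_n -> R) : Prop :=
  (forall i j, M i j = M j i) /\
  forall c : 'I_n -> R, 0 <= \sum_i \sum_j c i * c j * M i j.

Lemma sum2_recl n (F : 'I_n.+1 -> 'I_n.+1 -> R) : (forall i j, F i j = F j i) ->
  \sum_i \sum_j F i j = F ord0 ord0 + 2 * (\sum_(i < n) F ord0 (lift ord0 i)) +
    \sum_(i < n) \sum_(j < n) F (lift ord0 i) (lift ord0 j).
Proof.
move=> Fs; rewrite big_ord_recl big_ord_recl.
under [X in _ + X]eq_bigr => i _ do rewrite big_ord_recl Fs.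
rewrite big_split /= -!addrA; congr (_ + _); rewrite !addrA; congr (_ + _).
by rewrite mulr_natl mulr2n.
Qed.

Lemma gram_sum n (V : hilbert R) (c : 'I_n -> R) (x : 'I_n -> V) :
  \sum_i \sum_j c i * c j * inner (x i) (x j) = `|\sum_i c i *: x i| ^+ 2.
Proof.
rewrite -inner_norm inner_suml; apply: eq_bigr => i _.
rewrite inner_sumr; apply: eq_bigr => j _.
by rewrite innerZl innerZr mulrA.
Qed.

(* One step of the LDL^T decomposition of M writes the sum as a squared norm plus
   the same kind of sum for the Schur complement. *)
Lemma schur_product n (V : hilbert R) (M : 'I_n -> 'I_n -> R) (x : 'I_n -> V) :
  psdm M -> 0 <= \sum_i \sum_j M i j * inner (x i) (x j).
Proof.
elim: n M x => [|n IH] M x [Ms Mp]; first by rewrite big_ord0.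
set m := M ord0 ord0.
pose b i := M ord0 (lift ord0 i).
pose M1 i j := M (lift ord0 i) (lift ord0 j).
have expand c0 (c : 'I_n -> R) :
    0 <= c0 ^+ 2 * m + 2 * (c0 * \sum_i c i * b i) + \sum_i \sum_j c i * c j * M1 i j.
  have := Mp (fun i => if unlift ord0 i is Some j then c j else c0).
  rewrite sum2_recl; last by move=> i j; rewrite Ms; congr (_ * _); rewrite mulrC.
  rewrite unlift_none -expr2; congr (0 <= _ + _ + _).
    congr (2 * _); rewrite mulr_sumr; apply: eq_bigr => i _.
    by rewrite liftK mulrA.
  by apply: eq_bigr => i _; apply: eq_bigr => j _; rewrite !liftK.
have m0 : 0 <= m.
  have := expand 1 (fun=> 0).
  rewrite expr1n mul1r big1 => [|i _]; last by rewrite mul0r.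
  rewrite mulr0 mulr0 addr0 big1 ?addr0// => i _.
  by rewrite big1// => j _; rewrite !mul0r.
(* If the pivot [m] vanishes, positivity makes its whole row vanish. With [0^-1 = 0], the identities
   of the elimination then hold in both cases. *)
have mb i : m * m^-1 * b i = b i.
  have [m_0|m_neq0] := eqVneq m 0; last by rewrite divff// mul1r.
  rewrite m_0 !mul0r; apply/esym/eqP; apply: contraT => bi.
  have H t := expand t (fun j => (j == i)%:R).
  have S1 t : 0 <= 2 * (t * b i) + M1 i i.
    move: (H t); rewrite m_0 mulr0 add0r.
    rewrite (bigD1 i)//= eqxx mul1r big1 ?addr0 => [|j /negPf ->]; last by rewrite mul0r.
    rewrite (bigD1 i)//= [X in _ + (_ + X)]big1 ?addr0 => [|j /negPf ji]; last first.
      by rewrite big1// => k _; rewrite ji !mul0r.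
    rewrite (bigD1 i)//= eqxx !mul1r big1 ?addr0// => j /negPf ->.
    by rewrite mulr0 mul0r.
  (* For this [t] the value is [- M1 i i - 2], negative because [S1 0] gives [0 <= M1 i i]. *)
  have := S1 (- (M1 i i + 1) / b i).
  rewrite divfK//.
  by have := S1 0; rewrite mul0r mulr0 add0r; lra.
have mm : m * m^-1 * m = m.
  by have [->|m_neq0] := eqVneq m 0; rewrite ?mulr0// divff// mul1r.
(* The Schur complement of the pivot. Its form is the minimum of that of [M] over the first
   coordinate, attained at [- (m^-1 * L)], hence positive. *)
pose M' i j := M1 i j - m^-1 * (b i * b j).
have psdM' : psdm M'.
  split=> [i j|c]; first by rewrite /M' /M1 Ms (mulrC (b i)).
  set L := \sum_i c i * b i.
  have -> : \sum_i \sum_j c i * c j * M' i j =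
      \sum_i \sum_j c i * c j * M1 i j - m^-1 * L ^+ 2.
    rewrite expr2 /L mulr_suml mulr_sumr -sumrB; apply: eq_bigr => i _.
    rewrite !mulr_sumr -sumrB; apply: eq_bigr => j _; rewrite /M'; ring.
  have := expand (- (m^-1 * L)) c; rewrite -/L; move: (\sum_i \sum_j _) => A.
  have -> : (- (m^-1 * L)) ^+ 2 * m = m^-1 * L ^+ 2.
    have [m_0|m_neq0] := eqVneq m 0; first by rewrite m_0 invr0 !mul0r mulr0.
    by rewrite !expr2; field.
  by rewrite expr2; lra.
rewrite sum2_recl; last by move=> i j; rewrite Ms innerC.
have -> : \sum_(i < n) \sum_(j < n) M (lift ord0 i) (lift ord0 j) *
       inner (x (lift ord0 i)) (x (lift ord0 j)) =
   \sum_i \sum_j M' i j * inner (x (lift ord0 i)) (x (lift ord0 j)) +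
   m^-1 * `|\sum_i b i *: x (lift ord0 i)| ^+ 2.
  rewrite -gram_sum mulr_sumr -big_split; apply: eq_bigr => i _.
  rewrite mulr_sumr -big_split; apply: eq_bigr => j _ /=.
  by rewrite /M' /M1; ring.
have := IH M' (fun i => x (lift ord0 i)) psdM'.
have : 0 <= m^-1 * `|m *: x ord0 + \sum_i b i *: x (lift ord0 i)| ^+ 2.
  by rewrite mulr_ge0 ?invr_ge0// exprn_ge0.
set B := \sum_i b i *: _.
rewrite -(inner_norm (_ + _)) innerDl !innerDr (innerC B) !innerZl !innerZr inner_norm.
have <- : inner (x ord0) (m * m^-1 *: B) = \sum_(i < n) M ord0 (lift ord0 i) *
     inner (x ord0) (x (lift ord0 i)).
  rewrite /B scaler_sumr inner_sumr; apply: eq_bigr => i _.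
  by rewrite scalerA mb innerZr.
rewrite innerZr -/m (inner_norm B).
have e1 : m^-1 * (m * (m * `|x ord0| ^+ 2)) = m * `|x ord0| ^+ 2.
  by rewrite -[in RHS]mm; ring.
rewrite !mulrDr e1; lra.
Qed.

(** This is [schur_product] for the components of the [x i] orthogonal to [a], scaled by [|a|]:
    their inner products are [|a|^2 <x i, x j> - <a, x i> <a, x j>]. *)
Lemma psd_inner_le n (V : hilbert R) (M : 'I_n -> 'I_n -> R) (x : 'I_n -> V) (a : V) :
  psdm M ->
  \sum_i \sum_j M i j * (inner a (x i) * inner a (x j)) <=
  `|a| ^+ 2 * \sum_i \sum_j M i j * inner (x i) (x j).
Proof.
move=> psdM; have [->|a0] := eqVneq a 0.
  rewrite normr0 expr0n mul0r big1// => i _; rewrite big1// => j _.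
  by rewrite !inner0l !mulr0.
have na : `|a| != 0 by rewrite normr_eq0.
rewrite -subr_ge0.
have := schur_product (fun i => `|a| *: x i - (inner a (x i) / `|a|) *: a) psdM.
congr (_ <= _).
rewrite mulr_sumr -sumrB; apply: eq_bigr => i _.
rewrite mulr_sumr -sumrB; apply: eq_bigr => j _.
rewrite innerBl !innerBr !innerZl !innerZr inner_norm (innerC _ a).
by field.
Qed.

Lemma psdm_rank1 n (c : 'I_n -> R) : psdm (fun i j => c i * c j).
Proof.
split=> [i j|d]; first by rewrite mulrC.
have -> : \sum_i \sum_j d i * d j * (c i * c j) = (\sum_i d i * c i) ^+ 2.
  rewrite expr2 mulr_suml; apply: eq_bigr => i _; rewrite mulr_sumr.
  by apply: eq_bigr => j _; rewrite mulrACA.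
exact: sqr_ge0.
Qed.

(** The Schur product theorem in matrix form. It keeps the matrices positive when [psd_inner_le] is
    used several times. *)
Lemma psdm_gram n (V : hilbert R) (M : 'I_n -> 'I_n -> R) (x : 'I_n -> V) :
  psdm M -> psdm (fun i j => M i j * inner (x i) (x j)).
Proof.
move=> psdM; split=> [i j|c]; first by rewrite psdM.1 innerC.
have := schur_product (fun i => c i *: x i) psdM; congr (_ <= _).
apply: eq_bigr => i _; apply: eq_bigr => j _.
by rewrite innerZl innerZr; ring.
Qed.

(** Cauchy-Schwarz in the triple tensor product, without that space. The square is a double sum in
    which [psd_inner_le] turns the factors with [a1], then [a2], then [a3] into Gram entries; [p1],
    [p2], [p3] collect the factors left over at each stage. *)
Lemma trilinear_gram_le n (V1 V2 V3 : hilbert R) (c : 'I_n -> R)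
    (x1 : 'I_n -> V1) (x2 : 'I_n -> V2) (x3 : 'I_n -> V3) a1 a2 a3 :
  (\sum_i c i * (inner a1 (x1 i) * inner a2 (x2 i) * inner a3 (x3 i))) ^+ 2 <=
  (`|a1| * `|a2| * `|a3|) ^+ 2 *
  \sum_i \sum_j c i * c j *
     (inner (x1 i) (x1 j) * inner (x2 i) (x2 j) * inner (x3 i) (x3 j)).
Proof.
have p1 := psdm_rank1 (fun i => c i * inner a2 (x2 i) * inner a3 (x3 i)).
have p2 := psdm_gram x1 (psdm_rank1 (fun i => c i * inner a3 (x3 i))).
have p3 := psdm_gram x2 (psdm_gram x1 (psdm_rank1 c)).
have h1 := psd_inner_le x1 a1 p1.
have h2 := psd_inner_le x2 a2 p2.
have h3 := psd_inner_le x3 a3 p3.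
have sum2_eq_le (F G : 'I_n -> 'I_n -> R) : (forall i j, F i j = G i j) ->
    \sum_i \sum_j F i j <= \sum_i \sum_j G i j.
  by move=> e; rewrite le_eqVlt; apply/orP; left; apply/eqP;
     apply: eq_bigr => i _; apply: eq_bigr => j _; rewrite e.
have -> (F : 'I_n -> R) : (\sum_i F i) ^+ 2 = \sum_i \sum_j F i * F j.
  by rewrite expr2 mulr_suml; apply: eq_bigr => i _; rewrite mulr_sumr.
apply: (le_trans _ (le_trans h1 _)).
  by apply: sum2_eq_le => i j; ring.
have -> S : (`|a1| * `|a2| * `|a3|) ^+ 2 * S =
    `|a1| ^+ 2 * (`|a2| ^+ 2 * (`|a3| ^+ 2 * S)) by ring.
rewrite ler_wpM2l ?exprn_ge0//.
apply: (le_trans _ (le_trans h2 _)).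
  by apply: sum2_eq_le => i j; ring.
rewrite ler_wpM2l ?exprn_ge0//.
apply: (le_trans _ (le_trans h3 _)).
  by apply: sum2_eq_le => i j; ring.
rewrite ler_wpM2l ?exprn_ge0//.
by apply: sum2_eq_le => i j; ring.
Qed.

End SchurProduct.

Section TrilinearFeature.
Context (R : realType) (A : Type) (K : A -> A -> R) (H : rkhs K)
  (V1 V2 V3 : hilbert R) (F1 : A -> V1) (F2 : A -> V2) (F3 : A -> V3).
Hypothesis KE : forall a b, K a b =
  inner (F1 a) (F1 b) * inner (F2 a) (F2 b) * inner (F3 a) (F3 b).

(* The adjoint of the isometry of H into the (unconstructed) Hilbert tensor
   product of V1, V2 and V3, on elementary tensors. *)
Definition rk_tri (u : V1) (v : V2) (w : V3) : H :=
  xget 0 [set h : H | forall a, rk_ev h a = inner u (F1 a) * inner v (F2 a) * inner w (F3 a)].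

(** By [KE] the squared norm of a combination of sections is a triple Gram sum, so
    [trilinear_gram_le] is exactly the bound that [rk_bounded_functional] asks for. *)
Lemma rk_tri_exists u v w : exists2 h : H,
  (forall a, rk_ev h a = inner u (F1 a) * inner v (F2 a) * inner w (F3 a)) &
  `|h| <= `|u| * `|v| * `|w|.
Proof.
have M0 : 0 <= `|u| * `|v| * `|w| by rewrite !mulr_ge0.
have [s|h [h1 h2 _]] := @rk_bounded_functional _ _ _ H
  (fun a => inner u (F1 a) * inner v (F2 a) * inner w (F3 a)) _ M0; last by exists h.
rewrite -(@ler_pXn2r _ 2)// ?nnegrE ?mulr_ge0// real_normK ?num_real//.
rewrite exprMn.
case: s => [|p0 s0]; first by rewrite big_nil expr0n/= mulr_ge0// exprn_ge0.
set s := p0 :: s0; pose n := size s.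
rewrite (big_nth p0) big_mkord.
have -> : `|rk_comb H s| ^+ 2 = \sum_(i < n) \sum_(j < n) (nth p0 s i).1 * (nth p0 s j).1 *
   (inner (F1 (nth p0 s i).2) (F1 (nth p0 s j).2) *
    inner (F2 (nth p0 s i).2) (F2 (nth p0 s j).2) *
    inner (F3 (nth p0 s i).2) (F3 (nth p0 s j).2)).
  rewrite -inner_norm inner_comb (big_nth p0) big_mkord exchange_big /=.
  apply: eq_bigr => j _; rewrite -rk_repr /rk_comb inner_suml (big_nth p0) big_mkord.
  rewrite mulr_sumr; apply: eq_bigr => i _.
  by rewrite innerZl inner_sec KE; ring.
exact: (trilinear_gram_le (fun i : 'I_n => (nth p0 s i).1)
  (fun i : 'I_n => F1 (nth p0 s i).2) (fun i : 'I_n => F2 (nth p0 s i).2)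
  (fun i : 'I_n => F3 (nth p0 s i).2)).
Qed.

Lemma rk_ext (h h' : H) : (forall a, rk_ev h a = rk_ev h' a) -> h = h'.
Proof.
move=> e; apply/eqP; rewrite -subr_eq0; apply/eqP/rk_inj => s.
by rewrite -rk_repr innerBl !rk_repr e subrr.
Qed.

Lemma rk_triE u v w a :
  rk_ev (rk_tri u v w) a = inner u (F1 a) * inner v (F2 a) * inner w (F3 a).
Proof.
rewrite /rk_tri; case: xgetP => [h _ ->//|].
by have [h hE _] := rk_tri_exists u v w => /(_ h).
Qed.

Lemma rk_tri_norm u v w : `|rk_tri u v w| <= `|u| * `|v| * `|w|.
Proof.
have [h hE hn] := rk_tri_exists u v w.
suff -> : rk_tri u v w = h by [].
by apply: rk_ext => a; rewrite rk_triE hE.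
Qed.

Lemma rk_triB1 u u' v w : rk_tri (u - u') v w = rk_tri u v w - rk_tri u' v w.
Proof.
apply: rk_ext => a.
by rewrite -[RHS]rk_repr innerBl !rk_repr !rk_triE innerBl; ring.
Qed.
Lemma rk_triB2 u v v' w : rk_tri u (v - v') w = rk_tri u v w - rk_tri u v' w.
Proof.
apply: rk_ext => a.
by rewrite -[RHS]rk_repr innerBl !rk_repr !rk_triE innerBl; ring.
Qed.
Lemma rk_triB3 u v w w' : rk_tri u v (w - w') = rk_tri u v w - rk_tri u v w'.
Proof.
apply: rk_ext => a.
by rewrite -[RHS]rk_repr innerBl !rk_repr !rk_triE innerBl; ring.
Qed.
Lemma rk_triZ c1 c2 c3 u v w :
  rk_tri (c1 *: u) (c2 *: v) (c3 *: w) = (c1 * c2 * c3) *: rk_tri u v w.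
Proof.
apply: rk_ext => a.
by rewrite -[RHS]rk_repr innerZl !rk_repr !rk_triE !innerZl; ring.
Qed.

End TrilinearFeature.

(** * Finite differences and directional derivatives *)

Section FiniteDifference.
Context (R : realType).

Fixpoint fdiff (U W : zmodType) (us : seq U) (F : U -> W) (x : U) : W :=
  if us is u :: us' then fdiff us' F (x + u) - fdiff us' F x else F x.

Section Algebra.
Context (U W : zmodType).
Implicit Types (us : seq U) (F G : U -> W) (x u : U).

Lemma fdiff_cat us vs F x : fdiff (us ++ vs) F x = fdiff us (fdiff vs F) x.
Proof. by elim: us x => //= u us IH x; rewrite !IH. Qed.

Lemma fdiff_shift us F u x : fdiff us F (x + u) = fdiff us (fun y => F (y + u)) x.
Proof. by elim: us x => //= v us IH x; rewrite -!IH addrAC. Qed.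

Lemma eq_fdiff us F G x : F =1 G -> fdiff us F x = fdiff us G x.
Proof. by move=> /funext ->. Qed.

Lemma fdiffD us F G x :
  fdiff us (fun y => F y + G y) x = fdiff us F x + fdiff us G x.
Proof. by elim: us x => //= v us IH x; rewrite !IH opprD addrACA. Qed.

Lemma fdiffB us F G x :
  fdiff us (fun y => F y - G y) x = fdiff us F x - fdiff us G x.
Proof. by elim: us x => //= v us IH x; rewrite !IH !opprD opprK addrACA. Qed.

Lemma fdiff_sum I (r : seq I) us (F : I -> U -> W) x :
  fdiff us (fun y => \sum_(i <- r) F i y) x = \sum_(i <- r) fdiff us (F i) x.
Proof.
elim: us x => //= v us IH x.
by rewrite !IH -sumrB.
Qed.

Lemma fdiff_cst us (c : W) x : fdiff us (fun=> c) x = if us is [::] then c else 0.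
Proof. by elim: us x => //= v [|w us] IH x; rewrite !IH subrr. Qed.

Lemma fdiff_comp (U' : zmodType) (L : U' -> U) (us : seq U') F (x : U') :
  {morph L : a b / a + b} ->
  fdiff us (fun y => F (L y)) x = fdiff (map L us) F (L x).
Proof. by move=> LD; elim: us x => //= v us IH x; rewrite !IH LD. Qed.

(** Differences commute with translations, so the first increment, which the definition applies to
    the point, can be moved to the function. Inductions on the list then generalise over the
    function. *)
Lemma fdiff_head us F u x :
  fdiff (u :: us) F x = fdiff us (fun y => F (y + u) - F y) x.
Proof. by rewrite fdiffB -fdiff_shift. Qed.

End Algebra.

Lemma fdiffZ (U : zmodType) (W : lmodType R) (us : seq U) (F : U -> W) (c : R) x :
  fdiff us (fun y => c *: F y) x = c *: fdiff us F x.
Proof. by elim: us x => //= v us IH x; rewrite !IH scalerBr. Qed.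

Section Bounded.
Context (U : lmodType R) (ctrl base : U -> R -> Prop).
Hypothesis baseD : forall x r u q, base x r -> ctrl u q -> base (x + u) (r + q).
Hypothesis ctrlZ : forall u q (a : R), ctrl u q -> ctrl (a *: u) (`|a| * q).

Fixpoint ctrls (us : seq (U * R)) : Prop :=
  if us is p :: us' then [/\ ctrl p.1 p.2, 0 <= p.2 & ctrls us'] else True.

Definition sizes (us : seq (U * R)) : R := \sum_(p <- us) p.2.
Definition weight (us : seq (U * R)) : R := \prod_(p <- us) p.2.

Lemma sizes_ge0 us : ctrls us -> 0 <= sizes us.
Proof.
rewrite /sizes; elim: us => [|p us IH] /=; first by rewrite big_nil.
by move=> [_ p0 /IH h]; rewrite big_cons addr_ge0.
Qed.
Lemma weight_ge0 us : ctrls us -> 0 <= weight us.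
Proof.
rewrite /weight; elim: us => [|p us IH] /=; first by rewrite big_nil.
by move=> [_ p0 /IH h]; rewrite big_cons mulr_ge0.
Qed.

(* base x r: the point x uses the budget r; a direction of size q consumes q.
   All differences of order <= n inside the budget P are bounded by C times the
   product of the sizes of the directions. *)
Definition bdiff (W : normedModType R) (n : nat) (P C : R) (F : U -> W) : Prop :=
  forall us : seq (U * R), (size us <= n)%N -> ctrls us ->
  forall x r, base x r -> r + sizes us <= P ->
    `|fdiff (map fst us) F x| <= C * weight us.

Lemma bdiff_mono (W : normedModType R) n n' P P' C C' (F : U -> W) :
  (n' <= n)%N -> P' <= P -> C <= C' -> bdiff n P C F -> bdiff n' P' C' F.
Proof.
move=> nn PP CC bF us su cu x r bx h.
apply: le_trans (bF us (leq_trans su nn) cu x r bx (le_trans h PP)) _.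
by rewrite ler_wpM2r// weight_ge0.
Qed.

Lemma bdiffD (W : normedModType R) n P C C' (F G : U -> W) :
  bdiff n P C F -> bdiff n P C' G -> bdiff n P (C + C') (fun x => F x + G x).
Proof.
move=> bF bG us su cu x r bx h; rewrite fdiffD mulrDl.
by apply: le_trans (ler_normD _ _) _; rewrite lerD//; [exact: bF bx h|exact: bG bx h].
Qed.

Lemma bdiff_cst (W : normedModType R) n P (c : W) : bdiff n P `|c| (fun=> c).
Proof.
move=> us su cu x r bx h; rewrite fdiff_cst.
case: us cu {su h} => [_|p us cu] /=; first by rewrite /weight big_nil mulr1.
by rewrite normr0 mulr_ge0// weight_ge0.
Qed.

Lemma bdiff_head (W : normedModType R) n P C (F : U -> W) u q :
  ctrl u q -> 0 <= q -> bdiff n.+1 P C F ->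
  bdiff n (P - q) (C * q) (fun x => F (x + u) - F x).
Proof.
move=> cu q0 bF us su cus x r bx h.
have := bF ((u, q) :: us) su (And3 cu q0 cus) x r bx.
rewrite /sizes /weight !big_cons /= -/(fdiff (u :: _) F x) fdiff_head mulrA.
by apply; rewrite addrCA -lerBrDl.
Qed.

Lemma bdiff_shift (W : normedModType R) n P C (F : U -> W) u q :
  ctrl u q -> bdiff n P C F -> bdiff n (P - q) C (fun x => F (x + u)).
Proof.
move=> cu bF us su cus x r bx h; rewrite -fdiff_shift.
by apply: bF (baseD bx cu) _ => //; rewrite addrAC -lerBrDr.
Qed.

(** Leibniz rule: one difference of the product gives two products, with a difference of [F] and a
    shift of [G], or with a difference of [G]; hence [2 ^+ n]. The induction carries the sharper
    [2 ^+ size us]. *)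
Lemma bdiffM (A B W : normedModType R) (J : A -> B -> W) n P C1 C2
    (F : U -> A) (G : U -> B) :
  (forall a a' b, J (a - a') b = J a b - J a' b) ->
  (forall a b b', J a (b - b') = J a b - J a b') ->
  (forall a b, `|J a b| <= `|a| * `|b|) ->
  0 <= C1 -> 0 <= C2 -> bdiff n P C1 F -> bdiff n P C2 G ->
  bdiff n P (2 ^+ n * C1 * C2) (fun x => J (F x) (G x)).
Proof.
move=> Jl Jr Jn C10 C20 bF bG us su.
have : (2 : R) ^+ size us <= 2 ^+ n by rewrite ler_eXn2l// ltr1n.
move=> h2 cu x r bx h.
apply: le_trans (_ : _ <= 2 ^+ size us * C1 * C2 * weight us) _; last first.
  by rewrite ler_wpM2r ?weight_ge0// ler_wpM2r// ler_wpM2r.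
elim: us n P C1 C2 F G C10 C20 bF bG su {h2} cu x r bx h =>
    [|[u q] us IH] n P C1 C2 F G C10 C20 bF bG su cu x r bx h.
  have := bF [::] su cu x r bx h; have := bG [::] su cu x r bx h.
  rewrite /= /weight big_nil !mulr1 expr0 mul1r => hG hF.
  by apply: le_trans (Jn _ _) _; rewrite ler_pM.
case: n bF bG su => // n bF bG su.
case: cu => /= cu q0 cus.
have hP : r + sizes us <= P - q.
  by move: h; rewrite /sizes big_cons /= addrCA -lerBrDl.
rewrite -/(fdiff (u :: [seq p.1 | p <- us]) _ x) fdiff_head.
rewrite (@eq_fdiff _ _ _ _ (fun y => J (F (y + u) - F y) (G (y + u)) +
   J (F y) (G (y + u) - G y))); last first.
  by move=> y; rewrite Jl Jr addrA subrK.
rewrite fdiffD; apply: le_trans (ler_normD _ _) _.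
have m0 : P - q <= P by rewrite lerBlDr lerDl.
have I1 := IH n (P - q) (C1 * q) C2 _ _ (mulr_ge0 C10 q0) C20
  (bdiff_head cu q0 bF) (bdiff_shift cu (bdiff_mono (leqnSn _) (lexx _) (lexx _) bG)) su cus x r bx hP.
have I2 := IH n (P - q) C1 (C2 * q) _ _ C10 (mulr_ge0 C20 q0)
  (bdiff_mono (leqnSn _) m0 (lexx _) bF) (bdiff_head cu q0 bG) su cus x r bx hP.
apply: le_trans (lerD I1 I2) _.
rewrite /weight big_cons /= exprS le_eqVlt; apply/orP; left; apply/eqP; ring.
Qed.

(** A difference is a finite combination of values at points inside the budget, so bounds uniform in
    [m] survive pointwise limits. *)
Lemma bdiff_lim (W : normedModType R) n P C (F : nat -> U -> W) (G : U -> W) :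
  (forall m, bdiff n P C (F m)) ->
  (forall x r, base x r -> r <= P -> F ^~ x @ \oo --> G x) -> bdiff n P C G.
Proof.
move=> bF FG us su cu x r bx h.
have : (fun m => fdiff (map fst us) (F m) x) @ \oo --> fdiff (map fst us) G x.
  elim: us {su} cu x r bx h => [_|[u q] us IH [/= cu q0 cus]] x r bx h /=.
    by apply: FG bx _; move: h; rewrite /sizes big_nil addr0.
  have hP : r + q + sizes us <= P by move: h; rewrite /sizes big_cons addrA.
  apply: cvgB; first exact: IH cus _ _ (baseD bx cu) hP.
  by apply: (IH cus _ _ bx); apply: le_trans hP; rewrite lerD2r lerDl.
move=> /norm_lim_le; apply => m _; exact: (bF m us su cu x r bx h).
Unshelve. exact: 0%N.
Qed.

Lemma bdiffZ (W : normedModType R) n P C (F : U -> W) (c : R) :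
  bdiff n P C F -> bdiff n P (`|c| * C) (fun x => c *: F x).
Proof.
move=> bF us su cu x r bx h; rewrite fdiffZ normrZ -mulrA ler_wpM2l//.
exact: bF bx h.
Qed.

End Bounded.
End FiniteDifference.

(** * Derivatives with quadratic remainder out of bounds on differences *)

Section SecondDifference.
Context (R : realType) (V : hilbert R) (q : R -> V) (C : R).
Hypothesis C0 : 0 <= C.
Hypothesis d1 : forall a h, `|a| + `|h| <= 2 -> `|q (a + h) - q a| <= C * `|h|.
Hypothesis d2 : forall a h k, `|a| + `|h| + `|k| <= 2 ->
  `|q (a + h + k) - q (a + h) - (q (a + k) - q a)| <= C * (`|h| * `|k|).

(** The left side is a sum of second differences with steps [j dl] and [dl], for [j < M]; their
    bounds [C j dl^2] add up to at most [C (M dl)^2]. *)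
Lemma second_diff_multiple (M : nat) (dl : R) : 0 <= dl -> M%:R * dl <= 1 ->
  `|q (M%:R * dl) - q 0 - M%:R *: (q dl - q 0)| <= C * (M%:R * dl) ^+ 2.
Proof.
move=> dl0; elim: M => [|M IH] Md.
  by rewrite !mul0r scale0r subrr subr0 normr0 expr0n mulr0.
rewrite -natr1 in Md *.
have M0 : 0 <= M%:R * dl by rewrite mulr_ge0.
have Md' : M%:R * dl <= 1 by apply: le_trans Md; rewrite ler_wpM2r// lerDl.
have dl1 : dl <= 1 by apply: le_trans Md; rewrite mulrDl mul1r lerDr.
have h := @d2 0 (M%:R * dl) dl.
rewrite normr0 !add0r !ger0_norm// in h.
have {h} := h ltac:(lra); rewrite mulrDl mul1r => h.
rewrite scalerDl scale1r.
rewrite (_ : _ - _ - _ = (q (M%:R * dl + dl) - q (M%:R * dl) - (q dl - q 0)) +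
  (q (M%:R * dl) - q 0 - M%:R *: (q dl - q 0))); last first.
  hring.
apply: le_trans (ler_normD _ _) _; apply: le_trans (lerD h (IH Md')) _.
rewrite -mulrDr ler_wpM2l//; nra.
Qed.

(** No derivative is assumed: the quotients at [0] with steps [1/n] and [1/m] are both compared with
    the one of step [1/(n m)], which makes them Cauchy with rate [C/n]. *)
Lemma second_diff_derivative : exists D : V, `|D| <= C /\
  forall h, `|h| <= 1 -> `|q h - q 0 - h *: D| <= 2 * C * h ^+ 2.
Proof.
pose D n := n.+1%:R *: (q n.+1%:R^-1 - q 0).
have inv1 n : 0 <= (n.+1%:R^-1 : R) <= 1.
  by rewrite invr_ge0 ler0n invf_le1// ler1n.
have Dn n : `|D n| <= C.
  rewrite /D normrZ ger0_norm//; have /andP[i0 i1] := inv1 n.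
  have h := @d1 0 n.+1%:R^-1; rewrite normr0 !add0r (ger0_norm i0) in h.
  apply: le_trans (_ : _ <= n.+1%:R * (C * n.+1%:R^-1)) _.
    by rewrite ler_wpM2l//; apply: h; rewrite (le_trans i1)// ler1n.
  by rewrite mulrCA divff// mulr1.
have Dnm n m : `|D n - D (n.+1 * m.+1).-1| <= C / n.+1%:R.
  have nm : ((n.+1 * m.+1).-1.+1 = n.+1 * m.+1)%N by rewrite prednK// muln_gt0.
  rewrite /D nm natrM.
  have := @second_diff_multiple m.+1 ((n.+1%:R * m.+1%:R)^-1).
  rewrite invfM mulrCA divff// mulr1; have /andP[i0 i1] := inv1 n.
  have /andP[j0 j1] := inv1 m.
  move=> /(_ (mulr_ge0 i0 j0) i1) h.
  rewrite -scalerA -scalerBr normrZ ger0_norm//.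
  apply: le_trans (_ : _ <= n.+1%:R * (C * n.+1%:R^-1 ^+ 2)) _.
    by rewrite ler_wpM2l//.
  by rewrite mulrCA expr2 (mulrA n.+1%:R) divff// mul1r.
have Dnm2 n m : `|D n - D m| <= C / n.+1%:R + C / m.+1%:R.
  have h1 := Dnm n m; have h2 := Dnm m n; rewrite mulnC distrC in h2.
  apply: le_trans (ler_distD (D (n.+1 * m.+1).-1) _ _) _; exact: lerD.
have [l Dl] : exists l : V, D @ \oo --> l.
  apply: cauchy_seq_cvg => e e0.
  have := @cvg_harmonicM R (2 * C) => /cvgrPdist_lt /(_ e e0) [N _ HN].
  exists N => m n Nm Nn; apply: le_trans (Dnm2 m n) _.
  have := HN _ Nm; have := HN _ Nn; rewrite /= !sub0r !normrN !ger0_norm ?mulr_ge0//.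
  by rewrite -!mulrA; move: (_ / _) (_ / _) => a b; lra.
have DlN N : `|D N - l| <= C / N.+1%:R.
  apply: le_of_eps => e e0; move: (Dl) => /cvg_seqP /(_ _ (divr_gt0 e0 (ltr0n _ 2)))[N1 HN1].
  have := @cvg_harmonicM R C => /cvgrPdist_lt /(_ _ (divr_gt0 e0 (ltr0n _ 2))) [N2 _ HN2].
  pose m := maxn N1 N2.
  have := HN1 m (leq_maxl _ _); have := HN2 m (leq_maxr _ _).
  rewrite /= sub0r normrN ger0_norm ?mulr_ge0// => h2 h1.
  have h3 := Dnm2 N m.
  apply: le_trans (ler_distD (D m) _ _) _; move: h1 h2 h3.
  move: (C / N.+1%:R) (C / m.+1%:R) `|D N - D m| `|D m - l| => a b c d; lra.
(* [h] is within one step of the multiple [M dl] of [dl = 1/(N+1)]. Rounding [h] inside [q],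
   rounding it in the linear term and replacing [D N] by [l] cost [C dl] each: hence [3 * C]. *)
have pos h : 0 <= h -> h <= 1 -> `|q h - q 0 - h *: l| <= C * h ^+ 2.
  move=> h0 h1; apply: le_of_eps => e e0.
  have := @cvg_harmonicM R (3 * C) => /cvgrPdist_lt /(_ e e0) [N _ HN].
  have := HN N (leqnn _); rewrite /= sub0r normrN ger0_norm ?mulr_ge0// => hN.
  have /andP[i0 i1] := inv1 N.
  set dl := N.+1%:R^-1 in i0 i1 hN; pose M := Num.truncn (h * N.+1%:R).
  have /andP[M1 M2] : M%:R <= h * N.+1%:R < M.+1%:R.
    by apply: truncn_itv; rewrite mulr_ge0.
  have Nd : N.+1%:R * dl = 1 by rewrite divff.
  have Mh : M%:R * dl <= h by rewrite ler_pdivrMr.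
  have hM : h <= M%:R * dl + dl.
    have <- : M.+1%:R * dl = M%:R * dl + dl by rewrite -natr1 mulrDl mul1r.
    by rewrite ler_pdivlMr// ltW.
  have Md0 : 0 <= M%:R * dl by rewrite mulr_ge0.
  have s1 := second_diff_multiple i0 (le_trans Mh h1).
  have s2 := @d1 (M%:R * dl) (h - M%:R * dl).
  rewrite addrCA subrr addr0 !ger0_norm ?subr_ge0// in s2.
  have {}s2 := s2 ltac:(lra).
  have s3 := DlN N; rewrite -/dl in s3.
  have e1 : M%:R *: (q dl - q 0) = (M%:R * dl) *: D N.
    by rewrite /D -/dl scalerA -mulrA (mulrC dl) Nd mulr1.
  rewrite e1 in s1.
  have -> : q h - q 0 - h *: l = (q h - q (M%:R * dl)) +
      (q (M%:R * dl) - q 0 - (M%:R * dl) *: D N) + ((M%:R * dl - h) *: D N) +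
      h *: (D N - l).
    hring.
  apply: le_trans (ler_normD _ _) _; apply: le_trans (lerD (ler_normD _ _) (lexx _)) _.
  apply: le_trans (lerD (lerD (ler_normD _ _) (lexx _)) (lexx _)) _.
  rewrite (normrZ (_ - h)) (normrZ h) (ger0_norm h0) ler0_norm ?subr_le0//.
  have s4 : - (M%:R * dl - h) * `|D N| <= dl * C.
    rewrite ler_pM// ?oppr_ge0 ?subr_le0//; lra.
  have s5 : h * `|D N - l| <= C * dl.
    by apply: le_trans s3; rewrite ler_piMl.
  have s6 : C * (h - M%:R * dl) <= C * dl by rewrite ler_wpM2l//; lra.
  have s7 : C * (M%:R * dl) ^+ 2 <= C * h ^+ 2.
    by rewrite ler_wpM2l// ler_pXn2r// nnegrE.
  move: s1 s2 s4 s5 s6 s7 hN; rewrite -(mulrA 3) (mulrC dl).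
  move: `|q h - q (M%:R * dl)| `|q (M%:R * dl) - q 0 - (M%:R * dl) *: D N|.
  move: `|D N| `|D N - l| (M%:R * dl) => a b c d m; lra.
exists l; split; first exact: norm_lim_le Dl (fun n (_ : (0 <= n)%N) => Dn n).
move=> h; have [h0|h0] := leP 0 h.
  move=> h1; apply: le_trans (pos h h0 _) _; first by rewrite ger0_norm in h1.
  by rewrite -mulrA ler_peMl ?ler1n// mulr_ge0// sqr_ge0.
rewrite ltr0_norm// => h1.
have hn : 0 <= - h by rewrite oppr_ge0 ltW.
have s1 := pos _ hn h1.
(* The second difference with steps [h] and [- h] reflects the estimate to negative [h], which
   doubles the constant. *)
have s2 := @d2 0 h (- h).
rewrite normr0 !add0r subrr normrN ltr0_norm// in s2.
have {}s2 := s2 ltac:(lra).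
rewrite sqrrN scaleNr opprK in s1.
have -> : q h - q 0 - h *: l = - (q 0 - q h - (q (- h) - q 0)) - (q (- h) - q 0 + h *: l).
  hring.
apply: le_trans (ler_normB _ _) _; rewrite normrN.
apply: le_trans (lerD s2 s1) _; rewrite mulrNN -expr2; lra.
Qed.

End SecondDifference.

Section DirectionalDerivative.
Context (R : realType) (U : lmodType R) (ctrl base : U -> R -> Prop).
Hypothesis baseD : forall x r u q, base x r -> ctrl u q -> base (x + u) (r + q).
Hypothesis ctrlZ : forall u q (a : R), ctrl u q -> ctrl (a *: u) (`|a| * q).
Context (V : hilbert R).

(** As [U] carries no topology, the derivative is the limit along the single sequence [1/(n+1)];
    [dder_rate] shows that it governs all small steps. *)
Definition dder (F : U -> V) (u x : U) : V :=
  lim ((fun n : nat => n.+1%:R *: (F (x + n.+1%:R^-1 *: u) - F x)) @ \oo).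

Section Rate.
Context (n : nat) (P C : R) (F : U -> V) (x u : U) (r : R).
Hypotheses (C0 : 0 <= C) (bF : bdiff ctrl base n.+2 P C F) (bx : base x r)
  (cu : ctrl u 1) (rP : r + 2 <= P).

Let D_spec : exists D : V, `|D| <= C /\
  forall h, `|h| <= 1 -> `|F (x + h *: u) - F x - h *: D| <= 2 * C * h ^+ 2.
Proof.
have := @second_diff_derivative R V (fun a => F (x + a *: u)) C C0.
rewrite scale0r addr0; apply.
  move=> a h ah.
  have := bF (us := [:: (h *: u, `|h| * 1)]) (ltn0Sn n.+1) _ (baseD bx (ctrlZ a cu)).
  rewrite /weight /sizes !big_seq1 /= -(addrA x) -scalerDl !mulr1; apply.
    by split=> //; have := ctrlZ h cu; rewrite mulr1.
  by rewrite -addrA; apply: le_trans rP; rewrite lerD2l.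
move=> a h k ahk.
have := bF (us := [:: (h *: u, `|h| * 1); (k *: u, `|k| * 1)]) (isT : (2 <= n.+2)%N)
  _ (baseD bx (ctrlZ a cu)).
rewrite /weight /sizes !big_cons !big_nil /= !mulr1 !addr0.
rewrite -!(addrA x) -!scalerDl; apply.
  by split=> //; [have := ctrlZ h cu|split => //; have := ctrlZ k cu]; rewrite mulr1.
by rewrite -!addrA; apply: le_trans rP; rewrite lerD2l addrA.
Qed.

Lemma dder_cvg : (fun n : nat => n.+1%:R *: (F (x + n.+1%:R^-1 *: u) - F x)) @ \oo
  --> dder F u x.
Proof.
have [D [_ HD]] := D_spec.
have c : (fun n : nat => n.+1%:R *: (F (x + n.+1%:R^-1 *: u) - F x)) @ \oo --> D.
  apply: (@cvg_seq_le0 _ _ _ _ (fun n => 2 * C / n.+1%:R)); last exact: cvg_harmonicM.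
  move=> m; have := HD m.+1%:R^-1.
  rewrite ger0_norm// invf_le1// ler1n => /(_ isT) h.
  have -> : m.+1%:R *: (F (x + m.+1%:R^-1 *: u) - F x) - D =
      m.+1%:R *: (F (x + m.+1%:R^-1 *: u) - F x - m.+1%:R^-1 *: D).
    by rewrite [in RHS]scalerBr [in RHS]scalerA divff// scale1r.
  rewrite normrZ ger0_norm//; apply: le_trans (ler_wpM2l _ h) _ => //.
  by rewrite mulrCA expr2 (mulrA m.+1%:R) divff// mul1r.
by rewrite /dder (cvg_lim _ c).
Qed.

Lemma dder_rate : `|dder F u x| <= C /\
  forall h, `|h| <= 1 -> `|F (x + h *: u) - F x - h *: dder F u x| <= 2 * C * h ^+ 2.
Proof.
have [D [D1 D2]] := D_spec.
suff -> : dder F u x = D by [].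
apply/eqP; rewrite -subr_eq0 -normr_le0; apply: le_of_eps => e e0; rewrite add0r.
have /cvg_seqP /(_ (e / 2)) [|N1 HN1] := dder_cvg; first by rewrite divr_gt0.
have := @cvg_harmonicM R (2 * C) => /cvgrPdist_lt /(_ (e / 2)) [|N2 _ HN2].
  by rewrite divr_gt0.
pose m := maxn N1 N2.
have := HN1 m (leq_maxl _ _); have := HN2 m (leq_maxr _ _).
rewrite /= sub0r normrN ger0_norm ?mulr_ge0// => h2 h1.
have := D2 m.+1%:R^-1; rewrite ger0_norm// invf_le1// ler1n => /(_ isT) h3.
have h4 : `|m.+1%:R *: (F (x + m.+1%:R^-1 *: u) - F x) - D| <= 2 * C / m.+1%:R.
  have -> : m.+1%:R *: (F (x + m.+1%:R^-1 *: u) - F x) - D =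
      m.+1%:R *: (F (x + m.+1%:R^-1 *: u) - F x - m.+1%:R^-1 *: D).
    by rewrite [in RHS]scalerBr [in RHS]scalerA divff// scale1r.
  rewrite normrZ ger0_norm//; apply: le_trans (ler_wpM2l _ h3) _ => //.
  by rewrite mulrCA expr2 (mulrA m.+1%:R) divff// mul1r.
apply: le_trans (ler_distD (m.+1%:R *: (F (x + m.+1%:R^-1 *: u) - F x)) _ _) _.
rewrite distrC; apply/ltW; move: h1 h2 h4.
move: `|_ - dder _ _ _| `|_ - D| (2 * C / _) => a b c; lra.
Qed.

End Rate.

(** A quotient is a difference divided by the size of its increment, so one order is lost but the
    constant is kept. The budget drops by 2 because the convergence of the quotients uses increments
    of total size up to 2. *)
Lemma bdiff_dder n P C F u : 0 <= C -> bdiff ctrl base n.+2 P C F -> ctrl u 1 ->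
  bdiff ctrl base n.+1 (P - 2) C (dder F u).
Proof.
move=> C0 bF cu; apply: (@bdiff_lim _ _ _ _ baseD _ n.+1 (P - 2) C
  (fun m x => m.+1%:R *: (F (x + m.+1%:R^-1 *: u) - F x))) => [m|x r bx rP]; last first.
  by apply: (dder_cvg C0 bF bx cu); rewrite -lerBrDr.
have i1 : m.+1%:R^-1 <= 1 :> R by rewrite invf_le1// ler1n.
have i0 : 0 <= m.+1%:R^-1 :> R by rewrite invr_ge0.
have c : ctrl (m.+1%:R^-1 *: u) m.+1%:R^-1.
  by have := ctrlZ m.+1%:R^-1 cu; rewrite mulr1 ger0_norm.
have := bdiffZ m.+1%:R (bdiff_head c _ bF).
rewrite ger0_norm// mulrCA divff// mulr1 => /(_ i0).
by apply: bdiff_mono => //; rewrite lerD2l lerN2 (le_trans i1)// ler1n.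
Qed.

End DirectionalDerivative.

(** * From bounds on derivatives to bounds on finite differences *)

Section MeanValue.
Context (R : realType).

Lemma mean_value_real (f : R -> R) (C h : R) :
  (forall t, derivable f t 1) -> (forall t, `|'D_1 f t| <= C) ->
  `|f h - f 0| <= `|h| * C.
Proof.
move=> df fC.
have cf : continuous f by move=> t; apply: differentiable_continuous; apply/derivable1_diffP.
have W a b : {within `[a, b], continuous f} by apply: continuous_subspaceT.
have D t : is_derive t (1 : R) f ('D_1 f t) by apply/derivableP.
have [h0|h0] := leP 0 h.
  have [c _ ->] := MVT_segment h0 (fun t _ => D t) (W _ _).
  by rewrite subr0 normrM mulrC ler_wpM2l.
have [c _] := MVT_segment (ltW h0) (fun t _ => D t) (W _ _).
rewrite distrC => ->.
by rewrite sub0r normrM normrN mulrC ler_wpM2l.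
Qed.

Lemma derivable_line (U W : normedModType R) (f : U -> W) (x v : U) (t : R) :
  derivable f (x + t *: v) v ->
  derivable (fun s : R => f (x + s *: v)) t 1 /\
  'D_1 (fun s : R => f (x + s *: v)) t = 'D_v f (x + t *: v).
Proof.
rewrite /derivable /derive.
suff -> : (fun h : R => h^-1 *: (((fun s : R => f (x + s *: v)) \o shift t) (h *: 1) -
      f (x + t *: v))) =
   (fun h : R => h^-1 *: ((f \o shift (x + t *: v)) (h *: v) - f (x + t *: v))) by [].
apply/funext => h /=; congr (_ *: (f _ - _)).
have e : h *: (1 : R) = h by exact: mulr1.
by rewrite /shift /= e scalerDl addrCA.
Qed.

Lemma mean_value_line_real (U : normedModType R) (f : U -> R) (x v : U) (C h : R) :
  (forall y, derivable f y v) -> (forall y, `|'D_v f y| <= C) ->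
  `|f (x + h *: v) - f x| <= `|h| * C.
Proof.
move=> df fC.
have := @mean_value_real (fun s => f (x + s *: v)) C h.
rewrite scale0r addr0; apply=> t; first exact: (derivable_line (df _)).1.
by rewrite (derivable_line (df _)).2.
Qed.

Lemma derive_inner (U : normedModType R) (V : hilbert R) (f : U -> V) (x v : U) (y : V) :
  derivable f x v ->
  derivable (fun z => inner (f z) y) x v /\
  'D_v (fun z => inner (f z) y) x = inner ('D_v f x) y.
Proof.
move=> df.
have c : (h^-1 *: (((fun z => inner (f z) y) \o shift x) (h *: v) - inner (f x) y)
     @[h --> 0^']) --> inner ('D_v f x) y.
  have -> : (fun h : R => h^-1 *: (((fun z => inner (f z) y) \o shift x) (h *: v) - inner (f x) y))
     = (fun h : R => inner (h^-1 *: ((f \o shift x) (h *: v) - f x)) y).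
    by apply/funext => h; rewrite innerZl innerBl.
  apply/cvgrPdist_lt => e e0.
  have y1 : 0 < `|y| + 1 by rewrite ltr_wpDl.
  have /cvgrPdist_lt/(_ _ (divr_gt0 e0 y1)) : (h^-1 *: ((f \o shift x) (h *: v) - f x)
     @[h --> 0^']) --> 'D_v f x by exact: df.
  apply: filterS => h; rewrite ltr_pdivlMr// => H.
  rewrite -innerBl (le_lt_trans (inner_CS _ _))//; apply: le_lt_trans H.
  by rewrite ler_wpM2l// lerDl.
by split; [apply/cvg_ex; exists (inner ('D_v f x) y)|exact: cvg_lim c].
Qed.

(** Pairing with the increment [y] itself reduces to real functions; one factor [|y|] then
    cancels. *)
Lemma mean_value_line (U : normedModType R) (V : hilbert R) (f : U -> V) (x v : U)
    (C h : R) :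
  (forall y, derivable f y v) -> (forall y, `|'D_v f y| <= C) ->
  `|f (x + h *: v) - f x| <= `|h| * C.
Proof.
move=> df fC; set y := f (x + h *: v) - f x.
have [->|y0] := eqVneq y 0.
  by rewrite normr0 mulr_ge0//; apply: le_trans (fC x).
have ny : 0 < `|y| by rewrite normr_gt0.
rewrite -(ler_pM2r ny) -expr2 -inner_norm {1}/y innerBl -mulrA.
apply: le_trans (ler_norm _) _.
apply: (@mean_value_line_real _ (fun z => inner (f z) y)) => z.
  exact: (derive_inner _ (df z)).1.
rewrite (derive_inner _ (df z)).2; apply: le_trans (inner_CS _ _) _.
by rewrite ler_wpM2r.
Qed.

Lemma derive_fdiff (U W : normedModType R) (us : seq U) (F : U -> W) (v : U) :
  (forall x, derivable F x v) ->
  forall x, derivable (fdiff us F) x v /\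
    'D_v (fdiff us F) x = fdiff us ('D_v F) x.
Proof.
move=> dF; elim: us => [|u us IH] x //=.
have sh (G : U -> W) y : derivable G (y + u) v ->
    derivable (fun z => G (z + u)) y v /\ 'D_v (fun z => G (z + u)) y = 'D_v G (y + u).
  rewrite /derivable /derive.
  suff -> : (fun h : R => h^-1 *: (((fun z => G (z + u)) \o shift y) (h *: v) - G (y + u))) =
     (fun h : R => h^-1 *: ((G \o shift (y + u)) (h *: v) - G (y + u))) by [].
  by apply/funext => h /=; rewrite /shift /= addrA.
have [d1 e1] := sh _ x (IH (x + u)).1; have [d2 e2] := IH x.
split; first exact: derivableB.
by rewrite deriveB// e1 (IH (x + u)).2 e2.
Qed.

Definition fd_bound (U W : normedModType R) (n : nat) (C : R) (F : U -> W) : Prop :=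
  forall us : seq U, (size us <= n)%N -> forall x,
    `|fdiff us F x| <= C * \prod_(u <- us) `|u|.

(** Orders 0 and 1 are boundedness and the Lipschitz property. Orders 2 and 3 take one or two uses
    of the mean value theorem, followed by the Lipschitz property of the first or second
    derivative. *)
Lemma assumptionF_fd_bound n (V : hilbert R) (f : 'rV[R]_n -> V) :
  assumptionF f -> exists2 C : R, 0 <= C & fd_bound 3 C f.
Proof.
case=> [[M0 [_ HM0]]] [M1 [_ HM1]] nd [C1 HC1] [C2 HC2].
have B0 x : `|f x| <= M0 + 1 by apply: HM0 => //; rewrite ltrDl.
have B1 x y : `|f x - f y| <= (M1 + 1) * `|x - y|.
  by apply: (HM1 _ _ (x, y)) => //; rewrite ltrDl.
have df x v : derivable f x v by apply: diff_derivable; case: nd => + _; apply.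
have ddf w x v : derivable ('D_w f) x v.
  by apply: diff_derivable; case: nd => _ /(_ w)[+ _]; apply.
pose C := `|M0 + 1| + `|M1 + 1| + `|C1| + `|C2|.
have C0 : 0 <= C by rewrite !addr_ge0.
have l0 : `|M0 + 1| <= C by rewrite /C -!addrA lerDl !addr_ge0.
have l1 : `|M1 + 1| <= C by rewrite /C -!addrA addrCA lerDl !addr_ge0.
have l2 : `|C1| <= C by rewrite /C -!addrA (addrCA _ `|C1|) (addrCA _ `|C1|) lerDl !addr_ge0.
have l3 : `|C2| <= C by rewrite /C lerDr !addr_ge0.
exists C => // -[|u1 [|u2 [|u3 [|//]]]] _ x; rewrite ?big_cons ?big_nil ?mulr1.
- by rewrite /=; apply: le_trans (B0 x) _; apply: le_trans (ler_norm _) l0.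
- rewrite /=; apply: le_trans (B1 _ _) _; rewrite addrAC subrr add0r ler_wpM2r//.
  exact: le_trans (ler_norm _) l1.
- have := @mean_value_line _ _ (fdiff [:: u2] f) x u1 (C * (`|u1| * `|u2|)) 1.
  rewrite scale1r normr1 mul1r; apply=> y; first exact: (derive_fdiff _ (df^~ u1) _).1.
  rewrite (derive_fdiff _ (df^~ u1) _).2 /=.
  apply: le_trans (HC1 _ _ _).2 _; rewrite addrAC subrr add0r mulrA.
  by rewrite ler_wpM2r// ler_wpM2r// (le_trans (ler_norm _) l2).
have := @mean_value_line _ _ (fdiff [:: u2; u3] f) x u1 (C * (`|u1| * (`|u2| * `|u3|))) 1.
rewrite scale1r normr1 mul1r; apply=> y; first exact: (derive_fdiff _ (df^~ u1) _).1.
rewrite (derive_fdiff _ (df^~ u1) _).2.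
have := @mean_value_line _ _ (fdiff [:: u3] ('D_u1 f)) y u2 (C * (`|u1| * (`|u2| * `|u3|))) 1.
rewrite scale1r normr1 mul1r; apply=> z; first exact: (derive_fdiff _ (ddf u1 ^~ u2) _).1.
rewrite (derive_fdiff _ (ddf u1 ^~ u2) _).2 /=.
apply: le_trans (HC2 _ _ _ _).2 _; rewrite addrAC subrr add0r !mulrA.
by rewrite !ler_wpM2r// (le_trans (ler_norm _) l3).
Qed.

End MeanValue.

Section RowVectorNorm.
Context (R : realType).

Lemma coord_le_norm n (v : 'rV[R]_n) i : `|v 0 i| <= `|v|.
Proof.
rewrite [leRHS]/Num.norm /= mx_normrE; apply/bigmax_geP; right => /=.
by exists (0, i).
Qed.

Lemma norm_row_le n (v : 'rV[R]_n) (b : R) :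
  0 <= b -> (forall i, `|v 0 i| <= b) -> `|v| <= b.
Proof.
move=> b0 vb; rewrite [leLHS]/Num.norm /= mx_normrE; apply/bigmax_leP; split => //.
by move=> [i j] _ /=; rewrite ord1.
Qed.

Lemma norm_delta_mx n (i : 'I_n) : `|delta_mx 0 i : 'rV[R]_n| <= 1.
Proof.
apply: norm_row_le => // j; rewrite mxE.
by case: (_ && _); rewrite ?normr1 ?normr0.
Qed.

Lemma norm_le_enorm n (v : 'rV[R]_n) : `|v| <= enorm v.
Proof.
apply: norm_row_le => [|i]; first exact: sqrtr_ge0.
rewrite /enorm -sqrtr_sqr ler_wsqrtr// (bigD1 i)//= lerDl.
by apply: sumr_ge0 => j _; exact: sqr_ge0.
Qed.

End RowVectorNorm.

Section CoordinateDirections.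
Context (R : realType) (e : nat) (W : normedModType R) (F : 'rV[R]_e -> W).

Definition basis_step (p : 'I_e * R) : 'rV[R]_e := p.2 *: delta_mx 0 p.1.

(** Partial derivatives only control coordinate steps, so each increment is run through one
    coordinate at a time, in [e] steps. Using [e.+1] keeps the base of the power at least 1. *)
Lemma coordinate_fd_bound (n : nat) (C : R) : 0 <= C ->
  (forall L : seq ('I_e * R), (size L <= n)%N -> forall x,
     `|fdiff (map basis_step L) F x| <= C * \prod_(p <- L) `|p.2|) ->
  fd_bound n (C * e.+1%:R ^+ n) F.
Proof.
move=> C0 H us su x.
suff D : forall us L, (size L + size us <= n)%N -> forall x,
    `|fdiff (map basis_step L ++ us) F x| <=
    C * \prod_(p <- L) `|p.2| * \prod_(u <- us) (e.+1%:R * `|u|).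
  have := D us [::] su x; rewrite big_nil mulr1 /= => h; apply: le_trans h _.
  rewrite big_split /= -mulrA ler_wpM2l// ler_wpM2r ?prodr_ge0//.
  rewrite big_const_seq count_predT iter_mulr_1.
  by rewrite ler_weXn2l// ler1n.
elim=> [|u us' IH] L sL y.
  by rewrite cats0 big_nil mulr1; apply: H; rewrite addn0 in sL.
have pL : 0 <= C * \prod_(p <- L) `|p.2| by rewrite mulr_ge0// prodr_ge0.
(* [part k] keeps the first [k] coordinates of [u]: the corners of a staircase from [0] to [u]. *)
pose part k : 'rV[R]_e := \row_j (if (j < k)%N then u 0 j else 0).
have part0 : part 0%N = 0 by apply/rowP => j; rewrite !mxE.
have partS (i : 'I_e) : part i.+1 = part i + basis_step (i, u 0 i).
  apply/rowP => j; rewrite /basis_step !mxE eqxx ltnS leq_eqVlt val_eqE.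
  have [->|ji] := eqVneq j i; first by rewrite ltnn mulr1 add0r.
  by rewrite mulr0 addr0.
have parte : part e = u by apply/rowP => j; rewrite mxE ltn_ord.
rewrite fdiff_cat (@eq_fdiff _ _ _ _ (fun z => \sum_(i < e)
   (fdiff us' F (z + part i + basis_step (i, u 0 i)) - fdiff us' F (z + part i)))); last first.
  move=> z; pose f k := fdiff us' F (z + part k).
  rewrite (eq_bigr (fun i : 'I_e => f i.+1 - f i)).
    rewrite -(big_mkord predT (fun i => f i.+1 - f i)) telescope_sumr//.
    by rewrite /f part0 addr0 parte.
  by move=> i _; rewrite /f partS addrA.
rewrite fdiff_sum; apply: le_trans (ler_norm_sum _ _ _) _.
apply: le_trans (_ : _ <= \sum_(i < e) (C * \prod_(p <- L) `|p.2| * `|u| *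
    \prod_(v <- us') (e.+1%:R * `|v|))) _.
  apply: ler_sum => i _.
  have -> : fdiff (map basis_step L) (fun z => fdiff us' F (z + part i + basis_step (i, u 0 i)) -
       fdiff us' F (z + part i)) y =
    fdiff (map basis_step (rcons L (i, u 0 i)) ++ us') F (y + part i).
    rewrite map_rcons cat_rcons fdiff_cat fdiff_shift; apply: eq_fdiff => z /=.
    by [].
  apply: le_trans (IH _ _ _) _; first by rewrite size_rcons addSnnS.
  rewrite -cats1 big_cat big_seq1 /= mulrA ler_wpM2r//.
    by apply: prodr_ge0 => v _; rewrite mulr_ge0.
  by rewrite ler_wpM2l// coord_le_norm.
rewrite sumr_const card_ord big_cons -[leLHS]mulr_natl.
have P0 : 0 <= \prod_(v <- us') (e.+1%:R * `|v|).
  by apply: prodr_ge0 => v _; rewrite mulr_ge0.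
have -> : C * \prod_(p <- L) `|p.2| * (e.+1%:R * `|u| * \prod_(v <- us') (e.+1%:R * `|v|)) =
   e.+1%:R * (C * \prod_(p <- L) `|p.2| * `|u| * \prod_(v <- us') (e.+1%:R * `|v|)) by ring.
rewrite ler_wpM2r//; last by rewrite ler_nat.
by rewrite mulr_ge0// mulr_ge0.
Qed.

End CoordinateDirections.

Section FeatureDifferences.
Context (R : realType) (e : nat) (g : 'rV[R]_e -> 'rV[R]_e -> R).

Definition partials (J : seq 'I_e) (f : 'rV[R]_e -> R) : 'rV[R]_e -> R :=
  foldr (fun j h => 'D_(delta_mx 0 j) h) f J.

Lemma mixed_partialE J x : mixed_partial g [::] J x = partials J (g x).
Proof.
elim: J => //= j J IH; apply/funext => y /=.
by rewrite /mixed_partial /= -/(mixed_partial g [::] J x) IH.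
Qed.

Lemma mixed_partial_catE I J y :
  mixed_partial g I J ^~ y = partials I (mixed_partial g [::] J ^~ y).
Proof.
elim: I => //= i I IH; apply/funext => x /=.
by rewrite /mixed_partial /= -/(mixed_partial g I J) IH.
Qed.

Lemma partials_rcons J i f : partials (rcons J i) f = partials J ('D_(delta_mx 0 i) f).
Proof. by rewrite /partials foldr_rcons. Qed.

(** Each use of the mean value theorem turns the first difference of the list into the innermost
    derivative, so the derivatives come out in reverse order. *)
Lemma fdiff_le_partials (L : seq ('I_e * R)) (f : 'rV[R]_e -> R) (C : R) :
  (forall j J, (size J < size L)%N -> forall y, derivable (partials J f) y (delta_mx 0 j)) ->
  (forall y, `|partials (rev (map fst L)) f y| <= C) ->
  forall x, `|fdiff (map (@basis_step R e) L) f x| <= C * \prod_(p <- L) `|p.2|.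
Proof.
elim: L f C => [|[i h] L IH] f C df fC x /=.
  by rewrite big_nil mulr1; exact: (fC x).
rewrite big_cons /= mulrCA.
have d0 y : derivable f y (delta_mx 0 i) by exact: (df i [::] isT y).
rewrite /basis_step /=.
apply: (mean_value_line_real (f := fdiff (map (@basis_step R e) L) f)) => y.
  exact: (derive_fdiff _ d0 y).1.
rewrite (derive_fdiff _ d0 y).2; apply: IH => [j J sJ z|z].
  by rewrite -partials_rcons; apply: df; rewrite size_rcons.
by rewrite -partials_rcons -rev_cons; exact: fC.
Qed.

Lemma partials_fdiff (us : seq 'rV[R]_e) (G : 'rV[R]_e -> 'rV[R]_e -> R) (J : seq 'I_e) x :
  (forall j K, (size K < size J)%N -> forall z y, derivable (partials K (G z)) y (delta_mx 0 j)) ->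
  partials J (fun y => fdiff us (G ^~ y) x) =
  fun y => fdiff us (fun z => partials J (G z) y) x.
Proof.
elim: J => //= j J IH dG; rewrite IH; last by move=> i K sK; apply: dG; exact: ltnW.
have {}dG z y : derivable (partials J (G z)) y (delta_mx 0 j) by apply: dG.
apply/funext => y.
suff /(_ us x) [] : forall us x, derivable (fun y => fdiff us (fun z => partials J (G z) y) x) y
    (delta_mx 0 j) /\ 'D_(delta_mx 0 j) (fun y => fdiff us (fun z => partials J (G z) y) x) y =
    fdiff us (fun z => 'D_(delta_mx 0 j) (partials J (G z)) y) x by [].
elim=> [|u us' IHus] x' /=; first by split.
have [d1 e1] := IHus (x' + u); have [d2 e2] := IHus x'.
split; first exact: derivableB.
by rewrite deriveB// e1 e2.
Qed.

Lemma derivable_partials_fdiff (us : seq 'rV[R]_e) (G : 'rV[R]_e -> 'rV[R]_e -> R)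
    (J : seq 'I_e) x j y :
  (forall i K, (size K <= size J)%N -> forall z y, derivable (partials K (G z)) y (delta_mx 0 i)) ->
  derivable (partials J (fun y => fdiff us (G ^~ y) x)) y (delta_mx 0 j).
Proof.
move=> dG; rewrite partials_fdiff; last by move=> i K sK; apply: dG; exact: ltnW.
have {}dG z y' : derivable (partials J (G z)) y' (delta_mx 0 j) by apply: dG.
elim: us x => [|u us IH] x /=; first exact: dG.
by apply: derivableB; exact: IH.
Qed.

Lemma inner_fdiff (V : hilbert R) (f : 'rV[R]_e -> V) us vs x y :
  inner (fdiff us f x) (fdiff vs f y) =
  fdiff vs (fun y' => fdiff us (fun x' => inner (f x') (f y')) x) y.
Proof.
elim: vs y => [|v vs IHv] y /=; last by rewrite innerBr !IHv.
by elim: us x => //= u us IH x; rewrite innerBl !IH.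
Qed.

(** The squared norm of a difference of the feature map is the difference of [g] along the same
    increments in both arguments, which mixed partials of order at most 4 in each argument
    control. *)
Lemma assumptionG_fd_bound (Hg : rkhs g) : assumptionG g ->
  exists2 C : R, 0 <= C & fd_bound 4 C (rk_sec Hg).
Proof.
case=> _ dy dx bnd.
have [C C0 HC] : exists2 C : R, 0 <= C & forall (L : seq 'I_e), (size L <= 4)%N ->
    forall x y, `|mixed_partial g L L x y| <= C.
  have /choice[c Hc] : forall n, exists c : R, (n <= 4)%N ->
      forall x y, Num.sqrt (\sum_(I : n.-tuple 'I_e) \sum_(J : n.-tuple 'I_e)
          `|mixed_partial g I J x y| ^+ 2) <= c.
    move=> n; case: (leqP n 4) => n4; last by exists 0.
    by have [c Hc] := bnd n n n4 n4; exists c.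
  exists (\sum_(n < 5) `|c n|); first by apply: sumr_ge0.
  move=> L L4 x y.
  apply: le_trans (_ : _ <= `|c (size L)|) _; last first.
    by rewrite (bigD1 (Ordinal (L4 : (size L < 5)%N)))//= lerDl sumr_ge0.
  apply: le_trans (le_trans (Hc _ L4 x y) (ler_norm _)).
  rewrite -[leLHS]normr_id -sqrtr_sqr ler_wsqrtr//.
  rewrite (bigD1 (in_tuple L))//= (bigD1 (in_tuple L))//=.
  rewrite -addrA lerDl addr_ge0// ?sumr_ge0// => *; rewrite ?sumr_ge0// => *;
  exact: exprn_ge0.
(* [1 + C] stands in for the square root of [C]: [C <= (1 + C)^2]. *)
exists ((1 + C) * e.+1%:R ^+ 4); first by rewrite mulr_ge0 ?addr_ge0.
apply: coordinate_fd_bound; first by rewrite addr_ge0.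
move=> L L4 x; set w := \prod_(p <- L) _.
have w0 : 0 <= w by rewrite prodr_ge0.
rewrite -(@ler_pXn2r _ 2)// ?nnegrE ?mulr_ge0 ?addr_ge0//.
rewrite -inner_norm inner_fdiff.
apply: (@le_trans _ _ (C * w * w)); last first.
  by rewrite expr2 mulrACA -mulrA ler_wpM2r ?mulr_ge0//; nra.
apply: le_trans (ler_norm _) _.
have -> : (fun y' => fdiff (map (@basis_step R e) L)
      (fun x' => inner (rk_sec Hg x') (rk_sec Hg y')) x) =
    (fun y' => fdiff (map (@basis_step R e) L) (g ^~ y') x).
  by apply/funext => y'; apply: eq_fdiff => x'; rewrite inner_sec.
have dg j K : (size K < 4)%N -> forall z y, derivable (partials K (g z)) y (delta_mx 0 j).
  by move=> K4 z y; rewrite -mixed_partialE; exact: dy.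
apply: fdiff_le_partials => [j J sJ y|y].
  apply: derivable_partials_fdiff => i K sK z y'; apply: dg.
  by rewrite (leq_ltn_trans sK)// (leq_trans sJ).
rewrite partials_fdiff; last first.
  move=> j K; rewrite size_rev size_map => sK z y'; apply: dg.
  by rewrite (leq_trans sK).
have -> : (fun z => partials (rev (map fst L)) (g z) y) =
    mixed_partial g [::] (rev (map fst L)) ^~ y.
  by apply/funext => z; rewrite mixed_partialE.
apply: fdiff_le_partials => [j J sJ z|z].
  rewrite -mixed_partial_catE; apply: dx; rewrite ?size_rev ?size_map//.
  by rewrite (leq_trans sJ).
rewrite -mixed_partial_catE; apply: HC.
by rewrite size_rev size_map.
Qed.

End FeatureDifferences.

(** * Signatures of paths controlled by a common function *)

Section Control.
Context (R : realType) (T : R).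
Implicit Types (om : R -> R).

(** A time change: a path is measured by its Lipschitz constant relative to [om], and several paths
    come under one control by adding theirs. The last clause is uniform continuity. *)
Definition control om : Prop := [/\ om 0 = 0,
  forall s t, 0 <= s -> s <= t -> t <= T -> om s <= om t &
  forall e : R, 0 < e -> exists2 rho : R, 0 < rho & forall s t, 0 <= s -> s <= t ->
    t <= T -> t - s < rho -> om t - om s < e].

Definition lipc (V : normedModType R) om (K : R) (X : R -> V) : Prop :=
  forall s t, 0 <= s -> s <= t -> t <= T -> `|X t - X s| <= K * (om t - om s).

Lemma control_ge0 om t : control om -> 0 <= t -> t <= T -> 0 <= om t.
Proof. by case=> o0 om_le _ t0 tT; rewrite -o0; apply: om_le. Qed.

Lemma control_le om t : control om -> 0 <= t -> t <= T -> om t <= om T.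
Proof. by case=> _ om_le _ t0 tT; apply: om_le. Qed.

Lemma controlD om1 om2 : control om1 -> control om2 -> control (fun t => om1 t + om2 t).
Proof.
move=> [a1 b1 c1] [a2 b2 c2]; split=> [|s t s0 st tT|e e0].
- by rewrite a1 a2 addr0.
- by rewrite lerD ?b1 ?b2.
have e2 : 0 < e / 2 by rewrite divr_gt0.
have [r1 r10 H1] := c1 _ e2; have [r2 r20 H2] := c2 _ e2.
exists (Num.min r1 r2); first by rewrite lt_min r10.
move=> s t s0 st tT; rewrite lt_min => /andP[/(H1 _ _ s0 st tT) h1 /(H2 _ _ s0 st tT) h2].
by rewrite opprD addrACA [e]splitr ltrD.
Qed.

Lemma lipc_mono (V : normedModType R) om om' K K' (X : R -> V) :
  control om -> 0 <= K -> K <= K' ->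
  (forall s t, 0 <= s -> s <= t -> t <= T -> om t - om s <= om' t - om' s) ->
  lipc om K X -> lipc om' K' X.
Proof.
move=> [_ o_le _] K0 KK oo lX s t s0 st tT; apply: le_trans (lX s t s0 st tT) _.
by rewrite ler_pM ?oo// subr_ge0 o_le.
Qed.

End Control.

Section Grid.
Context (R : realType).

Definition grid (t : R) (N k : nat) : R := t * k%:R / N.+1%:R.

Lemma grid0 t N : grid t N 0 = 0. Proof. by rewrite /grid mulr0 mul0r. Qed.
Lemma gridN t N : grid t N N.+1 = t.
Proof. by rewrite /grid mulfK. Qed.
Lemma grid_step t N k : grid t N k.+1 - grid t N k = t / N.+1%:R.
Proof. by rewrite /grid -mulrBl -mulrBr -natr1 addrAC subrr add0r mulr1. Qed.
Lemma grid_leS t N k : 0 <= t -> grid t N k <= grid t N k.+1.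
Proof. by move=> t0; rewrite -subr_ge0 grid_step divr_ge0. Qed.
Lemma grid_ltS t N k : 0 < t -> grid t N k < grid t N k.+1.
Proof. by move=> t0; rewrite -subr_gt0 grid_step divr_gt0. Qed.
Lemma grid_ge0 t N k : 0 <= t -> 0 <= grid t N k.
Proof. by move=> t0; rewrite divr_ge0// mulr_ge0. Qed.
Lemma grid_le t N k : 0 <= t -> (k <= N.+1)%N -> grid t N k <= t.
Proof. by move=> t0 kN; rewrite /grid ler_pdivrMr// ler_wpM2l// ler_nat. Qed.

Lemma grid_mesh (T : R) om t (e : R) : control T om -> 0 <= t -> t <= T -> 0 < e ->
  exists N0, forall N, (N0 <= N)%N -> forall k, (k <= N)%N ->
    om (grid t N k.+1) - om (grid t N k) < e.
Proof.
move=> [_ _ oc] t0 tT e0; have [rho rho0 H] := oc _ e0.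
have := @cvg_harmonicM R t => /cvgrPdist_lt /(_ rho rho0) [N0 _ HN].
exists N0 => N /HN /=; rewrite sub0r normrN ger0_norm ?divr_ge0// => h k kN.
apply: H; rewrite ?grid_ge0 ?grid_leS ?grid_step//.
by apply: le_trans tT; apply: grid_le.
Qed.

Definition grid_seq (t : R) (N : nat) : seq R := mkseq (fun i => grid t N i.+1) N.+1.

Lemma size_grid_seq t N : size (grid_seq t N) = N.+1.
Proof. by rewrite size_mkseq. Qed.

Lemma nth_grid t x0 N i : (i <= N.+1)%N -> nth x0 (0 :: grid_seq t N) i = grid t N i.
Proof. by case: i => [|i] iN; [rewrite grid0|rewrite -(nth_mkseq x0 (fun i => grid t N i.+1) iN)]. Qed.

Lemma grid_partition t N : 0 < t -> itv_partition 0 t (grid_seq t N).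
Proof.
move=> t0; split.
  apply/(pathP 0) => i; rewrite size_grid_seq => iN.
  rewrite nth_grid ?(ltnW iN)// -[nth 0 _ i]/(nth 0 (0 :: grid_seq t N) i.+1).
  by rewrite nth_grid// grid_ltS.
by rewrite (last_nth 0) size_grid_seq nth_grid// gridN.
Qed.

End Grid.

(** * Indefinite Riemann-Stieltjes integrals *)

Section Primitive.
Context (R : realType) (V : hilbert R) (TV : tensor_algebra V) (T : R) (om : R -> R).
Context (F : R -> TV) (X : R -> V) (K L : R).
Hypotheses (T0 : 0 <= T) (om_c : control T om) (K0 : 0 <= K) (L0 : 0 <= L).
Hypotheses (lF : lipc T om L F) (lX : lipc T om K X).

(** The integral is characterised by its left-point germ, up to an error quadratic in [om]. The
    linear slack [eps] lets the grid sums qualify too, so that [primitive_diff] proves them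
    Cauchy. *)
Definition primitive (eps : R) (I : R -> TV) : Prop := forall a b, 0 <= a -> a <= b ->
  b <= T -> `|I b - I a - ta_mul (F a) (X b - X a)| <=
    K * (L * (om b - om a) + eps) * (om b - om a).

Let om_le s t : 0 <= s -> s <= t -> t <= T -> om s <= om t.
Proof. by case: om_c => _ H _; exact: H. Qed.
Let om0 : om 0 = 0. Proof. by case: om_c. Qed.

(** Along a fine grid the quadratic errors add up to at most the mesh times [om t], up to a
    constant, and vanish in the limit; only the slacks survive. *)
Lemma primitive_diff e1 e2 I1 I2 t : 0 <= e1 -> 0 <= e2 ->
  primitive e1 I1 -> primitive e2 I2 -> I1 0 = I2 0 ->
  0 <= t -> t <= T -> `|I1 t - I2 t| <= K * (e1 + e2) * om t.
Proof.
move=> e10 e20 p1 p2 I0 t0 tT; apply: le_of_eps => e e0.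
have ot0 := control_ge0 om_c t0 tT.
have q0 : 0 <= 2 * K * L * om t by rewrite !mulr_ge0.
have q1 : 0 < 2 * K * L * om t + 1 by rewrite ltr_wpDl.
have [N0 /(_ _ (leqnn N0)) mesh] := grid_mesh om_c t0 tT (divr_gt0 e0 q1).
set mu := e / _ in mesh; set g := grid t N0.
have Dk k : (k <= N0.+1)%N ->
    `|I1 (g k) - I2 (g k)| <= K * (2 * L * mu + (e1 + e2)) * om (g k).
  elim: k => [_|k IH kN]; first by rewrite /g grid0 I0 subrr normr0 om0 mulr0.
  have gk0 : 0 <= g k by exact: grid_ge0.
  have gkS : g k <= g k.+1 by exact: grid_leS.
  have gkT : g k.+1 <= T by apply: le_trans tT; exact: grid_le.
  have h1 := p1 _ _ gk0 gkS gkT; have h2 := p2 _ _ gk0 gkS gkT.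
  have h3 := IH (ltnW kN); have h4 := mesh _ kN.
  have h5 := om_le gk0 gkS gkT.
  rewrite -/g in h4.
  have -> : I1 (g k.+1) - I2 (g k.+1) = (I1 (g k) - I2 (g k)) +
     ((I1 (g k.+1) - I1 (g k) - ta_mul (F (g k)) (X (g k.+1) - X (g k))) -
      (I2 (g k.+1) - I2 (g k) - ta_mul (F (g k)) (X (g k.+1) - X (g k)))) by hring.
  apply: le_trans (ler_normD _ _) _; apply: le_trans (lerD h3 (ler_normB _ _)) _.
  apply: le_trans (lerD (lexx _) (lerD h1 h2)) _.
  move: (om (g k)) (om (g k.+1)) h4 h5 => a b h4 h5.
  have : K * L * (b - a) * (b - a) <= K * L * mu * (b - a).
    by rewrite ler_wpM2r ?subr_ge0// ler_wpM2l ?mulr_ge0// ltW.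
  by move: (mu) h4 => m h4; lra.
have := Dk _ (leqnn _); rewrite /g gridN => /le_trans; apply.
have -> : K * (2 * L * mu + (e1 + e2)) * om t =
   (2 * K * L * om t) * mu + K * (e1 + e2) * om t by ring.
rewrite addrC lerD2l /mu mulrCA ler_piMr// ?(ltW e0)//.
by rewrite ler_pdivrMr// mul1r lerDl.
Qed.

(** Truncating the nodes at [t] lets one grid of [[0, T]] serve every upper bound. *)
Definition grid_integral (N : nat) (t : R) : TV :=
  \sum_(i < N.+1) ta_mul (F (grid T N i))
    (X (Num.min (grid T N i.+1) t) - X (Num.min (grid T N i) t)).

(** Between [a] and [b] the sum runs over the clipped nodes [c]. For a cell not collapsed by
    clipping, the left node lies in [[a, b]], at cost [L (om b - om a)], or the cell straddles [a],
    at cost [L mu]. *)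
Lemma grid_integral_primitive N mu : 0 <= mu ->
  (forall k, (k <= N)%N -> om (grid T N k.+1) - om (grid T N k) <= mu) ->
  primitive (L * mu) (grid_integral N).
Proof.
move=> mu0 mesh a b a0 ab bT; set g := grid T N.
pose c i := Num.max a (Num.min (g i) b).
have cl s : X (Num.min s b) - X (Num.min s a) = X (Num.max a (Num.min s b)) - X a.
  have [sa|sa] := leP s a.
    by rewrite (min_l (le_trans sa ab)) (max_l sa) !subrr.
  by congr (_ - _); rewrite max_r// le_min ab (ltW sa).
have cab i : a <= c i <= b.
  by rewrite /c le_max lexx /= ge_max ab ge_min lexx orbT.
have g_le i : g i <= g i.+1 by exact: grid_leS.
have cle i : c i <= c i.+1 by rewrite /c ge_max le_max lexx /= le_max le_min !ge_min g_le lexx !orbT.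
have c0 : c 0%N = a by rewrite /c /g grid0 min_l ?max_l// (le_trans a0).
have cN : c N.+1 = b by rewrite /c /g gridN min_r ?max_r.
have e1 : grid_integral N b - grid_integral N a =
    \sum_(i < N.+1) ta_mul (F (g i)) (X (c i.+1) - X (c i)).
  rewrite /grid_integral -sumrB; apply: eq_bigr => i _.
  rewrite -ta_mulBr -/g; congr ta_mul.
  have h1 := cl (g i.+1); have h2 := cl (g i).
  have -> : X (c i.+1) - X (c i) = (X (c i.+1) - X a) - (X (c i) - X a) by hring.
  by rewrite -h1 -h2; hring.
have tel (W : zmodType) (f : nat -> W) : \sum_(i < N.+1) (f i.+1 - f i) = f N.+1 - f 0%N.
  by rewrite -(big_mkord predT (fun i => f i.+1 - f i)) telescope_sumr.
have e2 : ta_mul (F a) (X b - X a) = \sum_(i < N.+1) ta_mul (F a) (X (c i.+1) - X (c i)).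
  by rewrite -ta_mul_sumr (tel _ (fun i => X (c i))) c0 cN.
rewrite e1 e2 -sumrB.
apply: le_trans (ler_norm_sum _ _ _) _.
have -> : K * (L * (om b - om a) + L * mu) * (om b - om a) =
    \sum_(i < N.+1) K * (L * (om b - om a) + L * mu) * (om (c i.+1) - om (c i)).
  by rewrite -mulr_sumr (tel _ (fun i => om (c i))) c0 cN.
apply: ler_sum => i _; rewrite -ta_mulBl ta_norm_mul.
have [/andP[ca cb] /andP[cSa cSb]] := (cab i, cab i.+1).
have c_ge0 : 0 <= c i by exact: le_trans ca.
have hX := lX c_ge0 (cle i) (le_trans cSb bT).
have oab := om_le a0 ab bT.
have oc := om_le c_ge0 (cle i) (le_trans cSb bT).
suff hF : c i = c i.+1 \/ `|F (g i) - F a| <= L * (om b - om a) + L * mu.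
  case: hF => [ci|hF]; first by rewrite -ci !subrr normr0 !mulr0.
  apply: le_trans (ler_pM _ _ hF hX) _ => //.
  by rewrite le_eqVlt; apply/orP; left; apply/eqP; ring.
have L1 : 0 <= L * (om b - om a) by rewrite mulr_ge0// subr_ge0.
have L2 : 0 <= L * mu by rewrite mulr_ge0.
have gi0 : 0 <= g i by exact: grid_ge0.
have [bg|gb] := leP b (g i).
  by left; rewrite /c !min_r// (le_trans bg).
have [ag|ga] := leP a (g i).
  right; apply: le_trans (lF a0 ag (le_trans (ltW gb) bT)) _.
  by rewrite -[leLHS]addr0 lerD// ler_wpM2l// lerD2r om_le// ltW.
have [gSa|agS] := leP (g i.+1) a.
  by left; rewrite /c !min_l ?(le_trans gSa)// ?(ltW gb)// !max_l// ltW.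
right; rewrite distrC; apply: le_trans (lF gi0 (ltW ga) (le_trans ab bT)) _.
rewrite -[leLHS]add0r lerD// ler_wpM2l//.
have iN : (i <= N)%N by rewrite -ltnS ltn_ord.
apply: le_trans (mesh i iN); rewrite lerD2r om_le ?(ltW agS)//.
by apply: grid_le.
Qed.

Lemma primitive_exists : exists I : R -> TV, primitive 0 I /\ I 0 = 0.
Proof.
have IN0 N : grid_integral N 0 = 0.
  rewrite /grid_integral big1// => i _.
  by rewrite !min_r ?grid_ge0// subrr ta_mul0r.
have oT0 : 0 <= om T by exact: control_ge0 om_c T0 (lexx T).
have prim e : 0 < e -> exists N0, forall N, (N0 <= N)%N -> primitive e (grid_integral N).
  move=> e0; have L1 : 0 < L + 1 by rewrite ltr_wpDl.
  have [N0 HN0] := grid_mesh om_c T0 (lexx T) (divr_gt0 e0 L1).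
  exists N0 => N NN.
  have m0 : 0 <= e / (L + 1) by rewrite ltW// divr_gt0.
  have := @grid_integral_primitive N (e / (L + 1)) m0 (fun k kN => ltW (HN0 N NN k kN)).
  move=> p a b a0 ab bT; apply: le_trans (p a b a0 ab bT) _.
  rewrite ler_wpM2r ?subr_ge0 ?om_le// ler_wpM2l// lerD2l.
  by rewrite mulrCA ler_piMr ?(ltW e0)// ler_pdivrMr// mul1r lerDl.
have cauchy t : 0 <= t -> t <= T -> forall e, 0 < e -> exists N0, forall m n,
    (N0 <= m)%N -> (N0 <= n)%N -> `|grid_integral m t - grid_integral n t| <= e.
  move=> t0 tT e e0.
  have k0 : 0 <= 2 * K * om T by rewrite !mulr_ge0.
  have k1 : 0 < 2 * K * om T + 1 by rewrite ltr_wpDl.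
  have d0 := divr_gt0 e0 k1; have [N0 HN0] := prim _ d0.
  exists N0 => m n /HN0 pm /HN0 pn.
  apply: le_trans (primitive_diff (ltW d0) (ltW d0) pm pn _ t0 tT) _; first by rewrite !IN0.
  apply: le_trans (_ : _ <= (2 * K * om T) * (e / (2 * K * om T + 1))) _.
    have : K * om t * (e / (2 * K * om T + 1)) <= K * om T * (e / (2 * K * om T + 1)).
      by rewrite ler_wpM2r ?(ltW d0)// ler_wpM2l// control_le.
    move: (e / _) => d; lra.
  by rewrite mulrCA ler_piMr ?(ltW e0)// ler_pdivrMr// mul1r lerDl.
have /choice[I HI] : forall t, exists l : TV, 0 <= t -> t <= T -> grid_integral ^~ t @ \oo --> l.
  move=> t; have [/andP[t0 tT]|nt] := boolP (0 <= t <= T).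
    by have [l Hl] := cauchy_seq_cvg (cauchy t t0 tT); exists l.
  by exists 0 => t0 tT; rewrite t0 tT in nt.
exists I; split; last first.
  have c1 := HI 0 (lexx _) T0.
  have c2 : grid_integral ^~ 0 @ \oo --> (0 : TV).
    by under eq_fun do rewrite IN0; exact: cvg_cst.
  by rewrite -(cvg_lim _ c1)// (cvg_lim _ c2).
move=> a b a0 ab bT; rewrite addr0; apply: le_of_eps => e e0.
have oab : 0 <= K * (om b - om a) by rewrite mulr_ge0// subr_ge0 om_le.
have k1 : 0 < K * (om b - om a) + 1 by rewrite ltr_wpDl.
have [N0 HN0] := prim _ (divr_gt0 e0 k1).
have cab : (fun N => grid_integral N b - grid_integral N a - ta_mul (F a) (X b - X a))
    @ \oo --> I b - I a - ta_mul (F a) (X b - X a).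
  apply: cvgB; last exact: cvg_cst.
  apply: cvgB; first by apply: HI => //; exact: le_trans ab.
  by apply: HI => //; exact: le_trans bT.
apply: (norm_lim_le (N := N0) cab) => N NN.
apply: le_trans (HN0 N NN a b a0 ab bT) _.
have : K * (om b - om a) * (e / (K * (om b - om a) + 1)) <= e.
  by rewrite mulrCA ler_piMr ?(ltW e0)// ler_pdivrMr// mul1r lerDl.
by move: (e / _) => d; lra.
Qed.

Context (I : R -> TV).
Hypotheses (pI : primitive 0 I) (I0 : I 0 = 0).

Lemma primitive_lipc (B : R) : (forall t, 0 <= t -> t <= T -> `|F t| <= B) ->
  lipc T om (B * K + K * L * om T) I.
Proof.
move=> FB s t s0 st tT; have := pI s0 st tT; rewrite addr0 => h.
have ost := om_le s0 st tT.
have h1 : `|ta_mul (F s) (X t - X s)| <= B * K * (om t - om s).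
  rewrite ta_norm_mul -mulrA ler_pM//; first by apply: FB => //; exact: le_trans tT.
  exact: lX.
have -> : I t - I s = (I t - I s - ta_mul (F s) (X t - X s)) + ta_mul (F s) (X t - X s).
  by rewrite subrK.
apply: le_trans (ler_normD _ _) _; apply: le_trans (lerD h h1) _.
rewrite addrC mulrDl lerD2l ler_wpM2r ?subr_ge0//.
rewrite mulrA ler_wpM2l ?mulr_ge0// lerBlDr.
have := control_le om_c (le_trans s0 st) tT.
have := control_ge0 om_c s0 (le_trans st tT); lra.
Qed.

(** On each cell, moving the tag [xi i] to the left end and the local error of [I] both cost
    [K L mu] times the increment of [om], hence the [2 * K * L]. *)
Lemma primitive_RS t : 0 <= t -> t <= T -> is_RS_integral F X 0 t (I t).
Proof.
move=> t0 tT e e0.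
have ot0 := control_ge0 om_c t0 tT.
have k0 : 0 <= 2 * K * L * om t by rewrite !mulr_ge0.
have k1 : 0 < 2 * K * L * om t + 1 by rewrite ltr_wpDl.
have [_ _ /(_ _ (divr_gt0 e0 k1))[rho rho0 Hrho]] := om_c.
set mu := e / _ in Hrho; have mu0 : 0 < mu by exact: divr_gt0.
exists rho => // s xi ps Hs; set P := fun i => nth t (0 :: s) i.
have P0 : P 0%N = 0 by [].
have PS : P (size s) = t by rewrite /P -[size s]/((size (0 :: s)).-1) nth_last /=;
  case: ps => _ /eqP.
have Pge i : (i <= size s)%N -> 0 <= P i.
  by move=> si; apply: (itv_partition_nth_ge _ ps).
have Ple i : (i <= size s)%N -> P i <= t.
  by move=> si; apply: (itv_partition_nth_le _ ps).
have tel (W : zmodType) (f : nat -> W) :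
    \sum_(0 <= i < size s) (f i.+1 - f i) = f (size s) - f 0%N.
  by rewrite telescope_sumr.
have -> : RS_sum F X 0 t s xi - I t = \sum_(0 <= i < size s)
    (ta_mul (F (xi i)) (X (P i.+1) - X (P i)) - (I (P i.+1) - I (P i))).
  rewrite sumrB (tel _ (fun i => I (P i))) PS P0 I0 subr0 //.
apply: le_lt_trans (ler_norm_sum _ _ _) _.
apply: (@le_lt_trans _ _ (\sum_(0 <= i < size s) 2 * K * L * mu * (om (P i.+1) - om (P i)))).
  rewrite big_nat [leRHS]big_nat; apply: ler_sum => i /andP[_ si].
  have [h1 /andP[h2 h3]] := Hs i si; rewrite -/(P i.+1) -/(P i) in h1 h2 h3.
  have Pi0 := Pge i (ltnW si); have PT := le_trans (Ple _ si) tT.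
  have PP := le_trans h2 h3.
  have h4 := Hrho _ _ Pi0 PP PT h1.
  have h5 := pI Pi0 PP PT; rewrite addr0 in h5.
  have h6 := lF Pi0 h2 (le_trans h3 PT).
  have h7 := lX Pi0 PP PT.
  have h8 := om_le (le_trans Pi0 h2) h3 PT.
  have h9 := om_le Pi0 PP PT.
  have -> : ta_mul (F (xi i)) (X (P i.+1) - X (P i)) - (I (P i.+1) - I (P i)) =
    ta_mul (F (xi i) - F (P i)) (X (P i.+1) - X (P i)) -
    (I (P i.+1) - I (P i) - ta_mul (F (P i)) (X (P i.+1) - X (P i))).
    by rewrite ta_mulBl; hring.
  apply: le_trans (ler_normB _ _) _; rewrite ta_norm_mul.
  have h10 : `|F (xi i) - F (P i)| <= L * mu.
    apply: le_trans h6 _; rewrite ler_wpM2l//; apply/ltW; apply: le_lt_trans h4.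
    by rewrite lerD2r.
  apply: le_trans (lerD (ler_pM _ _ h10 h7) h5) _ => //.
  have : K * (L * (om (P i.+1) - om (P i))) * (om (P i.+1) - om (P i)) <=
         K * (L * mu) * (om (P i.+1) - om (P i)).
    by rewrite ler_wpM2r ?subr_ge0// ler_wpM2l// ler_wpM2l// ltW.
  by move: (om (P i.+1)) (om (P i)) mu {h4 h10 Hrho mu0} => x y m; lra.
rewrite -mulr_sumr (tel _ (fun i => om (P i))) PS P0 om0 subr0.
rewrite mulrAC /mu mulrCA -[ltRHS]mulr1 ltr_pM2l//.
by rewrite ltr_pdivrMr// mul1r ltrDl.
Qed.

Lemma primitive_grid_sum N mu k : 0 <= mu ->
  (forall j, (j <= N)%N -> om (grid T N j.+1) - om (grid T N j) <= mu) ->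
  (k <= N.+1)%N ->
  `|I (grid T N k) - \sum_(j < k) ta_mul (F (grid T N j)) (X (grid T N j.+1) - X (grid T N j))|
    <= K * L * mu * om (grid T N k).
Proof.
move=> mu0 mesh; set g := grid T N.
elim: k => [_|k IH kN]; first by rewrite /g grid0 big_ord0 subr0 I0 normr0 om0 mulr0.
rewrite big_ord_recr /=.
have gk0 : 0 <= g k by exact: grid_ge0.
have gkS : g k <= g k.+1 by exact: grid_leS.
have gkT : g k.+1 <= T by exact: grid_le.
have h1 := pI gk0 gkS gkT; rewrite addr0 in h1.
have h2 := IH (ltnW kN); have h3 := mesh k kN; have h4 := om_le gk0 gkS gkT.
rewrite (_ : I _ - _ = (I (g k) - \sum_(j < k) ta_mul (F (g j)) (X (g j.+1) - X (g j))) +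
  (I (g k.+1) - I (g k) - ta_mul (F (g k)) (X (g k.+1) - X (g k)))); last by hring.
apply: le_trans (ler_normD _ _) _; apply: le_trans (lerD h2 h1) _.
have : K * (L * (om (g k.+1) - om (g k))) * (om (g k.+1) - om (g k)) <=
       K * (L * mu) * (om (g k.+1) - om (g k)).
  by rewrite ler_wpM2r ?subr_ge0// ler_wpM2l// ler_wpM2l.
move: (om (g k.+1)) (om (g k)) => x y; lra.
Qed.

End Primitive.

(** Both values are close to the same sum over one fine grid. Partitions increase strictly, so
    [t = 0] uses the empty one. *)
Lemma is_RS_integral_unique (R : realType) (V : hilbert R) (TV : tensor_algebra V)
    (F : R -> TV) (X : R -> V) (t : R) (I1 I2 : TV) : 0 <= t ->
  is_RS_integral F X 0 t I1 -> is_RS_integral F X 0 t I2 -> I1 = I2.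
Proof.
move=> t0 h1 h2; apply/eqP; rewrite -subr_eq0 -normr_le0; apply: le_of_eps => e e0.
rewrite add0r; have e2 : 0 < e / 2 by rewrite divr_gt0.
have [d1 d10 H1] := h1 _ e2; have [d2 d20 H2] := h2 _ e2.
suff [s [xi [ps Hs1 Hs2]]] : exists s xi, [/\ itv_partition 0 t s,
   forall i, (i < size s)%N -> nth t (0 :: s) i.+1 - nth t (0 :: s) i < d1 /\
     nth t (0 :: s) i <= xi i <= nth t (0 :: s) i.+1 &
   forall i, (i < size s)%N -> nth t (0 :: s) i.+1 - nth t (0 :: s) i < d2 /\
     nth t (0 :: s) i <= xi i <= nth t (0 :: s) i.+1].
  have a1 := H1 _ _ ps Hs1; have a2 := H2 _ _ ps Hs2.
  apply: le_trans (ler_distD (RS_sum F X 0 t s xi) _ _) _.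
  by rewrite distrC [e]splitr lerD// ltW.
have [->|tn0] := eqVneq t 0.
  by exists [::], (fun=> 0); split=> //; split=> //=.
have {}t0 : 0 < t by rewrite lt_def tn0.
pose d := Num.min d1 d2; have d0 : 0 < d by rewrite lt_min d10.
have := @cvg_harmonicM R t => /cvgrPdist_lt /(_ d d0) [N _ /(_ N (leqnn N))] /=.
rewrite sub0r normrN ger0_norm ?divr_ge0 ?ltW// lt_min => /andP[a1 a2].
exists (grid_seq t N), (grid t N).
split; first exact: grid_partition.
  move=> i; rewrite size_grid_seq => iN.
  by rewrite -[nth t (grid_seq t N) i]/(nth t (0 :: grid_seq t N) i.+1)
    (nth_grid t t iN) (nth_grid t t (ltnW iN)) grid_step lexx grid_leS// ltW.
move=> i; rewrite size_grid_seq => iN.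
by rewrite -[nth t (grid_seq t N) i]/(nth t (0 :: grid_seq t N) i.+1)
    (nth_grid t t iN) (nth_grid t t (ltnW iN)) grid_step lexx grid_leS// ltW.
Qed.

Lemma RS_integralE (R : realType) (V : hilbert R) (TV : tensor_algebra V)
    (F : R -> TV) (X : R -> V) (t : R) (I : TV) : 0 <= t ->
  is_RS_integral F X 0 t I -> RS_integral F X 0 t = I.
Proof.
move=> t0 hI; rewrite /RS_integral; case: xgetP => [J _ hJ|/(_ I)//].
exact: is_RS_integral_unique hJ hI.
Qed.

(** * Discrete signatures and their convergence *)

Section DiscreteSignature.
Context (R : realType) (V : hilbert R) (TV : tensor_algebra V).
Implicit Types (dX : nat -> V) (a : nat -> R).

Fixpoint zlev dX (m k : nat) : TV :=
  if m is m'.+1 then \sum_(j < k) ta_mul (zlev dX m' j) (dX j) else ta_one TV.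

Fixpoint zprod dX (k : nat) : TV :=
  if k is k'.+1 then zprod dX k' + ta_mul (zprod dX k') (dX k') else ta_one TV.

(** The product of the factors [1 + dX j] expanded by degree. Level [m] vanishes for [m > k], so
    every [M > k] collects all of them. *)
Lemma sum_zlev dX k M : (k < M)%N -> \sum_(m < M) zlev dX m k = zprod dX k.
Proof.
elim: k M => [|k IH] [|M] // kM.
  rewrite big_ord_recl /= big1 ?addr0// => i _.
  by rewrite /= big_ord0.
rewrite big_ord_recl /=.
under eq_bigr => i _ do rewrite big_ord_recr /=.
rewrite big_split /= addrA -ta_mul_suml (IH M)// -(IH M.+1 (ltnW kM)).
by rewrite big_ord_recl.
Qed.

Section Bounds.
Context (dX : nat -> V) (a : nat -> R) (K : R) (n : nat).
Hypotheses (K0 : 0 <= K) (a0 : a 0%N = 0)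
  (aS : forall j, (j < n)%N -> a j <= a j.+1)
  (dXa : forall j, (j < n)%N -> `|dX j| <= K * (a j.+1 - a j)).

Let exp_step (x y : R) : expR x * y <= expR (x + y) - expR x.
Proof.
rewrite expRD -[X in _ - X]mulr1 -mulrBr ler_wpM2l ?expR_ge0// lerBrDl.
exact: expR_ge1Dx.
Qed.

(** The natural bound [(K a)^m / m!] is relaxed to [2^-m exp(2 K a)]: the exponential makes the
    induction telescope, and the powers of 1/2 make the tails geometric. *)
Lemma zlev_norm m k : (k <= n)%N ->
  `|zlev dX m k| <= 2^-1 ^+ m * expR (2 * K * a k).
Proof.
have a_ge0 j : (j <= n)%N -> 0 <= a j.
  elim: j => [|j IH] jn; first by rewrite a0.
  by apply: le_trans (aS jn); apply: IH; exact: ltnW.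
elim: m k => [|m IH] k kn.
  rewrite ta_norm1 expr0 mul1r -expR0 ler_expR.
  by rewrite mulr_ge0 ?mulr_ge0 ?a_ge0.
rewrite /=; apply: le_trans (ler_norm_sum _ _ _) _.
apply: (@le_trans _ _ (\sum_(j < k) 2^-1 ^+ m.+1 *
    (expR (2 * K * a j.+1) - expR (2 * K * a j)))).
  apply: ler_sum => j _; have jn : (j < n)%N by apply: leq_trans kn.
  rewrite ta_norm_mul; apply: le_trans (ler_pM _ _ (IH j (ltnW jn)) (dXa jn)) _ => //.
  rewrite exprSr -(mulrA _ 2^-1) -(mulrA (2^-1 ^+ m)) ler_wpM2l ?exprn_ge0//.
  have := exp_step (2 * K * a j) (2 * K * (a j.+1 - a j)).
  rewrite (_ : 2 * K * a j + 2 * K * (a j.+1 - a j) = 2 * K * a j.+1); last by ring.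
  by move: (expR _) (expR _) => x y; lra.
rewrite -mulr_sumr -(big_mkord predT (fun j => expR (2 * K * a j.+1) - expR (2 * K * a j))).
rewrite telescope_sumr// ler_wpM2l ?exprn_ge0// lerBlDr lerDl expR_ge0//.
Qed.

Lemma zprod_norm k : (k <= n)%N -> `|zprod dX k| <= expR (K * a k).
Proof.
elim: k => [_|k IH kn]; first by rewrite a0 mulr0 expR0 ta_norm1.
have h := IH (ltnW kn) => /=.
apply: le_trans (ler_normD _ _) _; rewrite ta_norm_mul.
have h2 := dXa kn.
apply: le_trans (lerD h (ler_pM _ _ h h2)) _ => //.
have := exp_step (K * a k) (K * (a k.+1 - a k)).
by rewrite -mulrDr (addrC (a k)) subrK; lra.
Qed.

Lemma geometric_sum_le (q M : nat) : \sum_(m < q) 2^-1 ^+ (M + m) <= 2 * 2^-1 ^+ M :> R.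
Proof.
suff -> : \sum_(m < q) 2^-1 ^+ (M + m) = 2 * 2^-1 ^+ M - 2 * 2^-1 ^+ (M + q) :> R.
  by rewrite lerBlDr lerDl mulr_ge0// exprn_ge0.
elim: q => [|q IH]; first by rewrite big_ord0 addn0 subrr.
rewrite big_ord_recr /= IH addnS exprS; move: (2^-1 ^+ _) (2^-1 ^+ _) => x y; lra.
Qed.

Lemma zprod_tail k M : (k <= n)%N ->
  `|zprod dX k - \sum_(m < M) zlev dX m k| <= 2 * 2^-1 ^+ M * expR (2 * K * a k).
Proof.
(* Enough levels for [sum_zlev], and at least [M] of them. *)
move=> kn; rewrite -(@sum_zlev dX k (M + k.+1)) ?leq_addl//.
rewrite big_split_ord /= addrAC subrr add0r.
apply: le_trans (ler_norm_sum _ _ _) _.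
apply: (@le_trans _ _ (\sum_(i < k.+1) 2^-1 ^+ (M + i) * expR (2 * K * a k))).
  by apply: ler_sum => i _; exact: zlev_norm.
by rewrite -mulr_suml ler_wpM2r ?expR_ge0// geometric_sum_le.
Qed.

End Bounds.

Lemma geometric_series_cvg (u : nat -> TV) (E : R) :
  (forall m, `|u m| <= 2^-1 ^+ m * E) ->
  exists2 l : TV, series u @ \oo --> l &
    forall M, `|l - series u M| <= 2 * 2^-1 ^+ M * E.
Proof.
move=> uE; have E0 : 0 <= E by have := uE 0%N; rewrite expr0 mul1r; apply: le_trans.
have tail M n : (M <= n)%N -> `|series u n - series u M| <= 2 * 2^-1 ^+ M * E.
  move=> /subnKC <-; rewrite /series /= !big_mkord big_split_ord /= addrAC subrr add0r.
  apply: le_trans (ler_norm_sum _ _ _) _.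
  apply: (@le_trans _ _ (\sum_(i < n - M) 2^-1 ^+ (M + i) * E)).
    by apply: ler_sum => i _; exact: uE.
  by rewrite -mulr_suml ler_wpM2r// geometric_sum_le.
have [l ul] : exists l : TV, series u @ \oo --> l.
  apply: cauchy_seq_cvg => e e0.
  have := @cvg_geometricM R (4 * E) => /cvgrPdist_lt /(_ e e0) [N _ /(_ N (leqnn N))] /=.
  rewrite sub0r normrN ger0_norm ?mulr_ge0// => h.
  exists N => m n Nm Nn; apply: le_trans (ler_distD (series u N) _ _) _.
  rewrite [X in _ + X]distrC.
  apply: le_trans (lerD (tail _ _ Nm) (tail _ _ Nn)) _.
  by apply/ltW; apply: le_lt_trans h; move: (2^-1 ^+ N) => x; lra.
exists l => // M.
have c : (fun n => series u n - series u M) @ \oo --> l - series u M.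
  by apply: cvgB => //; exact: cvg_cst.
by apply: (norm_lim_le (N := M) c) => n; exact: tail.
Qed.

End DiscreteSignature.

Section SignatureConvergence.
Context (R : realType) (V : hilbert R) (TV : tensor_algebra V) (T : R) (om : R -> R).
Context (X : R -> V) (K : R).
Hypotheses (T0 : 0 <= T) (om_c : control T om) (K0 : 0 <= K) (lX : lipc T om K X).

Definition incr (N j : nat) : V := X (grid T N j.+1) - X (grid T N j).

Lemma control_grid_mono N j : (j < N.+1)%N -> om (grid T N j) <= om (grid T N j.+1).
Proof.
move=> jN; case: om_c => _ + _; apply; rewrite ?grid_ge0 ?grid_leS//.
exact: grid_le.
Qed.

Lemma norm_incr N j : (j < N.+1)%N ->
  `|incr N j| <= K * (om (grid T N j.+1) - om (grid T N j)).
Proof.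
move=> jN; apply: lX; rewrite ?grid_ge0 ?grid_leS//.
exact: grid_le.
Qed.

Lemma sum_control_grid N k : \sum_(j < k) (om (grid T N j.+1) - om (grid T N j)) = om (grid T N k).
Proof.
rewrite -(big_mkord predT (fun j => om (grid T N j.+1) - om (grid T N j))).
by rewrite telescope_sumr// grid0; case: om_c => -> _ _; rewrite subr0.
Qed.

(** Induction on the level: the Lipschitz property of one level makes the next integral exist, and
    uniformity over the nodes is what lets its errors be summed along the grid. *)
Lemma sig_level_approx m : exists L : R, [/\ 0 <= L,
  lipc T om L (sig_level TV X 0 m) &
  forall e : R, 0 < e -> exists N0, forall N, (N0 <= N)%N -> forall k, (k <= N.+1)%N ->
    `|sig_level TV X 0 m (grid T N k) - zlev TV (incr N) m k| <= e].
Proof.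
have oT : 0 <= om T by exact: control_ge0 om_c T0 (lexx T).
elim: m => [|m [L [L0 lF conv]]].
  exists 0; split => // [s t _ _ _|e e0]; first by rewrite /= subrr normr0 mul0r.
  by exists 0%N => N _ k _; rewrite /= subrr normr0 ltW.
set F := sig_level TV X 0 m in lF conv.
have [I [pI I0]] := primitive_exists T0 om_c K0 L0 lF lX.
have SI t : 0 <= t -> t <= T -> sig_level TV X 0 m.+1 t = I t.
  move=> t0 tT /=; apply: RS_integralE => //.
  exact: (primitive_RS om_c K0 L0 lF lX pI I0).
pose B := `|F 0| + L * om T.
have FB t : 0 <= t -> t <= T -> `|F t| <= B.
  move=> t0 tT; have -> : F t = F 0 + (F t - F 0) by rewrite addrC subrK.
  apply: le_trans (ler_normD _ _) _; rewrite lerD2l.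
  apply: le_trans (lF _ _ (lexx _) t0 tT) _; rewrite ler_wpM2l//.
  by case: om_c => -> _ _; rewrite subr0; exact: control_le.
have B0 : 0 <= B by rewrite addr_ge0// mulr_ge0.
exists (B * K + K * L * om T); split.
- by rewrite addr_ge0// ?mulr_ge0.
- move=> s t s0 st tT; rewrite (SI t (le_trans s0 st) tT) (SI s s0 (le_trans st tT)).
  exact: (primitive_lipc om_c K0 L0 lX pI FB).
move=> e e0.
(* [K * L] pays for the Riemann sum of the exact integrand, [K] for replacing this integrand by the
   discrete level. *)
have q0 : 0 <= (K * L + K) * om T by rewrite mulr_ge0// addr_ge0// mulr_ge0.
have q1 : 0 < (K * L + K) * om T + 1 by rewrite ltr_wpDl.
have d0 := divr_gt0 e0 q1.
have [N1 HN1] := conv _ d0; have [N2 HN2] := grid_mesh om_c T0 (lexx T) d0.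
exists (maxn N1 N2) => N; rewrite geq_max => /andP[NN1 NN2] k kN.
have gkT : grid T N k <= T by exact: grid_le.
rewrite SI ?grid_ge0//.
have h1 := primitive_grid_sum T0 om_c K0 L0 pI I0 (ltW d0)
  (fun j jN => ltW (HN2 N NN2 j jN)) kN.
apply: le_trans (ler_distD (\sum_(j < k) ta_mul (F (grid T N j)) (incr N j)) _ _) _.
have h2 : `|\sum_(j < k) ta_mul (F (grid T N j)) (incr N j) - zlev TV (incr N) m.+1 k| <=
    \sum_(j < k) e / ((K * L + K) * om T + 1) * (K * (om (grid T N j.+1) - om (grid T N j))).
  rewrite /= -sumrB; apply: le_trans (ler_norm_sum _ _ _) _.
  apply: ler_sum => j _; rewrite -ta_mulBl ta_norm_mul.
  have jN : (j < N.+1)%N by apply: leq_trans kN.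
  by rewrite ler_pM// ?HN1// ?norm_incr// ltnW.
apply: le_trans (lerD h1 h2) _.
rewrite -!mulr_sumr sum_control_grid.
have h3 : om (grid T N k) <= om T by apply: control_le; rewrite ?grid_ge0.
have h4 : (K * L + K) * om T * (e / ((K * L + K) * om T + 1)) <= e.
  by rewrite mulrCA ler_piMr ?(ltW e0)// ler_pdivrMr// mul1r lerDl.
apply: le_trans h4; move: (e / _) (ltW d0) => d d0'.
have : (K * L + K) * d * om (grid T N k) <= (K * L + K) * d * om T.
  by rewrite ler_wpM2l// mulr_ge0// addr_ge0// mulr_ge0.
by lra.
Qed.

(** The tails beyond level [M] are small uniformly in [N], on the discrete and on the continuous
    side, so [M] is fixed first and only finitely many levels have to converge. *)
Lemma signature_cvg :
  (fun N => zprod TV (incr N) N.+1) @ \oo --> signature TV X 0 T.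
Proof.
pose E := expR (2 * K * om T).
have o0 N : om (grid T N 0) = 0 by rewrite grid0; case: om_c.
have zl N m : `|zlev TV (incr N) m N.+1| <= 2^-1 ^+ m * E.
  have := @zlev_norm _ _ TV (incr N) (fun k => om (grid T N k)) K N.+1 K0 (o0 N)
   (@control_grid_mono N) (@norm_incr N) m N.+1 (leqnn _).
  by rewrite gridN.
have lev_cvg m e : 0 < e -> exists N0, forall N, (N0 <= N)%N ->
    `|sig_level TV X 0 m T - zlev TV (incr N) m N.+1| <= e.
  move=> e0; have [L [_ _ /(_ _ e0)[N0 HN0]]] := sig_level_approx m.
  by exists N0 => N NN; have := HN0 N NN N.+1 (leqnn _); rewrite gridN.
have sl m : `|sig_level TV X 0 m T| <= 2^-1 ^+ m * E.
  apply: le_of_eps => e /(lev_cvg m)[N0 /(_ N0 (leqnn _)) h].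
  rewrite -(subrK (zlev TV (incr N0) m N0.+1) (sig_level _ _ _ _ _)) addrC.
  by apply: le_trans (ler_normD _ _) _; rewrite lerD.
have [l sl_l tail] := geometric_series_cvg sl.
have -> : signature TV X 0 T = l by exact: cvg_lim sl_l.
apply/cvg_seqP => e e0.
have E0 : 0 <= E by exact: expR_ge0.
have e4 : 0 < e / 4 by rewrite divr_gt0.
have := @cvg_geometricM R (2 * E) => /cvgrPdist_lt /(_ _ e4) [M _ /(_ M (leqnn M))] /=.
rewrite sub0r normrN ger0_norm ?mulr_ge0// => hM.
have e4M : 0 < e / 4 / M.+1%:R by rewrite divr_gt0.
have /choice[c Hc] : forall m, exists N0, forall N, (N0 <= N)%N ->
    `|sig_level TV X 0 m T - zlev TV (incr N) m N.+1| <= e / 4 / M.+1%:R.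
  by move=> m; exact: lev_cvg.
exists (\max_(m < M) c m) => N NN.
have h1 := @zprod_tail _ _ TV (incr N) (fun k => om (grid T N k)) K N.+1 K0 (o0 N)
   (@control_grid_mono N) (@norm_incr N) N.+1 M (leqnn _).
rewrite gridN -/E in h1.
have h2 := tail M; rewrite distrC in h2.
have h3 : `|\sum_(m < M) zlev TV (incr N) m N.+1 - series (fun m => sig_level TV X 0 m T) M| <= e / 4.
  rewrite /series /= big_mkord -sumrB; apply: le_trans (ler_norm_sum _ _ _) _.
  apply: (@le_trans _ _ (\sum_(m < M) e / 4 / M.+1%:R)).
    apply: ler_sum => m _; rewrite distrC; apply: Hc.
    by apply: leq_trans NN; exact: leq_bigmax.
  rewrite sumr_const card_ord -[leLHS]mulr_natl mulrCA ler_piMr ?(ltW e4)//.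
  by rewrite ler_pdivrMr// mul1r ler_nat.
have tri (x y z w : TV) : `|x - w| <= `|x - y| + `|y - z| + `|z - w|.
  by rewrite (le_trans (ler_distD y _ _))// -addrA lerD2l ler_distD.
apply: le_lt_trans (tri _ (\sum_(m < M) zlev TV (incr N) m N.+1)
  (series (fun m => sig_level TV X 0 m T) M) _) _.
apply: le_lt_trans (lerD (lerD h1 h3) h2) _.
move: hM; move: (2^-1 ^+ M) => x; lra.
Qed.

End SignatureConvergence.

Section FdiffLipschitz.
Context (R : realType) (U W : normedModType R).

Lemma fd_bound_ge0 n (C : R) (f : U -> W) : fd_bound n C f -> 0 <= C.
Proof.
move=> fb; have := fb [::] isT 0; rewrite big_nil mulr1.
exact: le_trans.
Qed.

Lemma fd_bound_lipschitz n (C : R) (f : U -> W) x y :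
  fd_bound n.+1 C f -> `|f x - f y| <= C * `|x - y|.
Proof.
move=> fb; have := fb [:: x - y] isT y.
by rewrite big_seq1 /= (addrC y) subrK.
Qed.

(** Changing the base point, and then each direction in turn, costs one further difference of [f]:
    hence the order [n.+1] and the factor [rho + size us]. *)
Lemma fdiff_lipschitz n (us : seq (U * U * R)) (f : U -> W) (C rho dl : R) x x' :
  fd_bound n.+1 C f -> (size us <= n)%N -> 0 <= dl ->
  (forall p, p \in us -> [/\ `|p.1.1| <= p.2, `|p.1.2| <= p.2 &
     `|p.1.1 - p.1.2| <= p.2 * dl]) ->
  `|x - x'| <= rho * dl ->
  `|fdiff [seq p.1.1 | p <- us] f x - fdiff [seq p.1.2 | p <- us] f x'| <=
    C * (rho + (size us)%:R) * dl * \prod_(p <- us) p.2.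
Proof.
elim: us n f C => [|[[u u'] a] us IH] n f C fb su dl0 Hus xx' /=.
  rewrite big_nil mulr1 addr0 -mulrA.
  apply: le_trans (fd_bound_lipschitz _ _ fb) _.
  by rewrite ler_wpM2l// (fd_bound_ge0 fb).
case: n fb su => // n fb su.
have C0 := fd_bound_ge0 fb.
have [/= ua u'a uu'] := Hus _ (mem_head _ _).
have a0 : 0 <= a by exact: le_trans ua.
have Hus' p : p \in us -> [/\ `|p.1.1| <= p.2, `|p.1.2| <= p.2 &
     `|p.1.1 - p.1.2| <= p.2 * dl] by move=> pus; apply: Hus; rewrite in_cons pus orbT.
have P0 : 0 <= \prod_(p <- us) p.2.
  rewrite big_seq; apply: prodr_ge0 => p /Hus'[h _ _]; exact: le_trans h.
rewrite -!/(fdiff (_ :: _) _ _) !fdiff_head.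
set us1 := [seq p.1.1 | p <- us]; set us2 := [seq p.1.2 | p <- us].
pose G y := f (y + u) - f y.
have bG : fd_bound n.+1 (C * a) G.
  move=> vs sv y; rewrite -fdiff_head.
  apply: le_trans (fb (u :: vs) sv y) _.
  by rewrite big_cons mulrA ler_wpM2r ?prodr_ge0// ler_wpM2l.
have h1 := IH n G (C * a) bG su dl0 Hus' xx'.
have h2 : `|fdiff us2 G x' - fdiff us2 (fun y => f (y + u') - f y) x'| <=
    C * (a * dl) * \prod_(p <- us) p.2.
  (* A difference along [u] minus one along [u'] is a difference along [u - u'], taken from the
     point shifted by [u']. *)
  rewrite -fdiffB (@eq_fdiff _ _ _ _ (fun y => (fun z => f (z + (u - u')) - f z) (y + u'))).
    rewrite -(fdiff_shift us2 (fun z => f (z + (u - u')) - f z)) -fdiff_head.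
    apply: le_trans (fb (_ :: _) _ _) _.
      by rewrite /= /us2 size_map; exact: leqW su.
    rewrite big_cons [leLHS]mulrA; apply: ler_pM.
    - by rewrite mulr_ge0.
    - by rewrite prodr_ge0.
    - by rewrite ler_wpM2l.
    rewrite /us2 big_map big_seq [leRHS]big_seq; apply: ler_prod => p /Hus'[_ h _].
    by rewrite h normr_ge0.
  by move=> y; rewrite /G -(addrA y u') (addrC u') subrK opprB addrA subrK.
apply: le_trans (ler_distD (fdiff us2 G x') _ _) _.
apply: le_trans (lerD h1 h2) _.
by rewrite big_cons /= -natr1 le_eqVlt; apply/orP; left; apply/eqP; ring.
Qed.

End FdiffLipschitz.

(** * Stability of discrete signatures in the sup norm *)

Section DiscreteStability.
Context (R : realType) (V : hilbert R) (TV : tensor_algebra V).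
Context (dX dX' Y : nat -> V) (a a' : nat -> R) (K B y : R) (n : nat).
Hypotheses (K0 : 0 <= K) (B0 : 0 <= B) (y0 : 0 <= y).
Hypotheses (a0 : a 0%N = 0) (a'0 : a' 0%N = 0)
  (aS : forall j, (j < n)%N -> a j <= a j.+1)
  (aS' : forall j, (j < n)%N -> a' j <= a' j.+1)
  (dXa : forall j, (j < n)%N -> `|dX j| <= K * (a j.+1 - a j))
  (dXa' : forall j, (j < n)%N -> `|dX' j| <= K * (a' j.+1 - a' j))
  (YE : forall j, dX j - dX' j = Y j.+1 - Y j)
  (Yy : forall j, (j <= n)%N -> `|Y j| <= y)
  (ZB : forall j, (j <= n)%N -> `|zprod TV dX j| <= B).

Let Z := zprod TV dX.
Let Z' := zprod TV dX'.
Let D k := Z k - Z' k.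
Let A k := \sum_(j < k) ta_mul (Z j) (Y j.+1 - Y j).

(* Abel summation moves the difference of the driving paths off the increments. *)
Let A_norm k : (k <= n)%N -> `|A k| <= (2 * B + B * K * a k) * y.
Proof.
have AE : A k = ta_mul (Z k) (Y k) - ta_mul (Z 0%N) (Y 0%N) -
    \sum_(j < k) ta_mul (ta_mul (Z j) (dX j)) (Y j.+1).
  elim: k => [|k IH]; first by rewrite /A !big_ord0 subrr subr0.
  rewrite /A big_ord_recr /= -/(A k) IH big_ord_recr /= -/(Z k) ta_mulBr ta_mulDl.
  by hring.
move=> kn; rewrite AE.
apply: le_trans (ler_normB _ _) _; apply: le_trans (lerD (ler_normB _ _) (lexx _)) _.
have sum_a : \sum_(j < k) (a j.+1 - a j) = a k.
  by rewrite -(big_mkord predT (fun j => a j.+1 - a j)) telescope_sumr// a0 subr0.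
have h1 : `|ta_mul (Z k) (Y k)| <= B * y by rewrite ta_norm_mul ler_pM ?ZB ?Yy.
have h2 : `|ta_mul (Z 0%N) (Y 0%N)| <= B * y by rewrite ta_norm_mul ler_pM ?ZB ?Yy.
have h3 : `|\sum_(j < k) ta_mul (ta_mul (Z j) (dX j)) (Y j.+1)| <= B * K * a k * y.
  apply: le_trans (ler_norm_sum _ _ _) _.
  rewrite -sum_a mulr_sumr mulr_suml; apply: ler_sum => j _.
  have jn : (j < n)%N by apply: leq_trans kn.
  by rewrite !ta_norm_mul ler_pM ?mulr_ge0 ?Yy// -mulrA ler_pM ?dXa// ZB// ltnW.
by apply: le_trans (lerD (lerD h1 h2) h3) _; lra.
Qed.

Let D_rec k : D k = A k + \sum_(j < k) ta_mul (D j) (dX' j).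
Proof.
elim: k => [|k IH]; first by rewrite /D /A !big_ord0 /Z /Z' /= subrr addr0.
rewrite /D /A !big_ord_recr /= -/(A k) -/(Z k) -/(Z' k).
have -> : A k = D k - \sum_(j < k) ta_mul (D j) (dX' j) by rewrite [D k in RHS]IH addrK.
rewrite -YE -/(D k) /D !ta_mulBl !ta_mulBr.
by rewrite -/(D _); hring.
Qed.

(** Discrete Gronwall inequality: [D_rec] is a linear recursion with source [A], and its majorant
    [G] grows by a factor at most [1 + K (a' k.+1 - a' k)]. Of the difference of the driving paths
    only the sup norm [y] enters. *)
Lemma zprod_stability k : (k <= n)%N ->
  `|zprod TV dX k - zprod TV dX' k| <= (2 * B + B * K * a n) * y * expR (K * a' k).
Proof.
set r := (2 * B + B * K * a n) * y.
have a_le j : (j <= n)%N -> a j <= a n.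
  move=> jn; rewrite -(subnKC jn).
  have : (j + (n - j) <= n)%N by rewrite subnKC.
  elim: (n - j)%N => [|i IH] h; first by rewrite addn0.
  by rewrite addnS in h *; apply: le_trans (IH (ltnW h)) (aS h).
have Ar j : (j <= n)%N -> `|A j| <= r.
  move=> jn; apply: le_trans (A_norm jn) _.
  by rewrite ler_wpM2r// lerD2l ler_wpM2l ?mulr_ge0// a_le.
have r0 : 0 <= r by exact: le_trans (Ar 0%N isT).
pose G k := r + \sum_(j < k) `|D j| * (K * (a' j.+1 - a' j)).
have DG j : (j <= n)%N -> `|D j| <= G j.
  move=> jn; rewrite D_rec; apply: le_trans (ler_normD _ _) _.
  apply: lerD; first exact: Ar.
  apply: le_trans (ler_norm_sum _ _ _) _; apply: ler_sum => i _.
  by rewrite ta_norm_mul ler_wpM2l// dXa'// (leq_trans _ jn).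
move=> kn; apply: le_trans (DG k kn) _.
elim: k kn => [_|k IH kn].
  by rewrite /G big_ord0 addr0 a'0 mulr0 expR0 mulr1.
rewrite /G big_ord_recr /= addrA -/(G k).
have h1 := IH (ltnW kn); have h2 := DG k (ltnW kn).
have w0 : 0 <= K * (a' k.+1 - a' k) by rewrite mulr_ge0// subr_ge0 aS'.
have G0 : 0 <= G k by exact: le_trans h2.
apply: (@le_trans _ _ (G k * expR (K * (a' k.+1 - a' k)))).
  apply: (@le_trans _ _ (G k * (1 + K * (a' k.+1 - a' k)))).
    by rewrite (mulrDr (G k)) mulr1 lerD2l ler_wpM2r.
  by rewrite ler_wpM2l// expR_ge1Dx.
have -> : K * a' k.+1 = K * a' k + K * (a' k.+1 - a' k) by ring.
by rewrite expRD mulrA ler_wpM2r// expR_ge0.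
Qed.

End DiscreteStability.

(** * The signature as a function of the path *)

Section PathSignature.
Context (R : realType) (T : R) (e : nat) (g : 'rV[R]_e -> 'rV[R]_e -> R) (Hg : rkhs g)
  (TV : tensor_algebra Hg).
Context (Cf : R).
Hypotheses (T0 : 0 <= T) (fb : fd_bound 4 Cf (rk_sec Hg)).
Notation path := (R -> 'rV[R]_e).

Let Cf0 : 0 <= Cf. Proof. exact: fd_bound_ge0 fb. Qed.

(** The path is translated to start at [0], as in [kappa_sig_l]; the kernel [l] takes care of the
    starting point. *)
Definition feat (c : path) (s : R) : Hg := rk_sec Hg (c s - c 0).
Definition path_sig (c : path) : TV := signature TV (feat c) 0 T.

Lemma lipcD om (V : normedModType R) (x u : R -> V) r q :
  lipc T om r x -> lipc T om q u -> lipc T om (r + q) (x + u).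
Proof.
move=> lx lu s t s0 st tT.
rewrite -[(x + u) t]/(x t + u t) -[(x + u) s]/(x s + u s) opprD addrACA mulrDl.
apply: le_trans (ler_normD _ _) _.
by rewrite lerD ?lx ?lu.
Qed.

Lemma lipcZ om (V : normedModType R) (u : R -> V) q (a : R) :
  lipc T om q u -> lipc T om (`|a| * q) (a *: u).
Proof.
move=> lu s t s0 st tT; rewrite -[(a *: u) t]/(a *: u t) -[(a *: u) s]/(a *: u s).
by rewrite -scalerBr normrZ -mulrA ler_wpM2l// lu.
Qed.

Lemma feat_lipc om r c : control T om -> lipc T om r c -> lipc T om (Cf * `|r|) (feat c).
Proof.
move=> [_ o_le _] lc s t s0 st tT; rewrite /feat.
apply: le_trans (fd_bound_lipschitz _ _ fb) _.
rewrite -mulrA ler_wpM2l// opprB addrA subrK.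
apply: le_trans (lc s t s0 st tT) _; rewrite ler_wpM2r ?ler_norm//.
by rewrite subr_ge0 o_le.
Qed.

Lemma path_sig_cvg om r c : control T om -> lipc T om r c ->
  (fun N => zprod TV (incr T (feat c) N) N.+1) @ \oo --> path_sig c.
Proof.
move=> om_c lc; have K0 : 0 <= Cf * `|r| by rewrite mulr_ge0.
exact: signature_cvg T0 om_c K0 (feat_lipc om_c lc).
Qed.

Section Differences.
Context (om : R -> R) (W P : R).
Hypotheses (om_c : control T om) (omW : om T <= W) (W1 : 1 <= W) (P0 : 0 <= P).

Let ctl (u : path) (q : R) := lipc T om q u.
Let bd (V : normedModType R) := @bdiff R path ctl ctl V.
Let ctlD x r u q : ctl x r -> ctl u q -> ctl (x + u) (r + q).
Proof. exact: lipcD. Qed.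

(** [P] bounds the budget of the base point, 3 the number of directions, and each direction is at
    most [W] times its size. *)
Definition incr_const : R := Cf * (P + 3) * W ^+ 3.

Let incr_const_ge0 : 0 <= incr_const.
Proof. by rewrite !mulr_ge0 ?addr_ge0 ?exprn_ge0// (le_trans _ W1). Qed.

Lemma ctrls_mem (us : seq (path * R)) p : ctrls ctl us -> p \in us ->
  lipc T om p.2 p.1 /\ 0 <= p.2.
Proof.
elim: us => //= q us IH [cq q0 cus]; rewrite in_cons => /predU1P[->//|pus].
exact: IH.
Qed.

(** Both terms are differences of the feature of [g], with base point and directions taken at time
    [t] or at time [s]; [fdiff_lipschitz] compares them at the price of a fourth difference. *)
Lemma feat_incr_bdiff s t : 0 <= s -> s <= t -> t <= T ->
  bd 3 P (incr_const * (om t - om s)) (fun c => feat c t - feat c s).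
Proof.
move=> s0 st tT us su cus c r lc rP.
have [z0 o_le _] := om_c.
pose y (t : R) (c : path) := c t - c 0.
have yD t' : {morph y t' : a b / a + b}.
  by move=> a b; rewrite /y -[(a + b) t']/(a t' + b t') -[(a + b) 0]/(a 0 + b 0) opprD addrACA.
have dl0 : 0 <= om t - om s by rewrite subr_ge0 o_le.
have W0 : 0 <= W by exact: le_trans W1.
rewrite fdiffB /feat -/(y t _) -/(y s _).
rewrite (fdiff_comp _ (rk_sec Hg) _ (yD t)) (fdiff_comp _ (rk_sec Hg) _ (yD s)).
pose vs := [seq (y t p.1, y s p.1, p.2 * W) | p <- us].
have := @fdiff_lipschitz _ _ _ 3 vs (rk_sec Hg) Cf r (om t - om s) (y t c) (y s c) fb.
rewrite size_map -!map_comp /= => /(_ su dl0) H.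
apply: le_trans (H _ _) _.
- move=> _ /mapP[p pus ->] /=; have [lp p0] := ctrls_mem cus pus.
  have yW t' : 0 <= t' -> t' <= T -> `|y t' p.1| <= p.2 * W.
    move=> t0 t'T; apply: le_trans (lp 0 t' (lexx _) t0 t'T) _.
    rewrite ler_wpM2l// z0 subr0 (le_trans _ omW)//.
    exact: control_le om_c t0 t'T.
  split; [apply: yW => //; exact: le_trans st|apply: yW => //; exact: le_trans tT|].
  rewrite /y opprB addrA subrK; apply: le_trans (lp s t s0 st tT) _.
  by rewrite ler_wpM2r// ler_peMr.
- by rewrite /y opprB addrA subrK; exact: lc.
rewrite big_map big_split /= -/(weight us).
have w0 : 0 <= weight us by exact: weight_ge0 cus.
have -> : \prod_(i <- us) W = W ^+ size us.
  by rewrite big_const_seq count_predT iter_mulr_1.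
have hW : W ^+ size us <= W ^+ 3 by rewrite ler_weXn2l.
have hr : r + (size us)%:R <= P + 3.
  apply: lerD; last by rewrite ler_nat.
  by apply: le_trans rP; rewrite lerDl (sizes_ge0 cus).
have -> : Cf * (r + (size us)%:R) * (om t - om s) * (weight us * W ^+ size us) =
  (Cf * ((r + (size us)%:R) * W ^+ size us)) * (om t - om s) * weight us by ring.
rewrite ler_wpM2r// ler_wpM2r// /incr_const -mulrA ler_wpM2l//.
have W3 : 0 <= W ^+ size us by rewrite exprn_ge0.
have P3 : 0 <= P + 3 by rewrite addr_ge0.
by apply: le_trans (ler_wpM2r W3 hr) (ler_wpM2l P3 hW).
Qed.

(** The Leibniz constant is [8 = 2 ^+ 3]. Each factor of the product multiplies the bound by at most
    [1 + 8 * incr_const] times the increment of [om], so the result is an exponential independent of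
    the number of factors. *)
Lemma zprod_bdiff N k : (k <= N.+1)%N ->
  bd 3 P (expR (8 * incr_const * om (grid T N k)))
    (fun c => zprod TV (incr T (feat c) N) k).
Proof.
elim: k => [_|k IH kN].
  rewrite grid0; have [-> _ _] := om_c; rewrite mulr0 expR0 /=.
  by rewrite -(ta_norm1 TV); exact: bdiff_cst.
have h1 := IH (ltnW kN).
have h2 : bd 3 P (incr_const * (om (grid T N k.+1) - om (grid T N k)))
    (fun c => incr T (feat c) N k).
  by apply: feat_incr_bdiff; rewrite ?grid_ge0 ?grid_leS ?grid_le.
have d0 : 0 <= om (grid T N k.+1) - om (grid T N k).
  by rewrite subr_ge0 (control_grid_mono T0 om_c).
have nrm a b : `|ta_mul (a : TV) b| <= `|a| * `|b| by rewrite ta_norm_mul.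
have h3 := bdiffM ctlD (@ta_mulBl _ _ TV) (@ta_mulBr _ _ TV) nrm
  (expR_ge0 _) (mulr_ge0 incr_const_ge0 d0) h1 h2.
have := bdiffD h1 h3; apply: bdiff_mono => //.
have -> : 8 * incr_const * om (grid T N k.+1) = 8 * incr_const * om (grid T N k) +
  8 * incr_const * (om (grid T N k.+1) - om (grid T N k)) by ring.
rewrite expRD; move: (expR (8 * _ * om (grid T N k))) (expR_ge0 (8 * incr_const * om (grid T N k))) => E E0.
apply: (@le_trans _ _ (E * (1 + 8 * incr_const * (om (grid T N k.+1) - om (grid T N k))))).
  by rewrite le_eqVlt; apply/orP; left; apply/eqP; ring.
by rewrite ler_wpM2l// expR_ge1Dx.
Qed.

Lemma path_sig_bdiff : bd 3 P (expR (8 * incr_const * W)) path_sig.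
Proof.
apply: (bdiff_lim ctlD (F := fun N c => zprod TV (incr T (feat c) N) N.+1)).
  move=> N; apply: bdiff_mono (zprod_bdiff (leqnn N.+1)) => //.
  by rewrite gridN ler_expR ler_wpM2l// mulr_ge0.
by move=> c r lc _; exact: path_sig_cvg om_c lc.
Qed.

End Differences.

Section Stability.
Context (om om' : R -> R) (W r : R).
Hypotheses (om_c : control T om) (om_c' : control T om').
Hypotheses (omW : om T <= W) (omW' : om' T <= W) (r0 : 0 <= r).

(** [zprod_stability] with constants independent of the grid. The two paths keep their own controls,
    sharing only the bound [W]; the factor [2 * Cf] comes from the subtraction of the starting
    points. *)
Lemma path_sig_lipschitz c c' y : lipc T om r c -> lipc T om' r c' ->
  (forall s, 0 <= s -> s <= T -> `|c s - c' s| <= y) ->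
  `|path_sig c - path_sig c'| <=
   (2 * expR (Cf * r * W) + expR (Cf * r * W) * (Cf * r) * W) * (2 * Cf) *
     expR (Cf * r * W) * y.
Proof.
move=> lc lc' cy; set B := expR _.
have K0 : 0 <= Cf * r by rewrite mulr_ge0.
have B0 : 0 <= B by exact: expR_ge0.
have W0 : 0 <= W by apply: le_trans omW; exact: control_ge0 om_c T0 (lexx T).
have y0 : 0 <= y by apply: le_trans (cy 0 (lexx _) T0).
have l1 := feat_lipc om_c lc; have l2 := feat_lipc om_c' lc'.
rewrite (ger0_norm r0) in l1 l2.
have c1 := path_sig_cvg om_c lc; have c2 := path_sig_cvg om_c' lc'.
apply: (norm_lim_le (N := 0%N) (cvgB c1 c2)) => N _.
have gW o k : control T o -> o T <= W -> (k <= N.+1)%N -> o (grid T N k) <= W.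
  move=> oc oW kN; apply: le_trans oW; apply: control_le => //.
    by rewrite grid_ge0.
  exact: grid_le.
have og o : control T o -> o (grid T N 0) = 0 by rewrite grid0 => -[-> _ _].
have := @zprod_stability _ _ TV (incr T (feat c) N) (incr T (feat c') N)
  (fun j => feat c (grid T N j) - feat c' (grid T N j))
  (fun k => om (grid T N k)) (fun k => om' (grid T N k)) (Cf * r) B (2 * Cf * y) N.+1
  K0 B0 _ (og _ om_c) (og _ om_c') (@control_grid_mono _ _ _ T0 om_c N)
  (@control_grid_mono _ _ _ T0 om_c' N) (@norm_incr _ _ _ _ _ _ T0 l1 N)
  (@norm_incr _ _ _ _ _ _ T0 l2 N) _ _ _ N.+1 (leqnn _).
move=> H; apply: le_trans (H _ _ _ _) _.
- by rewrite !mulr_ge0.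
- by move=> j; rewrite /incr; hring.
- move=> j jN; rewrite /feat; apply: le_trans (fd_bound_lipschitz _ _ fb) _.
  rewrite -mulrA mulrCA ler_wpM2l//.
  have g0 : 0 <= grid T N j by exact: grid_ge0.
  have gT : grid T N j <= T by exact: grid_le.
  have -> : c (grid T N j) - c 0 - (c' (grid T N j) - c' 0) =
     (c (grid T N j) - c' (grid T N j)) - (c 0 - c' 0).
    by rewrite !opprB addrACA [RHS]addrACA (addrC (- c 0)).
  apply: le_trans (ler_normB _ _) _.
  by have := cy _ g0 gT; have := cy 0 (lexx _) T0; lra.
- move=> j jN; apply: le_trans (@zprod_norm _ _ TV _ (fun k => om (grid T N k)) (Cf * r) N.+1
     (og _ om_c) (@norm_incr _ _ _ _ _ _ T0 l1 N) j jN) _.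
  by rewrite ler_expR ler_wpM2l// gW.
have e1 : expR (Cf * r * om' (grid T N N.+1)) <= B by rewrite ler_expR ler_wpM2l// gW.
have e2 : 2 * B + B * (Cf * r) * om (grid T N N.+1) <= 2 * B + B * (Cf * r) * W.
  by rewrite lerD2l ler_wpM2l ?mulr_ge0// gW.
have p0 : 0 <= 2 * B + B * (Cf * r) * W by rewrite addr_ge0 ?mulr_ge0.
have q0 : 0 <= 2 * Cf * y by rewrite !mulr_ge0.
apply: le_trans (ler_wpM2r (expR_ge0 _) (ler_wpM2r q0 e2)) _.
apply: le_trans (ler_wpM2l (mulr_ge0 p0 q0) e1) _.
by rewrite le_eqVlt; apply/orP; left; apply/eqP; ring.
Qed.

End Stability.

End PathSignature.

(** * Uniform approximation by finitely many vectors *)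

Section ApproximatelyFinite.
Context (R : realType).

(* For bounded lam, this says that {F i | P i} is totally bounded. Bounding the
   coefficients by lam makes the notion stable under sums of arbitrary length,
   hence under Riemann sums and their limits. *)
Definition af (V : hilbert R) (I : Type) (P : I -> Prop) (lam : I -> R) (F : I -> V) : Prop :=
  forall eps : R, 0 < eps -> exists (J : finType) (v : J -> V) (C : R), 0 <= C /\
    forall i, P i -> exists c : J -> R, (forall j, `|c j| <= C * lam i) /\
      `|F i - \sum_j c j *: v j| <= eps * lam i.

Section Stability.
Context (V : hilbert R).

Lemma af_approx (I : Type) (P : I -> Prop) lam (F : I -> V) :
  (forall eps : R, 0 < eps -> exists2 F' : I -> V, af P lam F' &
     forall i, P i -> `|F i - F' i| <= eps * lam i) -> af P lam F.
Proof.
move=> H eps e0; have e2 : 0 < eps / 2 by rewrite divr_gt0.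
have [F' aF' FF'] := H _ e2; have [J [v [C [C0 HC]]]] := aF' _ e2.
exists J, v, C; split=> // i Pi; have [c [c1 c2]] := HC i Pi.
exists c; split=> //; apply: le_trans (ler_distD (F' i) _ _) _.
by rewrite [eps]splitr mulrDl lerD ?FF'.
Qed.

Lemma af_comp (I I' : Type) (P : I -> Prop) (P' : I' -> Prop) lam lam' (F : I -> V) (phi : I' -> I) :
  (forall i, P' i -> P (phi i) /\ lam (phi i) <= lam' i) ->
  af P lam F -> af P' lam' (fun i => F (phi i)).
Proof.
move=> H aF eps e0; have [J [v [C [C0 HC]]]] := aF _ e0.
exists J, v, C; split=> // i /H[Pi l]; have [c [c1 c2]] := HC _ Pi.
exists c; split=> [j|]; first by apply: le_trans (c1 j) _; rewrite ler_wpM2l.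
by apply: le_trans c2 _; rewrite ler_wpM2l// ltW.
Qed.

Lemma af_lim (I I' : Type) (P : I -> Prop) (P' : I' -> Prop) lam lam' (F : I -> V) (F' : I' -> V) :
  (forall i', P' i' -> forall e : R, 0 < e -> exists i, [/\ P i, lam i <= lam' i' &
     `|F' i' - F i| <= e * lam' i']) ->
  af P lam F -> af P' lam' F'.
Proof.
move=> H aF eps e0; have e2 : 0 < eps / 2 by rewrite divr_gt0.
have [J [v [C [C0 HC]]]] := aF _ e2.
exists J, v, C; split=> // i' Pi'; have [i [Pi l h]] := H i' Pi' _ e2.
have [c [c1 c2]] := HC _ Pi.
exists c; split=> [j|]; first by apply: le_trans (c1 j) _; rewrite ler_wpM2l.
apply: le_trans (ler_distD (F i) _ _) _; rewrite [eps]splitr mulrDl lerD//.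
by apply: le_trans c2 _; rewrite ler_wpM2l// ltW.
Qed.

Lemma af_add (I : Type) (P : I -> Prop) lam (F G : I -> V) :
  af P lam F -> af P lam G -> af P lam (fun i => F i + G i).
Proof.
move=> aF aG eps e0; have e2 : 0 < eps / 2 by rewrite divr_gt0.
have [J1 [v1 [C1 [C10 H1]]]] := aF _ e2; have [J2 [v2 [C2 [C20 H2]]]] := aG _ e2.
exists (J1 + J2)%type, (fun j => match j with inl j => v1 j | inr j => v2 j end), (Num.max C1 C2).
split=> [|i Pi]; first by rewrite le_max C10.
have [c1 [a1 b1]] := H1 i Pi; have [c2 [a2 b2]] := H2 i Pi.
exists (fun j => match j with inl j => c1 j | inr j => c2 j end); split.
  (* A negative [lam i] would bound a norm by a negative number; excluding it allows the constant to
     be enlarged. *)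
  have lamC C j (c : R) : `|c| <= C * lam i -> 0 <= C -> C <= j -> `|c| <= j * lam i.
    move=> h C0 Cj; have [l0|l0] := leP 0 (lam i).
      by apply: le_trans h _; rewrite ler_wpM2r.
    have : `|c| <= 0 by apply: le_trans h _; rewrite mulr_ge0_le0// ltW.
    have e4 : eps / 2 * lam i < 0 by rewrite pmulr_rlt0.
    by have := le_lt_trans (normr_ge0 _) (le_lt_trans b1 e4); rewrite ltxx.
  by case=> j; [apply: lamC (a1 j) _ _|apply: lamC (a2 j) _ _]; rewrite // le_max lexx ?orbT.
rewrite big_sumType /= opprD addrACA; apply: le_trans (ler_normD _ _) _.
by rewrite [eps]splitr mulrDl lerD.
Qed.

Lemma af_scale (I : Type) (P : I -> Prop) lam lam' (F : I -> V) (s : I -> R) (M : R) :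
  0 <= M -> (forall i, P i -> `|s i| * lam i <= M * lam' i) ->
  (forall i, P i -> 0 <= lam' i) ->
  af P lam F -> af P lam' (fun i => s i *: F i).
Proof.
move=> M0 H l0 aF eps e0; have M1 : 0 < M + 1 by rewrite ltr_wpDl.
have [J [v [C [C0 HC]]]] := aF _ (divr_gt0 e0 M1).
exists J, v, (C * M); split=> [|i Pi]; first by rewrite mulr_ge0.
have [c [c1 c2]] := HC i Pi; exists (fun j => s i * c j); split=> [j|].
  rewrite normrM; apply: le_trans (ler_wpM2l _ (c1 j)) _ => //.
  by rewrite mulrCA -mulrA ler_wpM2l// H.
under eq_bigr do rewrite -scalerA.
rewrite -scaler_sumr -scalerBr normrZ; apply: le_trans (ler_wpM2l _ c2) _ => //.
rewrite mulrCA; apply: le_trans (ler_wpM2l _ (H i Pi)) _.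
  by rewrite ltW// divr_gt0.
rewrite mulrA ler_wpM2r ?l0// mulrAC ler_pdivrMr// ler_wpM2l ?ltW//.
by rewrite ltrDl.
Qed.

Lemma af_cst0 (I : Type) (P : I -> Prop) lam : (forall i, P i -> 0 <= lam i) ->
  af P lam (fun=> 0 : V).
Proof.
move=> l0 eps e0; exists 'I_0, (fun=> 0), 0; split=> // i Pi.
exists (fun=> 0); split=> [j|]; first by rewrite normr0 mul0r.
by rewrite big_ord0 subrr normr0 mulr_ge0 ?l0// ltW.
Qed.

Lemma af_cst (I : Type) (P : I -> Prop) (v : V) : af P (fun=> 1) (fun=> v).
Proof.
move=> eps e0; exists 'I_1, (fun=> v), 1; split=> // i Pi.
exists (fun=> 1); split=> [j|]; first by rewrite normr1 mulr1.
by rewrite big_ord1 scale1r subrr normr0 mulr1 ltW.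
Qed.

Lemma af_sum (I : Type) (P : I -> Prop) lam n (F : 'I_n -> I -> V) :
  (forall i, P i -> 0 <= lam i) -> (forall k, af P lam (F k)) ->
  af P lam (fun i => \sum_(k < n) F k i).
Proof.
move=> l0; elim: n F => [|n IH] F aF.
  rewrite (_ : (fun i => _) = fun=> 0); first exact: af_cst0.
  by apply/funext => i; rewrite big_ord0.
rewrite (_ : (fun i => _) = (fun i => \sum_(k < n) F (widen_ord (leqnSn n) k) i + F ord_max i)).
  by apply: af_add => //; exact: IH.
by apply/funext => i; rewrite big_ord_recr.
Qed.

(* The lengths of the sums are not bounded: only their total weight is. *)
Lemma af_weighted_sum (I I' : Type) (P : I -> Prop) (P' : I' -> Prop) lam lam'
    (F : I -> V) (F' : I' -> V) (M : R) : 0 <= M -> (forall i, P' i -> 0 <= lam' i) ->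
  (forall i', P' i' -> exists (n : nat) (idx : nat -> I),
     [/\ forall k, (k < n)%N -> P (idx k),
         \sum_(k < n) lam (idx k) <= M * lam' i' &
         F' i' = \sum_(k < n) F (idx k)]) ->
  af P lam F -> af P' lam' F'.
Proof.
move=> M0 l0 H aF eps e0; have M1 : 0 < M + 1 by rewrite ltr_wpDl.
have e1 := divr_gt0 e0 M1.
have [J [v [C [C0 HC]]]] := aF _ e1.
exists J, v, (C * M); split=> [|i' Pi']; first by rewrite mulr_ge0.
have [n [idx [Pidx lidx ->]]] := H i' Pi'.
have /choice[c Hc] : forall k, exists c : J -> R, (k < n)%N ->
    (forall j, `|c j| <= C * lam (idx k)) /\
    `|F (idx k) - \sum_j c j *: v j| <= eps / (M + 1) * lam (idx k).
  move=> k; case: (ltnP k n) => kn; last by exists (fun=> 0).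
  by have [c Hc] := HC _ (Pidx k kn); exists c.
exists (fun j => \sum_(k < n) c k j); split=> [j|].
  apply: le_trans (ler_norm_sum _ _ _) _; rewrite -mulrA.
  apply: le_trans (ler_wpM2l C0 lidx); rewrite mulr_sumr.
  by apply: ler_sum => k _; have [+ _] := Hc k (ltn_ord k); apply.
have -> : \sum_j (\sum_(k < n) c k j) *: v j = \sum_(k < n) \sum_j c k j *: v j.
  by rewrite exchange_big; apply: eq_bigr => j _; rewrite scaler_suml.
rewrite -sumrB; apply: le_trans (ler_norm_sum _ _ _) _.
apply: (@le_trans _ _ (\sum_(k < n) eps / (M + 1) * lam (idx k))).
  by apply: ler_sum => k _; have [_] := Hc k (ltn_ord k).
rewrite -mulr_sumr; apply: le_trans (ler_wpM2l (ltW e1) lidx) _.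
rewrite mulrA ler_wpM2r ?l0// mulrAC ler_pdivrMr// ler_wpM2l ?ltW//.
by rewrite ltrDl.
Qed.

(** The vectors are the values on a lattice of mesh [d] covering the cube of radius [r]; the
    coefficients of [x] single out the lattice point just below it. *)
Lemma af_lipschitz_ball n (f : 'rV[R]_n -> V) (C r : R) : 0 <= C -> 0 <= r ->
  (forall x y, `|f x - f y| <= C * `|x - y|) ->
  af (fun x : 'rV[R]_n => `|x| <= r) (fun=> 1) f.
Proof.
move=> C0 r0 lf eps e0; have C1 : 0 < C + 1 by rewrite ltr_wpDl.
pose d := eps / (C + 1); have d0 : 0 < d by exact: divr_gt0.
pose k := (Num.truncn (2 * r / d)).+1.
pose z (j : {ffun 'I_n -> 'I_k}) : 'rV[R]_n := \row_i ((j i)%:R * d - r).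
exists {ffun 'I_n -> 'I_k}, (fun j => f (z j)), 1; split=> // x xr.
have pos i : 0 <= (x 0 i + r) / d.
  rewrite divr_ge0 ?(ltW d0)//; have := le_trans (coord_le_norm x i) xr.
  by rewrite ler_norml; lra.
have tk (i : 'I_n) : (Num.truncn ((x 0 i + r) / d)%R < k)%N.
  rewrite ltnS; apply: le_truncn; rewrite ler_wpM2r ?invr_ge0 ?(ltW d0)//.
  by have := le_trans (coord_le_norm x i) xr; rewrite ler_norml; lra.
pose j0 : {ffun 'I_n -> 'I_k} := [ffun i => Ordinal (tk i)].
exists (fun j => (j == j0)%:R); split=> [j|].
  by case: (j == j0); rewrite ?normr1 ?normr0 mulr1.
rewrite (bigD1 j0)//= eqxx scale1r big1 ?addr0; last first.
  by move=> j /negPf ->; rewrite scale0r.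
apply: le_trans (lf _ _) _; rewrite mulr1.
have : `|x - z j0| <= d.
  apply: norm_row_le => [|i]; first exact: ltW.
  rewrite !mxE ffunE /=; have /andP[h1 h2] := truncn_itv (pos i).
  rewrite ler_pdivlMr// in h1; rewrite ltr_pdivrMr// -natr1 in h2.
  by rewrite ler_norml; lra.
move=> h; apply: le_trans (ler_wpM2l C0 h) _.
by rewrite /d mulrCA ler_piMr ?(ltW e0)// ler_pdivrMr// mul1r lerDl.
Qed.

End Stability.

(** The finite family consists of the products of the two given ones. The tolerance for [G] is
    chosen last, since it gets multiplied by the norm of the approximation of [F], at most [B1] plus
    the first tolerance. *)
Lemma af_bilinear (A B V : hilbert R) (J : A -> B -> V) (I : Type) (P : I -> Prop) lam
    (F : I -> A) (G : I -> B) (B1 B2 : R) :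
  (forall a a' b, J (a - a') b = J a b - J a' b) ->
  (forall a b b', J a (b - b') = J a b - J a b') ->
  (forall s t a b, J (s *: a) (t *: b) = (s * t) *: J a b) ->
  (forall a b, `|J a b| <= `|a| * `|b|) ->
  0 <= B1 -> 0 <= B2 -> (forall i, P i -> 0 <= lam i) ->
  (forall i, P i -> `|F i| <= B1) -> (forall i, P i -> `|G i| <= B2 * lam i) ->
  af P (fun=> 1) F -> af P lam G -> af P lam (fun i => J (F i) (G i)).
Proof.
move=> Jl Jr JZ Jn B10 B20 l0 FB GB aF aG eps e0.
have J0l b : J 0 b = 0 by rewrite -(subrr 0) Jl subrr.
have J0r a : J a 0 = 0 by rewrite -(subrr 0) Jr subrr.
have JDl b : {morph (fun a => J a b) : x y / x + y >-> x + y}.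
  move=> x y; rewrite -[y in LHS]opprK Jl -[- y]add0r Jl J0l opprD oppr0 opprK add0r//.
have JDr a : {morph J a : x y / x + y >-> x + y}.
  move=> x y; rewrite -[y in LHS]opprK Jr -[- y]add0r Jr J0r opprD oppr0 opprK add0r//.
have b2 : 0 < 2 * (B2 + 1) by rewrite mulr_gt0// ltr_wpDl.
have e1 := divr_gt0 e0 b2.
have b1 : 0 < 2 * (B1 + eps / (2 * (B2 + 1)) + 1).
  by rewrite mulr_gt0// ltr_wpDl// addr_ge0// ltW.
have e2 := divr_gt0 e0 b1.
have [J1 [v1 [C1 [C10 H1]]]] := aF _ e1; have [J2 [v2 [C2 [C20 H2]]]] := aG _ e2.
exists (J1 * J2)%type, (fun j => J (v1 j.1) (v2 j.2)), (C1 * C2).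
split=> [|i Pi]; first by rewrite mulr_ge0.
have [c1 [p1 q1]] := H1 i Pi; have [c2 [p2 q2]] := H2 i Pi.
exists (fun j => c1 j.1 * c2 j.2); split=> [j|].
  rewrite normrM -mulrA; have h := p1 j.1; rewrite mulr1 in h.
  by rewrite ler_pM.
set F1 := \sum_j c1 j *: v1 j in q1; set G1 := \sum_j c2 j *: v2 j in q2.
have -> : \sum_j (c1 j.1 * c2 j.2) *: J (v1 j.1) (v2 j.2) = J F1 G1.
  rewrite /F1 (big_morph _ (JDl _) (J0l _)).
  rewrite -(pair_bigA _ (fun j k => (c1 j * c2 k) *: J (v1 j) (v2 k))) /=.
  apply: eq_bigr => j _; rewrite /G1 (big_morph _ (JDr _) (J0r _)).
  by apply: eq_bigr => k _; rewrite JZ.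
have -> : J (F i) (G i) - J F1 G1 = J (F i - F1) (G i) + J F1 (G i - G1).
  by rewrite Jl Jr addrA subrK.
apply: le_trans (ler_normD _ _) _.
rewrite mulr1 in q1.
have nF1 : `|F1| <= B1 + eps / (2 * (B2 + 1)).
  rewrite -(subrK (F i) F1) addrC; apply: le_trans (ler_normD _ _) _.
  by rewrite lerD ?FB// distrC.
have s1 : `|J (F i - F1) (G i)| <= eps / 2 * lam i.
  apply: le_trans (Jn _ _) _; apply: le_trans (ler_pM _ _ q1 (GB i Pi)) _ => //.
  rewrite mulrA ler_wpM2r ?l0//.
  have p : 0 < B2 + 1 by rewrite ltr_wpDl.
  rewrite (_ : _ * B2 = eps / 2 * (B2 / (B2 + 1))); last by field; rewrite gt_eqF.
  by rewrite ler_piMr ?(ltW (divr_gt0 _ _))// ler_pdivrMr// mul1r lerDl.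
have s2 : `|J F1 (G i - G1)| <= eps / 2 * lam i.
  apply: le_trans (Jn _ _) _; apply: le_trans (ler_pM _ _ nF1 q2) _ => //.
  rewrite mulrA ler_wpM2r ?l0//; move: (B1 + _) nF1 b1 => b nF1 b1.
  have b0 : 0 <= b by exact: le_trans nF1.
  have p : 0 < b + 1 by rewrite ltr_wpDl.
  rewrite (_ : b * _ = eps / 2 * (b / (b + 1))); last by field; rewrite gt_eqF.
  by rewrite ler_piMr ?(ltW (divr_gt0 _ _))// ler_pdivrMr// mul1r lerDl.
by rewrite [eps]splitr mulrDl lerD.
Qed.

End ApproximatelyFinite.

(** * Approximation of increments in proportion to their length *)

Section LipschitzIncrements.
Context (R : realType) (e : nat) (V : hilbert R) (f : 'rV[R]_e -> V) (C : R).
Hypothesis fb : fd_bound 3 C f.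

Let C0 : 0 <= C. Proof. exact: fd_bound_ge0 fb. Qed.
Let ctl (u : 'rV[R]_e) (q : R) : Prop := `|u| <= q.
Let anywhere (u : 'rV[R]_e) (q : R) : Prop := True.

Let fd_bdiff P : bdiff ctl anywhere 3 P C f.
Proof.
move=> us su cus x r _ _; apply: le_trans (fb _ _) _; first by rewrite size_map.
rewrite big_map /weight ler_wpM2l//.
elim: us cus {su} => [|p us IH] /=; first by rewrite !big_nil.
move=> [p1 p2 cus]; rewrite !big_cons ler_pM ?IH//.
by apply: prodr_ge0.
Qed.

Let ctlZ u q (a : R) : ctl u q -> ctl (a *: u) (`|a| * q).
Proof. by rewrite /ctl normrZ => h; rewrite ler_wpM2l. Qed.
Let anyD x r u q : anywhere x r -> ctl u q -> anywhere (x + u) (r + q).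
Proof. by []. Qed.

(** The error must be proportional to the step, so that along a path it adds up to the variation.
    The increment is therefore written as an integral of the derivative [D], whose Riemann sums have
    total weight [|p.2|]; [D] itself is Lipschitz on a ball. *)
Lemma af_increment_coord i (rho : R) : 0 <= rho ->
  af (fun p : 'rV[R]_e * R => `|p.1| <= rho /\ `|p.2| <= rho) (fun p => `|p.2|)
    (fun p => f (p.1 + p.2 *: delta_mx 0 i) - f p.1).
Proof.
move=> rho0; pose u : 'rV[R]_e := delta_mx 0 i.
have cu : ctl u 1 by exact: norm_delta_mx.
pose D := dder f u.
have D_rate x : forall h, `|h| <= 1 -> `|f (x + h *: u) - f x - h *: D x| <= 2 * C * h ^+ 2.
  by have [] := dder_rate anyD ctlZ C0 (@fd_bdiff 2) (I : anywhere x 0) cu _;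
     rewrite ?add0r.
(* After [bdiff_dder] the budget is 0; since [anywhere] accepts every amount, the base can start
   from [- |x - y|]. *)
have D_lip x y : `|D x - D y| <= C * `|x - y|.
  have bD := bdiff_dder anyD ctlZ C0 (@fd_bdiff 2) cu.
  have cs : ctrls ctl [:: (x - y, `|x - y|)] by split; rewrite /ctl /=.
  have ss : - `|x - y| + sizes [:: (x - y, `|x - y|)] <= 2 - 2.
    by rewrite /sizes big_seq1 /= addNr subrr.
  have := bD [:: (x - y, `|x - y|)] isT cs y (- `|x - y|) I ss.
  by rewrite /weight big_seq1 /= (addrC y) subrK.
have rho2 : 0 <= 2 * rho by rewrite mulr_ge0.
have aD := af_lipschitz_ball C0 rho2 D_lip.
have aD' : af (fun p : 'rV[R]_e * R => `|p.1| <= 2 * rho) (fun p => `|p.2|) (fun p => p.2 *: D p.1).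
  apply: (af_scale (lam := fun=> 1) (M := 1)) => //; first by move=> p _; rewrite mulr1 mul1r.
  by apply: af_comp aD => p h; split.
pose S (p : 'rV[R]_e * R * nat) :=
  \sum_(k < p.2.+1) (p.1.2 / p.2.+1%:R) *: D (p.1.1 + (k%:R * (p.1.2 / p.2.+1%:R)) *: u).
have aS : af (fun p : 'rV[R]_e * R * nat => `|p.1.1| <= rho /\ `|p.1.2| <= rho)
    (fun p => `|p.1.2|) S.
  apply: (af_weighted_sum (M := 1) _ _ _ aD') => // -[[x h] n] /= [xr hr].
  exists n.+1, (fun k => (x + (k%:R * (h / n.+1%:R)) *: u, h / n.+1%:R)); split=> //=.
    move=> k kn; apply: le_trans (ler_normD _ _) _; rewrite [leRHS]mulr_natl mulr2n lerD//.
    rewrite normrZ !normrM; apply: le_trans (ler_pM _ _ (lexx _) cu) _ => //.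
    rewrite mulr1 mulrCA; apply: le_trans hr; rewrite ler_piMr// ger0_norm//.
    by rewrite ger0_norm// ler_pdivrMr// mul1r ler_nat ltnW.
  rewrite sumr_const card_ord -[leLHS]mulr_natl mul1r normrM mulrCA.
  by rewrite (ger0_norm (_ : 0 <= n.+1%:R^-1))// divff// mulr1.
apply: af_lim aS => -[x h] /= [xr hr] eps e0.
(* The bound by [eps] makes the quadratic errors of the [n.+1] steps total at most [eps |h|]; the
   bound by 1 keeps each step in the range of [D_rate]. *)
have := @cvg_harmonicM R (2 * C * rho + rho) => /cvgrPdist_lt /(_ (Num.min eps 1)) [|n _ /(_ n (leqnn n))].
  by rewrite lt_min e0 ltr01.
rewrite /= sub0r normrN ger0_norm; last by rewrite divr_ge0// addr_ge0// !mulr_ge0.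
rewrite lt_min => /andP[n1 n2].
exists (x, h, n); split=> //; rewrite /S /=.
set t := h / n.+1%:R; pose y k := x + (k%:R * t) *: u.
have q0 : 0 <= 2 * C * rho by rewrite !mulr_ge0.
have t1 : `|t| <= 1.
  rewrite /t normrM (ger0_norm (_ : 0 <= n.+1%:R^-1))// ler_pdivrMr// mul1r.
  rewrite ltr_pdivrMr// mul1r in n2; lra.
have yS k : y k.+1 = y k + t *: u by rewrite /y -natr1 mulrDl mul1r scalerDl addrA.
have -> : f (x + h *: u) - f x = \sum_(k < n.+1) (f (y k.+1) - f (y k)).
  rewrite -(big_mkord predT (fun k => f (y k.+1) - f (y k))) telescope_sumr//.
  by rewrite /y mul0r scale0r addr0 /t mulrC divfK.
rewrite -sumrB; apply: le_trans (ler_norm_sum _ _ _) _.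
apply: (@le_trans _ _ (\sum_(k < n.+1) 2 * C * t ^+ 2)).
  by apply: ler_sum => k _; rewrite yS; exact: D_rate.
rewrite sumr_const card_ord -[leLHS]mulr_natl -(real_normK (num_real t)) /t normrM.
rewrite (ger0_norm (_ : 0 <= n.+1%:R^-1))//.
have -> : n.+1%:R * (2 * C * (`|h| / n.+1%:R) ^+ 2) = 2 * C * `|h| / n.+1%:R * `|h|.
  have : n.+1%:R != 0 :> R by rewrite pnatr_eq0.
  by move: (n.+1%:R) => N N0; field.
rewrite ler_wpM2r//; apply: le_trans (ltW n1); rewrite ler_wpM2r ?invr_ge0//.
by apply: le_trans (ler_wpM2l _ hr) _; rewrite ?mulr_ge0// lerDl.
Qed.

Lemma af_increment (rho : R) : 0 <= rho ->
  af (fun p : 'rV[R]_e * 'rV[R]_e => `|p.1| <= rho /\ `|p.2| <= rho)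
    (fun p => `|p.2 - p.1|) (fun p => f p.2 - f p.1).
Proof.
move=> rho0.
pose part k (v : 'rV[R]_e) : 'rV[R]_e := \row_j (if (j < k)%N then v 0 j else 0).
have part_le k v : `|part k v| <= `|v|.
  apply: norm_row_le => // j; rewrite mxE.
  by case: ifP => _; rewrite ?normr0// coord_le_norm.
rewrite (_ : (fun p => _) = fun p : 'rV[R]_e * 'rV[R]_e => \sum_(i < e)
   (f (p.1 + part i (p.2 - p.1) + (p.2 - p.1) 0 i *: delta_mx 0 i) -
    f (p.1 + part i (p.2 - p.1)))).
  apply: af_sum => // i.
  (* The corners between [x] and [y] have norm at most [|x| + |y - x| <= 3 rho]. *)
  have r3 : 0 <= 3 * rho by rewrite mulr_ge0.
  have := af_increment_coord i r3.
  apply: (af_comp (phi := fun p : 'rV[R]_e * 'rV[R]_e =>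
     (p.1 + part i (p.2 - p.1), (p.2 - p.1) 0 i))) => -[x y] /= [xr yr].
  have xy : `|y - x| <= 2 * rho by apply: le_trans (ler_normB _ _) _; lra.
  split; last exact: coord_le_norm.
  split; last by apply: le_trans (coord_le_norm _ _) _; lra.
  apply: le_trans (ler_normD _ _) _; have := part_le i (y - x); lra.
apply/funext => -[x y] /=; set v := y - x.
have partS (i : 'I_e) : part i.+1 v = part i v + v 0 i *: delta_mx 0 i.
  apply/rowP => j; rewrite !mxE eqxx ltnS leq_eqVlt val_eqE.
  have [->|ji] := eqVneq j i; first by rewrite ltnn mulr1 add0r.
  by rewrite mulr0 addr0.
rewrite (eq_bigr (fun i : 'I_e => f (x + part i.+1 v) - f (x + part i v))); last first.
  by move=> i _; rewrite partS addrA.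
rewrite -(big_mkord predT (fun i => f (x + part i.+1 v) - f (x + part i v))).
rewrite telescope_sumr//.
have -> : part e v = v by apply/rowP => j; rewrite mxE ltn_ord.
have -> : part 0%N v = 0 by apply/rowP => j; rewrite !mxE.
by rewrite addr0 /v (addrC x) subrK.
Qed.

End LipschitzIncrements.

Section PathSignatureCompact.
Context (R : realType) (T : R) (e : nat) (g : 'rV[R]_e -> 'rV[R]_e -> R) (Hg : rkhs g)
  (TV : tensor_algebra Hg).
Context (Cf : R).
Hypotheses (T0 : 0 <= T) (fb : fd_bound 4 Cf (rk_sec Hg)).
Notation path := (R -> 'rV[R]_e).

Let Cf0 : 0 <= Cf. Proof. exact: fd_bound_ge0 fb. Qed.
Let fb3 : fd_bound 3 Cf (rk_sec Hg).
Proof. by move=> us su x; apply: fb; exact: leq_trans su _. Qed.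

Definition bounded_path (W : R) (c : path) : Prop :=
  exists om, [/\ control T om, om T <= W & lipc T om 1 c].

Context (W : R).
Hypothesis W0 : 0 <= W.

Let E := expR (2 * Cf * W).

Let zl_norm om c N m k : control T om -> om T <= W -> lipc T om 1 c -> (k <= N.+1)%N ->
  `|zlev TV (incr T (feat Hg c) N) m k| <= 2^-1 ^+ m * E.
Proof.
move=> om_c omW lc kN.
have l1 := feat_lipc fb om_c lc; rewrite normr1 mulr1 in l1.
have og : om (grid T N 0) = 0 by rewrite grid0; case: om_c.
apply: le_trans (@zlev_norm _ _ TV _ (fun k => om (grid T N k)) Cf N.+1 Cf0 og
  (@control_grid_mono _ _ _ T0 om_c N) (@norm_incr _ _ _ _ _ _ T0 l1 N) m k kN) _.
rewrite ler_wpM2l ?exprn_ge0// ler_expR ler_wpM2l ?mulr_ge0//.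
apply: le_trans omW; apply: control_le => //; rewrite ?grid_ge0//.
exact: grid_le.
Qed.

(** Level [m.+1] sums products of level [m] with increments of the feature. Their weights, the
    lengths of the increments of the path, total at most [W] whatever the grid, as [af_weighted_sum]
    requires. *)
Lemma af_zlev m :
  af (fun p : path * nat * nat => bounded_path W p.1.1 /\ (p.2 <= p.1.2.+1)%N) (fun=> 1)
    (fun p => zlev TV (incr T (feat Hg p.1.1) p.1.2) m p.2).
Proof.
elim: m => [|m IH]; first exact: af_cst.
pose F (p : path * nat * nat) := ta_mul (zlev TV (incr T (feat Hg p.1.1) p.1.2) m p.2)
  (incr T (feat Hg p.1.1) p.1.2 p.2).
pose lam (p : path * nat * nat) := `|p.1.1 (grid T p.1.2 p.2.+1) - p.1.1 (grid T p.1.2 p.2)|.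
suff aF : af (fun p : path * nat * nat => bounded_path W p.1.1 /\ (p.2 < p.1.2.+1)%N) lam F.
  apply: (af_weighted_sum (M := W) _ _ _ aF) => // -[[c N] k] /= [[om [om_c omW lc]] kN].
  exists k, (fun j => (c, N, j)); split=> //=.
    by move=> j jk; split; [exists om|apply: leq_trans jk kN].
  rewrite mulr1; apply: le_trans omW.
  apply: (@le_trans _ _ (om (grid T N k))); last first.
    by apply: control_le => //; rewrite ?grid_ge0 ?grid_le.
  rewrite -(sum_control_grid om_c N k); apply: ler_sum => j _.
  have jN : (j < N.+1)%N by apply: leq_trans (ltn_ord j) kN.
  rewrite -[leRHS]mul1r; apply: lc; rewrite ?grid_ge0 ?grid_leS//.
  exact: grid_le.
apply: (@af_bilinear _ _ _ _ (@ta_mul _ _ TV) _ _ _ _ _ (2^-1 ^+ m * E) Cf) => //.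
- exact: ta_mulBl.
- exact: ta_mulBr.
- by move=> s t a b; rewrite ta_mulZl ta_mulZr scalerA.
- by move=> a b; rewrite ta_norm_mul.
- by rewrite mulr_ge0 ?exprn_ge0 ?expR_ge0.
- by move=> p _; exact: normr_ge0.
- by move=> -[[c N] k] /= [[om [om_c omW lc]] kN]; exact: (@zl_norm om c N m k om_c omW lc (ltnW kN)).
- move=> -[[c N] k] /= _; rewrite /incr /feat /lam /=.
  apply: le_trans (fd_bound_lipschitz _ _ fb) _.
  by rewrite opprB addrA subrK.
- by apply: (af_comp (phi := id)) IH => -[[c N] k] /= [cW kN]; split=> //; split=> //; exact: ltnW.
have := af_increment fb3 W0.
apply: (af_comp (phi := fun p : path * nat * nat =>
  (p.1.1 (grid T p.1.2 p.2) - p.1.1 0, p.1.1 (grid T p.1.2 p.2.+1) - p.1.1 0))).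
move=> -[[c N] k] /= [[om [om_c omW lc]] kN].
have cW s : 0 <= s -> s <= T -> `|c s - c 0| <= W.
  move=> s0 sT; apply: le_trans (lc 0 s (lexx _) s0 sT) _.
  have [-> _ _] := om_c; rewrite mul1r subr0; apply: le_trans omW.
  exact: control_le.
split; last by rewrite /lam /= opprB addrA subrK.
by split; apply: cW; rewrite ?grid_ge0// grid_le// ltnW.
Qed.

(** Cutting at [M] levels is uniform in the path and in the grid; [af_lim] then refines the grid. *)
Lemma af_path_sig : af (bounded_path W) (fun=> 1) (path_sig T TV).
Proof.
pose Z (p : path * nat) := zprod TV (incr T (feat Hg p.1) p.2) p.2.+1.
suff aZ : af (fun p : path * nat => bounded_path W p.1) (fun=> 1) Z.
  apply: af_lim aZ => c [om [om_c omW lc]] eps e0.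
  have /cvg_seqP /(_ _ e0) [N /(_ N (leqnn N)) h] := @path_sig_cvg _ T e g Hg TV Cf T0 fb om 1 c om_c lc.
  by exists (c, N); split=> //; [exists om|rewrite mulr1 distrC ltW].
apply: af_approx => eps e0.
have := @cvg_geometricM R (2 * E) => /cvgrPdist_lt /(_ _ e0) [M _ /(_ M (leqnn M))] /=.
rewrite sub0r normrN ger0_norm ?mulr_ge0 ?expR_ge0// => hM.
exists (fun p => \sum_(m < M) zlev TV (incr T (feat Hg p.1) p.2) m p.2.+1).
  apply: af_sum => // m.
  by apply: (af_comp (phi := fun p : path * nat => (p.1, p.2, p.2.+1))) (af_zlev m).
move=> [c N] /= [om [om_c omW lc]]; rewrite mulr1; apply/ltW; apply: le_lt_trans hM.
have l1 := feat_lipc fb om_c lc; rewrite normr1 mulr1 in l1.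
have og : om (grid T N 0) = 0 by rewrite grid0; case: om_c.
apply: le_trans (@zprod_tail _ _ TV _ (fun k => om (grid T N k)) Cf N.+1 Cf0 og
  (@control_grid_mono _ _ _ T0 om_c N) (@norm_incr _ _ _ _ _ _ T0 l1 N) N.+1 M (leqnn _)) _.
rewrite gridN mulrAC ler_wpM2r ?exprn_ge0// ler_wpM2l// ler_expR.
by rewrite ler_wpM2l// mulr_ge0.
Qed.

End PathSignatureCompact.

Section BdiffTrilinear.
Context (R : realType) (U : lmodType R) (ctrl base : U -> R -> Prop).
Hypothesis baseD : forall x r u q, base x r -> ctrl u q -> base (x + u) (r + q).
Context (A B C W : normedModType R) (J : A -> B -> C -> W).
Hypotheses (J1 : forall a a' b c, J (a - a') b c = J a b c - J a' b c)
  (J2 : forall a b b' c, J a (b - b') c = J a b c - J a b' c)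
  (J3 : forall a b c c', J a b (c - c') = J a b c - J a b c')
  (Jn : forall a b c, `|J a b c| <= `|a| * `|b| * `|c|).

Lemma bdiff_trilinear n P C1 C2 C3 (F : U -> A) (G : U -> B) (Z : U -> C) :
  0 <= C1 -> 0 <= C2 -> 0 <= C3 ->
  bdiff ctrl base n P C1 F -> bdiff ctrl base n P C2 G -> bdiff ctrl base n P C3 Z ->
  bdiff ctrl base n P (3 ^+ n * C1 * C2 * C3) (fun x => J (F x) (G x) (Z x)).
Proof.
move=> C10 C20 C30 bF bG bZ us su.
have : (3 : R) ^+ size us <= 3 ^+ n by rewrite ler_eXn2l// ltr1n.
move=> h3 cu x r bx h.
apply: (@le_trans _ _ (3 ^+ size us * C1 * C2 * C3 * weight us)); last first.
  by rewrite ler_wpM2r ?(weight_ge0 cu)// !ler_wpM2r.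
elim: us n P C1 C2 C3 F G Z C10 C20 C30 bF bG bZ su {h3} cu x r bx h =>
    [|[u q] us IH] n P C1 C2 C3 F G Z C10 C20 C30 bF bG bZ su cu x r bx h.
  have := bF [::] su cu x r bx h; have := bG [::] su cu x r bx h.
  have := bZ [::] su cu x r bx h.
  rewrite /= /weight big_nil !mulr1 expr0 mul1r => hZ hG hF.
  by apply: le_trans (Jn _ _ _) _; rewrite !ler_pM ?mulr_ge0.
case: n bF bG bZ su => // n bF bG bZ su.
case: cu => /= cu q0 cus.
have hP : r + sizes us <= P - q.
  by move: h; rewrite /sizes big_cons /= addrCA -lerBrDl.
rewrite -/(fdiff (u :: [seq p.1 | p <- us]) _ x) fdiff_head.
rewrite (@eq_fdiff _ _ _ _ (fun y => J (F (y + u) - F y) (G (y + u)) (Z (y + u)) +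
   (J (F y) (G (y + u) - G y) (Z (y + u)) + J (F y) (G y) (Z (y + u) - Z y)))); last first.
  have tele (a b c d : W) : a - d = a - b + (b - c + (c - d)).
    by rewrite [b - c + _]addrA subrK addrA subrK.
  by move=> y; rewrite J1 J2 J3; exact: tele.
rewrite !fdiffD; apply: le_trans (ler_normD _ _) _.
apply: le_trans (lerD (lexx _) (ler_normD _ _)) _.
have m0 : P - q <= P by rewrite lerBlDr lerDl.
have mono (V : normedModType R) c (f : U -> V) : bdiff ctrl base n.+1 P c f ->
    bdiff ctrl base n (P - q) c f by exact: bdiff_mono.
have sh (V : normedModType R) c (f : U -> V) : bdiff ctrl base n.+1 P c f ->
    bdiff ctrl base n (P - q) c (fun y => f (y + u)).
  by move=> bf; apply: bdiff_mono (bdiff_shift baseD cu bf).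
have I1 := IH n (P - q) (C1 * q) C2 C3 _ _ _ (mulr_ge0 C10 q0) C20 C30
  (bdiff_head cu q0 bF) (sh _ _ _ bG) (sh _ _ _ bZ) su cus x r bx hP.
have I2 := IH n (P - q) C1 (C2 * q) C3 _ _ _ C10 (mulr_ge0 C20 q0) C30
  (mono _ _ _ bF) (bdiff_head cu q0 bG) (sh _ _ _ bZ) su cus x r bx hP.
have I3 := IH n (P - q) C1 C2 (C3 * q) _ _ _ C10 C20 (mulr_ge0 C30 q0)
  (mono _ _ _ bF) (mono _ _ _ bG) (bdiff_head cu q0 bZ) su cus x r bx hP.
apply: le_trans (lerD I1 (lerD I2 I3)) _.
rewrite /weight big_cons /= exprS le_eqVlt; apply/orP; left; apply/eqP; ring.
Qed.

End BdiffTrilinear.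

Section BdiffComposition.
Context (R : realType) (U : lmodType R) (ctrl base : U -> R -> Prop).

Lemma bdiff_comp (U' : lmodType R) (ctrl' base' : U' -> R -> Prop) (L : U -> U')
    (W : normedModType R) n P C (F : U' -> W) :
  {morph L : a b / a + b} ->
  (forall u q, ctrl u q -> ctrl' (L u) q) -> (forall x r, base x r -> base' (L x) r) ->
  bdiff ctrl' base' n P C F -> bdiff ctrl base n P C (fun x => F (L x)).
Proof.
move=> LD cc bb bF us su cus x r bx h.
rewrite (fdiff_comp _ F _ LD).
have := bF [seq (L p.1, p.2) | p <- us]; rewrite size_map => /(_ su).
rewrite /weight /sizes !big_map -!map_comp /=; apply; [|exact: bb bx|exact: h].
elim: us cus {su h} => //= p us IH [c1 c2 c3]; split=> //; [exact: cc|exact: IH].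
Qed.

Lemma fd_bound_bdiff (U' W : normedModType R) (L : U -> U') n P C (D : R) (F : U' -> W) :
  {morph L : a b / a + b} -> 1 <= D -> (forall u q, ctrl u q -> `|L u| <= D * q) ->
  fd_bound n C F -> bdiff ctrl base n P (C * D ^+ n) (fun x => F (L x)).
Proof.
move=> LD D1 cL fb us su cus x r _ _.
have D0 : 0 <= D by exact: le_trans D1.
rewrite (fdiff_comp _ F _ LD); apply: le_trans (fb _ _ _) _; first by rewrite !size_map.
rewrite -mulrA ler_wpM2l ?(fd_bound_ge0 fb)//.
apply: (@le_trans _ _ (D ^+ size us * weight us)); last first.
  by rewrite ler_wpM2r ?(weight_ge0 cus)// ler_weXn2l.
rewrite /weight -map_comp big_map.
elim: us cus {su} => [|p us IH] /=; first by rewrite !big_nil expr0 mulr1.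
move=> [p1 p2 cus]; rewrite !big_cons exprS mulrACA ler_pM ?IH//.
  by apply: prodr_ge0.
exact: cL.
Qed.

End BdiffComposition.

Section AfTrilinear.
Context (R : realType).

Lemma af_sum_fin (V : hilbert R) (I : Type) (P : I -> Prop) lam (J : finType)
    (F : J -> I -> V) : (forall i, P i -> 0 <= lam i) -> (forall k, af P lam (F k)) ->
  af P lam (fun i => \sum_k F k i).
Proof.
move=> l0 aF; rewrite (_ : (fun i => _) = fun i => \sum_(k < #|J|) F (enum_val k) i).
  by apply: af_sum.
by apply/funext => i; rewrite [RHS](reindex enum_rank) /=;
   [apply: eq_bigr => k _; rewrite enum_rankK|exact: onW_bij (enum_rank_bij _)].
Qed.

(** Approximating [F] first leaves finitely many bilinear maps [J (v j)]; divided by [|v j| + 1]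
    they have norm at most 1, as [af_bilinear] wants. *)
Lemma af_trilinear (A B C V : hilbert R) (J : A -> B -> C -> V) (I : Type) (P : I -> Prop)
    (F : I -> A) (G : I -> B) (Z : I -> C) (B2 B3 : R) :
  (forall a a' b c, J (a - a') b c = J a b c - J a' b c) ->
  (forall a b b' c, J a (b - b') c = J a b c - J a b' c) ->
  (forall a b c c', J a b (c - c') = J a b c - J a b c') ->
  (forall r s t a b c, J (r *: a) (s *: b) (t *: c) = (r * s * t) *: J a b c) ->
  (forall a b c, `|J a b c| <= `|a| * `|b| * `|c|) ->
  0 <= B2 -> 0 <= B3 -> (forall i, P i -> `|G i| <= B2) -> (forall i, P i -> `|Z i| <= B3) ->
  af P (fun=> 1) F -> af P (fun=> 1) G -> af P (fun=> 1) Z ->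
  af P (fun=> 1) (fun i => J (F i) (G i) (Z i)).
Proof.
move=> J1 J2 J3 JZ Jn B20 B30 GB ZB aF aG aZ; apply: af_approx => eps e0.
have J0 b c : J 0 b c = 0 by rewrite -(subrr 0) J1 subrr.
have JD b c : {morph (fun a => J a b c) : x y / x + y >-> x + y}.
  by move=> x y; rewrite -[y in LHS]opprK J1 -[- y]add0r J1 J0 opprD oppr0 opprK add0r.
have JZ1 r a b c : J (r *: a) b c = r *: J a b c.
  by have := JZ r 1 1 a b c; rewrite !scale1r !mulr1.
have b1 : 0 < B2 * B3 + 1 by rewrite ltr_wpDl// mulr_ge0.
have e1 := divr_gt0 e0 b1.
have [J0' [v [K [K0 HK]]]] := aF _ e1.
have /choice[c Hc] : forall i, exists c : J0' -> R, P i ->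
    (forall j, `|c j| <= K * 1) /\ `|F i - \sum_j c j *: v j| <= eps / (B2 * B3 + 1) * 1.
  move=> i; have [Pi|nPi] := pselect (P i); last by exists (fun=> 0).
  by have [c Hc] := HK i Pi; exists c.
exists (fun i => \sum_j c i j *: J (v j) (G i) (Z i)).
  apply: af_sum_fin => // j.
  apply: (af_scale (lam := fun=> 1) (M := K)) => //.
    by move=> i Pi; have [h _] := Hc i Pi; rewrite !mulr1; have := h j; rewrite mulr1.
  pose n := `|v j| + 1; have n0 : 0 < n by rewrite ltr_wpDl.
  rewrite (_ : (fun i => _) = (fun i => n *: (n^-1 *: J (v j) (G i) (Z i)))); last first.
    by apply/funext => i; rewrite scalerA divff ?scale1r// gt_eqF.
  apply: (af_scale (lam := fun=> 1) (M := n) (s := fun=> n)) => //; first exact: ltW.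
    by move=> i _; rewrite gtr0_norm.
  apply: (@af_bilinear _ _ _ _ (fun b c => n^-1 *: J (v j) b c) _ _ _ _ _ B2 B3) => //.
  - by move=> a a' b; rewrite J2 scalerBr.
  - by move=> a b b'; rewrite J3 scalerBr.
  - move=> s t a b; have := JZ 1 s t (v j) a b; rewrite scale1r mul1r => ->.
    by rewrite !scalerA mulrC.
  - move=> a b; rewrite normrZ ger0_norm ?invr_ge0 ?(ltW n0)//.
    rewrite ler_pdivrMl//; apply: le_trans (Jn _ _ _) _.
    by rewrite -mulrA ler_wpM2r ?mulr_ge0// /n lerDl.
  - by move=> i Pi; rewrite mulr1; exact: ZB.
move=> i Pi; rewrite mulr1; have [_ h] := Hc i Pi; rewrite mulr1 in h.
have -> : \sum_j c i j *: J (v j) (G i) (Z i) = J (\sum_j c i j *: v j) (G i) (Z i).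
  by rewrite (big_morph _ (JD _ _) (J0 _ _)); apply: eq_bigr => j _; rewrite JZ1.
rewrite -J1; apply: le_trans (Jn _ _ _) _.
apply: (@le_trans _ _ (eps / (B2 * B3 + 1) * B2 * B3)).
  by rewrite !ler_pM ?mulr_ge0 ?GB ?ZB.
by rewrite -mulrA mulrAC -mulrA ler_piMr ?(ltW e0)// ler_pdivrMr// mul1r lerDl.
Qed.

End AfTrilinear.

Section QuadraticRemainder.
Context (R : realType).

(** The two-sided derivative serves the space and path directions, the right limit serves time. *)
Lemma quadratic_remainder (f : R -> R) (D K : R) :
  (forall h, `|h| <= 1 -> `|f h - f 0 - h * D| <= K * h ^+ 2) ->
  [/\ derivable f 0 1, derive1 f 0 = D & (f h - f 0) / h @[h --> 0^'+] --> D].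
Proof.
move=> H.
have K0 : 0 <= K by have := H 1; rewrite normr1 expr1n mulr1 => /(_ (lexx _)); apply: le_trans.
have est h e : h != 0 -> 0 < e -> `|h| < Num.min 1 (e / (K + 1)) ->
    `|D - (f h - f 0) / h| < e.
  move=> h0 e0; rewrite lt_min => /andP[/ltW h1].
  have K1 : 0 < K + 1 by rewrite ltr_wpDl.
  have nh : 0 < `|h| by rewrite normr_gt0.
  rewrite ltr_pdivlMr// => h2.
  have -> : D - (f h - f 0) / h = - (f h - f 0 - h * D) / h by field.
  rewrite normrM normrN normfV ltr_pdivrMr//; apply: le_lt_trans (H h h1) _.
  rewrite -(real_normK (num_real h)) expr2 mulrA ltr_pM2r//.
  by apply: le_lt_trans h2; rewrite mulrC ler_wpM2l// lerDl.
have m0 e : 0 < e -> 0 < Num.min 1 (e / (K + 1)).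
  by move=> e0; rewrite lt_min ltr01 divr_gt0// ltr_wpDl.
have c : (h^-1 * (f (h + 0) - f 0) @[h --> 0^']) --> D.
  apply/cvgrPdist_lt => e e0; near=> h.
  rewrite addr0 mulrC; apply: est => //.
    by near: h; exact: nbhs_dnbhs_neq.
  by near: h; apply: dnbhs0_lt; exact: m0.
split.
- rewrite /derivable; apply/cvg_ex; exists D.
  rewrite (_ : (fun h : R => _) = (fun h : R => h^-1 * (f (h + 0) - f 0)))//.
  by apply/funext => h; rewrite /shift /= (_ : h *: (1 : R) = h)//; exact: mulr1.
- exact: cvg_lim c.
- apply/cvgrPdist_lt => e e0; near=> h.
  have h0 : 0 < h by [].
  by apply: est; rewrite ?gt_eqF// gtr0_norm//; near: h; apply: nbhs_right_lt; exact: m0.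
Unshelve. all: by end_near. Qed.

End QuadraticRemainder.

(** * Paths of bounded variation and the state space *)

Section VariationControl.
Context (R : realType) (T : R).
Hypothesis T0 : 0 < T.

(** Heine-Cantor: intervals shorter than [1/(n+1)] with increments at least [e] would have both ends
    arbitrarily close to a cluster point of the left ends, against continuity there. *)
Lemma monotone_control (om : R -> R) : om 0 = 0 ->
  (forall s t, 0 <= s -> s <= t -> t <= T -> om s <= om t) ->
  {within `[0, T], continuous om} -> control T om.
Proof.
move=> om0 om_le om_c; split=> // e e0.
apply: contrapT => nH.
have /choice[st Hst] : forall n : nat, exists p : R * R, [/\ 0 <= p.1, p.1 <= p.2, p.2 <= T,
    p.2 - p.1 < n.+1%:R^-1 & e <= om p.2 - om p.1].
  move=> n; apply: contrapT => nP; apply: nH; exists n.+1%:R^-1; first by rewrite invr_gt0.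
  move=> s t s0 st tT h; rewrite ltNge; apply/negP => h2; apply: nP.
  by exists (s, t).
have [] := @segment_compact R 0 T ((fun n => (st n).1) @ \oo).
  exists 0%N => // n _ /=; have [h1 h2 h3 _ _] := Hst n.
  by rewrite in_itv /= h1 (le_trans h2).
move=> p [pT cl].
have /subspace_continuousP /(_ p pT) /cvgrPdist_lt /(_ (e / 2)) := om_c.
rewrite divr_gt0// => /(_ isT); rewrite /within /= => /nbhs_ballP[d /= d0 Hd].
have d2 : 0 < d / 2 by rewrite divr_gt0.
have := @cvg_harmonic R => /cvgrPdist_lt /(_ _ d2) [N _ HN].
have [] := cl [set x | exists2 n, (N <= n)%N & x = (st n).1] (ball p (d / 2)).
- by exists N => // n /= Nn; exists n.
- exact: nbhsx_ballx.
move=> _ [[n Nn ->] pn].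
have [h1 h2 h3 h4 h5] := Hst n.
have := HN n Nn; rewrite /= /harmonic sub0r normrN ger0_norm// => h6.
have h7 : ball p d (st n).1.
  by move: pn; rewrite -!ball_normE /ball_ /= => /lt_le_trans; apply; lra.
have h8 : ball p d (st n).2.
  move: pn; rewrite -!ball_normE /ball_ /= => pn.
  apply: le_lt_trans (ler_distD (st n).1 _ _) _.
  rewrite [X in _ + X]distrC (ger0_norm (_ : 0 <= (st n).2 - (st n).1)) ?subr_ge0//.
  by have h9 := lt_trans h4 h6; move: pn h9; lra.
have b1 := Hd _ h7; have b2 := Hd _ h8.
rewrite /= !in_itv /= h1 (le_trans h2 h3) in b1.
rewrite /= !in_itv /= (le_trans h1 h2) h3 in b2.
have {}b1 := b1 isT; have {}b2 := b2 isT.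
have : `|om (st n).2 - om (st n).1| < e.
  apply: le_lt_trans (ler_distD (om p) _ _) _.
  by rewrite [e]splitr ltrD// distrC.
by rewrite ltNge (le_trans h5 (ler_norm _)).
Qed.

Lemma control_sum n (om : 'I_n -> R -> R) : (forall i, control T (om i)) ->
  control T (fun t => \sum_(i < n) om i t).
Proof.
elim: n om => [|n IH] om H.
  split=> [|s t _ _ _|r r0]; rewrite ?big_ord0//.
  by exists 1 => // s t _ _ _ _; rewrite !big_ord0 subrr.
rewrite (_ : (fun t => _) = fun t => \sum_(i < n) om (widen_ord (leqnSn n) i) t + om ord_max t).
  by apply: controlD => //; apply: IH.
by apply/funext => t; rewrite big_ord_recr.
Qed.

Context (e : nat).
Implicit Types c : pathT R e.

Lemma pvar_sum_ge0 q c s : 0 <= pvar_sum q 0 T c s.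
Proof. by apply: sumr_ge0 => i _; exact: powR_ge0. Qed.

Lemma pvar_sum_le q c s : 0 < q -> itv_partition 0 T s ->
  ((pvar_sum q 0 T c s `^ q^-1)%:E <= pvar q 0 T c)%E.
Proof.
move=> q0 ps; rewrite /pvar -poweR_EFin.
pose S := [set (pvar_sum q 0 T c s)%:E | s in itv_partition 0 T].
have h : ((pvar_sum q 0 T c s)%:E <= ereal_sup S)%E.
  by apply: ereal_sup_ubound; exists s.
have h0 : (0 <= (pvar_sum q 0 T c s)%:E)%E by rewrite lee_fin pvar_sum_ge0.
apply: gt0_ler_poweR => //; first by rewrite invr_ge0 ltW.
  by rewrite in_itv /= h0 leey.
by rewrite in_itv /= leey andbT (le_trans h0).
Qed.

Lemma enorm_ge0 n (v : 'rV[R]_n) : 0 <= enorm v.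
Proof. exact: sqrtr_ge0. Qed.

Lemma coord_le_enorm n (v : 'rV[R]_n) i : `|v 0 i| <= enorm v.
Proof. exact: le_trans (coord_le_norm v i) (norm_le_enorm v). Qed.

(** The control is the sum of the variation functions of the coordinates, continuous because the
    path is. Each one is at most the variation of the path, hence the factor [e]. *)
Lemma BV_control c : BV 0 T c -> exists om,
  [/\ control T om, lipc T om 1 c & ((om T)%:E <= e%:R%:E * pvar 1 0 T c)%E].
Proof.
move=> [cc cv _].
have pv0 : (0 <= pvar 1 0 T c)%E by exact: poweR_ge0.
have cfin : pvar 1 0 T c \is a fin_num by rewrite ge0_fin_numE.
pose f (i : 'I_e) s := c s 0 i.
have TVle i : (total_variation 0 T (f i) <= pvar 1 0 T c)%E.
  apply: ge_ereal_sup => _ [_ [s ps <-] <-].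
  apply: le_trans (pvar_sum_le c ltr01 ps); rewrite lee_fin invr1 powRr1 ?pvar_sum_ge0//.
  apply: ler_sum => j _; rewrite powRr1 ?enorm_ge0//.
  have := coord_le_enorm (c (nth T (0 :: s) j.+1) - c (nth T (0 :: s) j)) i.
  by rewrite !mxE.
have TVfin i : total_variation 0 T (f i) \is a fin_num.
  rewrite ge0_fin_numE ?total_variation_ge0 ?(ltW T0)//.
  by apply: le_lt_trans (TVle i) _.
have bv i : bounded_variation 0 T (f i) by apply/(bounded_variationP _ (ltW T0)).
have TVfin' i s t : 0 <= s -> s <= t -> t <= T -> total_variation s t (f i) \is a fin_num.
  move=> s0 st tT; apply/(bounded_variationP _ st).
  exact: (bounded_variationr s0 st (bounded_variationl (le_trans s0 st) tT (bv i))).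
pose om i t := fine (total_variation 0 t (f i)).
have om_diff i s t : 0 <= s -> s <= t -> t <= T ->
    om i t - om i s = fine (total_variation s t (f i)).
  move=> s0 st tT; rewrite /om (total_variationD _ s0 st) fineD ?TVfin' ?(le_trans st)//.
  by rewrite addrAC subrr add0r.
have f_le i s t : 0 <= s -> s <= t -> t <= T -> `|f i t - f i s| <= om i t - om i s.
  move=> s0 st tT; rewrite om_diff// -lee_fin fineK ?TVfin'//.
  exact: total_variation_ge.
have om_ctrl i : control T (om i).
  apply: monotone_control.
  - by rewrite /om total_variationxx.
  - by move=> s t s0 st tT; rewrite -subr_ge0; apply: le_trans (f_le i s t s0 st tT).
  apply: total_variation_continuous => //.
  apply/subspace_continuousP => x xT; apply/cvgrPdist_lt => eps eps0.
  have /subspace_continuousP /(_ x xT) /cvgrPdist_lt /(_ _ eps0) := cc.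
  apply: filterS => y; apply: le_lt_trans.
  by have := coord_le_norm (c x - c y) i; rewrite !mxE.
exists (fun t => \sum_i om i t); split.
- exact: control_sum.
- move=> s t s0 st tT; rewrite mul1r -sumrB.
  have ge0 : 0 <= \sum_i (om i t - om i s).
    by apply: sumr_ge0 => i _; apply: le_trans (f_le i s t s0 st tT).
  apply: norm_row_le => // i; rewrite !mxE.
  apply: le_trans (f_le i s t s0 st tT) _.
  rewrite (bigD1 i)//= lerDl; apply: sumr_ge0 => j _.
  exact: le_trans (f_le j s t s0 st tT).
rewrite -(fineK cfin) -EFinM lee_fin.
apply: (@le_trans _ _ (\sum_(i < e) fine (pvar 1 0 T c))).
  by apply: ler_sum => i _; rewrite fine_le.
by rewrite sumr_const card_ord -[leLHS]mulr_natl.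
Qed.

Lemma pvar_norm_ge0 q c : (0 <= pvar_norm q 0 T c)%E.
Proof. by rewrite adde_ge0 ?lee_fin ?enorm_ge0 ?poweR_ge0. Qed.

Lemma bounded_path_pvar_norm c (v : R) : BV 0 T c -> (pvar_norm 1 0 T c <= v%:E)%E ->
  bounded_path T (e%:R * v) c /\ `|c 0| <= v.
Proof.
move=> cBV cv; have [om [om_c lc omT]] := BV_control cBV.
have p0 : (0 <= pvar 1 0 T c)%E by exact: poweR_ge0.
have pv : (pvar 1 0 T c <= v%:E)%E.
  by apply: le_trans cv; rewrite leeDr ?lee_fin ?enorm_ge0.
split.
  exists om; split=> //; rewrite -lee_fin; apply: le_trans omT _.
  by rewrite EFinM lee_wpmul2l// lee_fin.
apply: le_trans (norm_le_enorm _) _; rewrite -lee_fin; apply: le_trans cv.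
by rewrite leeDl.
Qed.

(** A single partition through [s] suffices; strictness of partitions sets [s = 0] and [s = T]
    apart. *)
Lemma pvar_ge_increment q c s : 0 < q -> 0 <= s -> s <= T ->
  ((enorm (c s - c 0))%:E <= pvar q 0 T c)%E.
Proof.
move=> q0 s0 sT.
have [->|sn0] := eqVneq s 0.
  rewrite subrr (_ : enorm 0 = 0) ?poweR_ge0//.
  by rewrite /enorm big1 ?sqrtr0// => i _; rewrite mxE expr0n.
have {}s0 : 0 < s by rewrite lt_def sn0.
suff [sg [psg sz nsg]] : exists sg, [/\ itv_partition 0 T sg, (0 < size sg)%N & nth T (0 :: sg) 1 = s].
  apply: le_trans (pvar_sum_le c q0 psg); rewrite lee_fin.
  apply: (@le_trans _ _ ((enorm (c s - c 0) `^ q) `^ q^-1)).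
    by rewrite -powRrM mulfV ?gt_eqF// powRr1// enorm_ge0.
  rewrite ge0_ler_powR ?invr_ge0 ?(ltW q0) ?nnegrE ?powR_ge0 ?pvar_sum_ge0//.
  rewrite /pvar_sum big_ltn// nsg /= lerDl.
  by apply: sumr_ge0 => i _; exact: powR_ge0.
have [sT'|Ts] := ltP s T.
  by exists [:: s; T]; split=> //; split; rewrite /= ?s0 ?sT'.
exists [:: T]; split=> //; first by split; rewrite /= ?T0.
by apply/eqP; rewrite eq_le Ts sT.
Qed.

Lemma pvar_norm_sup q c (v : R) s : 0 < q -> 0 <= s -> s <= T ->
  (pvar_norm q 0 T c <= v%:E)%E -> `|c s| <= v.
Proof.
move=> q0 s0 sT h.
have h2 : ((enorm (c 0) + enorm (c s - c 0))%:E <= v%:E)%E.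
  by apply: le_trans h; rewrite EFinD leeD// pvar_ge_increment.
rewrite lee_fin in h2; apply: le_trans h2.
have e1 : c s = c 0 + (c s - c 0) by rewrite addrC subrK.
rewrite {1}e1; apply: le_trans (ler_normD _ _) _.
by apply: lerD; exact: norm_le_enorm.
Qed.

End VariationControl.

Section StateSpace.
Context (R : realType) (T p : R) (d e : nat).
Hypotheses (T0 : 0 < T) (p1 : 1 < p).
Notation state := (state T p d e).
Notation point := ('rV[R]_(1 + d) * (R -> 'rV[R]_e))%type.

(* States are handled as points of a vector space, in which all the directions
   of differentiation (including time) are vectors. *)
Definition point_of (w : state) : point := (time_space (st_t w) (st_x w), st_path w).

(** Sup-norm closeness is weaker than [dist_state], yet enough for the continuity of the signature
    under a bound on the variations. *)
Definition near_point (dl : R) (x y : point) : Prop :=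
  `|x.1 - y.1| <= dl /\ forall s, 0 <= s -> s <= T -> `|x.2 s - y.2 s| <= dl.

Lemma near_pointD a b x y z : near_point a x y -> near_point b y z -> near_point (a + b) x z.
Proof.
move=> [h1 h2] [k1 k2]; split=> [|s s0 sT].
  by apply: le_trans (ler_distD y.1 _ _) _; exact: lerD.
by apply: le_trans (ler_distD (y.2 s) _ _) _; rewrite lerD ?h2 ?k2.
Qed.

Lemma near_point_shift a x y u : near_point a x y -> near_point a (x + u) (y + u).
Proof.
move=> [h1 h2]; split=> [|s s0 sT] /=; first by rewrite opprD addrACA subrr addr0.
rewrite -[(x.2 + u.2) s]/(x.2 s + u.2 s) -[(y.2 + u.2) s]/(y.2 s + u.2 s).
by rewrite opprD addrACA subrr addr0 h2.
Qed.

Lemma norm_row_mx_le m n (u : 'rV[R]_m) (v : 'rV[R]_n) (b : R) :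
  `|u| <= b -> `|v| <= b -> `|row_mx u v| <= b.
Proof.
move=> ub vb; apply: norm_row_le => [|i]; first exact: le_trans ub.
rewrite mxE; case: (fintype.split i) => j; first exact: le_trans (coord_le_norm _ _) ub.
exact: le_trans (coord_le_norm _ _) vb.
Qed.

Lemma dist_state_near (w v : state) (eps : R) : (dist_state w v < eps%:E)%E ->
  near_point eps (point_of w) (point_of v).
Proof.
move=> /ltW h.
have h3 := pvar_norm_ge0 T p (st_path w \- st_path v)%R.
have h2 : (0 <= (enorm (st_x w - st_x v))%:E)%E by rewrite lee_fin enorm_ge0.
have h1 : (0 <= `|st_t w - st_t v|%:E)%E by rewrite lee_fin.
have k1 : `|st_t w - st_t v| <= eps.
  by rewrite -lee_fin; apply: le_trans h; rewrite /dist_state -addeA leeDl// adde_ge0.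
have k2 : enorm (st_x w - st_x v) <= eps.
  by rewrite -lee_fin; apply: le_trans h; rewrite /dist_state -addeA addeCA leeDl// adde_ge0.
have k3 : (pvar_norm p 0 T (st_path w \- st_path v)%R <= eps%:E)%E.
  by apply: le_trans h; rewrite /dist_state leeDr// adde_ge0.
split=> [|s s0 sT].
  rewrite /= /time_space opp_row_mx add_row_mx; apply: norm_row_mx_le.
    by apply: norm_row_le => [|i]; rewrite ?mxE ?mxE//; exact: le_trans k1.
  exact: le_trans (norm_le_enorm _) k2.
by apply: (pvar_norm_sup T0 _ s0 sT k3); rewrite (lt_trans ltr01).
Qed.

Lemma nbhs_near_point (w : state) (dl : R) : 0 < dl ->
  nbhs w [set v | near_point dl (point_of w) (point_of v)].
Proof.
move=> d0; rewrite nbhsE /=.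
(* Radii strictly below [dl] make the set open: a point at radius [a] leaves the room [dl - a]. *)
exists [set v | exists2 a, a < dl & near_point a (point_of w) (point_of v)].
  split; last first.
    exists 0 => //; split=> [|s _ _]; by rewrite subrr normr0.
  move=> v [a ad av]; exists (dl - a); first by rewrite subr_gt0.
  move=> v' vv'.
  have [b bd vb] : exists2 b, b < dl - a & (dist_state v v' < b%:E)%E.
    have D0 : (0 <= dist_state v v')%E.
      rewrite /dist_state adde_ge0 ?pvar_norm_ge0// adde_ge0 ?lee_fin ?enorm_ge0//.
    have Df : dist_state v v' \is a fin_num by rewrite ge0_fin_numE// (lt_trans vv' (ltry _)).
    move: vv'; rewrite -(fineK Df) lte_fin => h.
    exists ((fine (dist_state v v') + (dl - a)) / 2); first by lra.
    by rewrite lte_fin; lra.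
  exists (a + b); first by lra.
  exact: near_pointD av (dist_state_near vb).
by move=> v [a ad [h1 h2]]; split=> [|s s0 sT]; [exact: le_trans h1 (ltW ad)|apply: le_trans (h2 s s0 sT) (ltW ad)].
Qed.

Lemma within_continuous_near (A : set state) (f : state -> R) :
  (forall w, A w -> forall eps : R, 0 < eps -> exists2 dl, 0 < dl & forall v, A v ->
     near_point dl (point_of w) (point_of v) -> `|f w - f v| < eps) ->
  {within A, continuous f}.
Proof.
move=> H; apply/subspace_continuousP => w Aw; apply/cvgrPdist_lt => eps eps0.
have [dl dl0 Hd] := H w Aw _ eps0.
have := nbhs_near_point w dl0; apply: filterS => v wv Av.
exact: Hd.
Qed.

(** Points with spatial parts of norm above [n] would cluster in [X], and infinitely many of these
    parts would lie within 1 of a fixed vector. *)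
Lemma compact_state_bounded (X : set state) : compact X ->
  exists rho : R, forall w, X w -> `|st_x w| <= rho.
Proof.
move=> cX; apply: contrapT => nH.
have /choice[w Hw] : forall n : nat, exists w, X w /\ n%:R < `|st_x w|.
  move=> n; apply: contrapT => nP; apply: nH; exists n%:R => w Xw.
  by rewrite leNgt; apply/negP => h; apply: nP; exists w.
have [|v [Xv cl]] := cX (w @ \oo) _; first by exists 0%N => // n _; exact: (Hw n).1.
pose N := Num.truncn (`|st_x v| + 1).
have [] := cl [set y | exists2 n, (N.+1 <= n)%N & y = w n]
   [set y | near_point 1 (point_of v) (point_of y)].
- by exists N.+1 => // n /= Nn; exists n.
- exact: nbhs_near_point.
move=> _ [[n Nn ->] [+ _]].
rewrite /= /time_space opp_row_mx add_row_mx => h.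
have h1 : `|st_x v - st_x (w n)| <= 1.
  apply: norm_row_le => // i; apply: le_trans h.
  by have := coord_le_norm (row_mx (const_mx (st_t v) + - const_mx (st_t (w n)) : 'rV_1)
     (st_x v - st_x (w n))) (rshift 1 i); rewrite row_mxEr.
have h2 := (Hw n).2.
have h3 : `|st_x (w n)| <= `|st_x v| + 1.
  have -> : st_x (w n) = st_x v - (st_x v - st_x (w n)) by rewrite opprB addrC subrK.
  by apply: le_trans (ler_normB _ _) _; rewrite lerD2l.
have h4 : `|st_x v| + 1 < N.+1%:R by exact: truncnS_gt.
have h5 : N.+1%:R <= n%:R :> R by rewrite ler_nat.
by have := lt_le_trans (lt_le_trans h2 h3) (le_trans (ltW h4) h5); rewrite ltxx.
Qed.

End StateSpace.

(** * The feature map of the kernel *)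

Section FeatureMap.
Context (R : realType) (T p : R) (d e : nat) (X : set (state T p d e))
  (g : 'rV[R]_e -> 'rV[R]_e -> R) (Hg : rkhs g) (TV : tensor_algebra Hg)
  (k : 'rV[R]_(1 + d) -> 'rV[R]_(1 + d) -> R) (Hk : rkhs k)
  (l : 'rV[R]_e -> 'rV[R]_e -> R) (Hl : rkhs l)
  (H : rkhs (restrict_kernel (@kappa R T p d e g Hg TV k l) X)).
Notation point := ('rV[R]_(1 + d) * (R -> 'rV[R]_e))%type.

(** Defined at every point of the vector space, so that states moved out of [X] still have a feature
    in [H]. *)
Definition feature (x : point) : H :=
  rk_tri H (fun a => rk_sec Hk (point_of (sval a)).1)
    (fun a => rk_sec Hl ((point_of (sval a)).2 0))
    (fun a => path_sig T TV (point_of (sval a)).2)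
    (rk_sec Hk x.1) (rk_sec Hl (x.2 0)) (path_sig T TV x.2).

Lemma restrict_kernelE (a b : {s | X s}) :
  restrict_kernel (@kappa R T p d e g Hg TV k l) X a b =
  inner (rk_sec Hk (point_of (sval a)).1) (rk_sec Hk (point_of (sval b)).1) *
  inner (rk_sec Hl ((point_of (sval a)).2 0)) (rk_sec Hl ((point_of (sval b)).2 0)) *
  inner (path_sig T TV (point_of (sval a)).2) (path_sig T TV (point_of (sval b)).2).
Proof. by rewrite !inner_sec -mulrA. Qed.

Lemma rk_extendE (h : H) (w : state T p d e) : rk_extend h w = inner h (feature (point_of w)).
Proof.
have fE a : rk_ev (feature (point_of w)) a = @kappa R T p d e g Hg TV k l w (sval a).
  by rewrite rk_triE; [rewrite !inner_sec -mulrA|exact: restrict_kernelE].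
rewrite /rk_extend; congr inner; case: xgetP => [f _ /= fE'|/(_ (feature (point_of w)))//].
by apply: rk_ext => a; rewrite fE fE'.
Qed.

Lemma feature_at (h : H) (a : {s | X s}) : inner h (feature (point_of (sval a))) = rk_ev h a.
Proof.
rewrite -rk_repr; congr inner; apply: rk_ext => b.
by rewrite rk_triE; [rewrite rk_secE restrict_kernelE|exact: restrict_kernelE].
Qed.

Context (Cf Ck Cl : R).
Hypotheses (T0 : 0 < T) (fbg : fd_bound 4 Cf (rk_sec Hg)) (fbk : fd_bound 3 Ck (rk_sec Hk))
  (fbl : fd_bound 3 Cl (rk_sec Hl)).

Let Tge0 : 0 <= T. Proof. exact: ltW. Qed.
Let Ck0 : 0 <= Ck. Proof. exact: fd_bound_ge0 fbk. Qed.
Let Cl0 : 0 <= Cl. Proof. exact: fd_bound_ge0 fbl. Qed.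

Let tri1 a a' b c := @rk_triB1 _ _ _ H _ _ _ _ _ _ restrict_kernelE a a' b c.
Let tri2 a b b' c := @rk_triB2 _ _ _ H _ _ _ _ _ _ restrict_kernelE a b b' c.
Let tri3 a b c c' := @rk_triB3 _ _ _ H _ _ _ _ _ _ restrict_kernelE a b c c'.
Let triZ r s t a b c := @rk_triZ _ _ _ H _ _ _ _ _ _ restrict_kernelE r s t a b c.
Let trin a b c := @rk_tri_norm _ _ _ H _ _ _ _ _ _ restrict_kernelE a b c.

(** Only the variation of the path draws on the budget of a base point: the features of [k] and [l]
    have bounded differences everywhere, so [pt_ctrl] leaves the other components free. *)
Definition dir_ctrl (W : R) (om : R -> R) (u : point) (q : R) : Prop :=
  [/\ `|u.1| <= q, `|u.2 0| <= W * q & lipc T om q u.2].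
Definition pt_ctrl (om : R -> R) (x : point) (r : R) : Prop := lipc T om r x.2.

Lemma dir_ctrlZ W om u q (a : R) : dir_ctrl W om u q -> dir_ctrl W om (a *: u) (`|a| * q).
Proof.
move=> [u1 u2 u3]; split; first by rewrite normrZ ler_wpM2l.
  by rewrite -[(a *: u).2 0]/(a *: u.2 0) normrZ mulrCA ler_wpM2l.
exact: lipcZ.
Qed.

Lemma pt_ctrlD W om x r u q : pt_ctrl om x r -> dir_ctrl W om u q -> pt_ctrl om (x + u) (r + q).
Proof. by move=> xr [_ _ uq]; exact: lipcD. Qed.

Let sig_const W := expR (8 * incr_const Cf W 5 * W).

Lemma path_sig_norm W om r x : 1 <= W -> control T om -> om T <= W -> r <= 5 ->
  pt_ctrl om x r -> `|path_sig T TV x.2| <= sig_const W.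
Proof.
move=> W1 om_c omW r5 xr.
have := @path_sig_bdiff _ T e g Hg TV Cf Tge0 fbg om W 5 om_c omW W1 (ler0n _ 5) [::] isT I x.2 r xr.
by rewrite /sizes /weight !big_nil addr0 mulr1; exact.
Qed.

(** Order 3 and budget 5 are what two derivatives in succession require: 1 for the point and 2 for
    each derivative. *)
Lemma feature_bdiff W : 1 <= W -> exists2 C : R, 0 <= C & forall om, control T om -> om T <= W ->
  bdiff (dir_ctrl W om) (pt_ctrl om) 3 5 C feature.
Proof.
move=> W1; exists (3 ^+ 3 * (Ck * 1 ^+ 3) * (Cl * W ^+ 3) * sig_const W).
  by rewrite !mulr_ge0 ?exprn_ge0 ?expR_ge0// (le_trans ler01).
move=> om om_c omW.
apply: (bdiff_trilinear (@pt_ctrlD W om) tri1 tri2 tri3 trin).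
- by rewrite mulr_ge0.
- by rewrite mulr_ge0// exprn_ge0// (le_trans ler01).
- exact: expR_ge0.
- by apply: (fd_bound_bdiff (L := fst)) => // u q [u1 _ _]; rewrite mul1r.
- by apply: (fd_bound_bdiff (L := fun x : point => x.2 0)) => // u q [_ u2 _].
apply: (bdiff_comp (L := snd) (ctrl' := fun c q => lipc T om q c) (base' := fun c q => lipc T om q c)).
- by [].
- by move=> u q [].
- by [].
by apply: path_sig_bdiff.
Qed.

(** One factor of the trilinear map is changed at a time. The constant 3 is that of a point moved
    along two directions. *)
Lemma feature_lipschitz W : 1 <= W -> exists2 C : R, 0 <= C & forall x x' om om' dl,
  control T om -> control T om' -> om T <= W -> om' T <= W ->
  pt_ctrl om x 3 -> pt_ctrl om' x' 3 -> near_point T dl x x' ->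
  `|feature x - feature x'| <= C * dl.
Proof.
move=> W1; have W0 : 0 <= W by exact: le_trans W1.
have Cf0 : 0 <= Cf by exact: fd_bound_ge0 fbg.
pose E := sig_const W; have E0 : 0 <= E by exact: expR_ge0.
pose B := expR (Cf * 3 * W); have B0 : 0 <= B by exact: expR_ge0.
pose CS := (2 * B + B * (Cf * 3) * W) * (2 * Cf) * B.
have CS0 : 0 <= CS by rewrite !(mulr_ge0, addr_ge0).
exists (Ck * Cl * E + Ck * Cl * E + Ck * Cl * CS); first by rewrite !addr_ge0// mulr_ge0// mulr_ge0.
move=> x x' om om' dl om_c om_c' omW omW' xc xc' [n1 n2].
have r35 : 3 <= 5 :> R by rewrite ler_nat.
have s1 := path_sig_norm W1 om_c omW r35 xc; have s2 := path_sig_norm W1 om_c' omW' r35 xc'.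
have s3 := @path_sig_lipschitz _ T e g Hg TV Cf Tge0 fbg om om' W 3 om_c om_c' omW omW'
  (ler0n _ 3) x.2 x'.2 dl xc xc' n2.
have fb0 (U V : normedModType R) n C (f : U -> V) y : fd_bound n C f -> `|f y| <= C.
  by move=> /(_ [::] isT y); rewrite big_nil mulr1.
have k1 := fb0 _ _ _ _ _ x.1 fbk; have k2 := fb0 _ _ _ _ _ x'.1 fbk.
have l1 := fb0 _ _ _ _ _ (x.2 0) fbl; have l2 := fb0 _ _ _ _ _ (x'.2 0) fbl.
have dl0 : 0 <= dl by exact: le_trans n1.
have k3 : `|rk_sec Hk x.1 - rk_sec Hk x'.1| <= Ck * dl.
  by apply: le_trans (fd_bound_lipschitz _ _ fbk) _; rewrite ler_wpM2l.
have l3 : `|rk_sec Hl (x.2 0) - rk_sec Hl (x'.2 0)| <= Cl * dl.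
  by apply: le_trans (fd_bound_lipschitz _ _ fbl) _; rewrite ler_wpM2l// n2.
set a := rk_sec Hk x.1 in k1 k3; set a' := rk_sec Hk x'.1 in k2 k3.
set b := rk_sec Hl (x.2 0) in l1 l3; set b' := rk_sec Hl (x'.2 0) in l2 l3.
set c := path_sig T TV x.2 in s1 s3; set c' := path_sig T TV x'.2 in s2 s3.
rewrite /feature -/a -/a' -/b -/b' -/c -/c'.
pose J := rk_tri H (fun a => rk_sec Hk (point_of (sval a)).1)
    (fun a => rk_sec Hl ((point_of (sval a)).2 0))
    (fun a => path_sig T TV (point_of (sval a)).2).
rewrite -/(J a b c) -/(J a' b' c').
have -> : J a b c - J a' b' c' = J (a - a') b c + (J a' (b - b') c + J a' b' (c - c')).
  have tele (x1 x2 x3 x4 : H) : x1 - x4 = (x1 - x2) + ((x2 - x3) + (x3 - x4)) by hring.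
  by rewrite /J tri1 tri2 tri3; exact: tele.
apply: le_trans (ler_normD _ _) _; apply: le_trans (lerD (lexx _) (ler_normD _ _)) _.
rewrite !mulrDl -addrA; apply: lerD; last apply: lerD.
- rewrite (_ : Ck * Cl * E * dl = Ck * dl * Cl * E); last by ring.
  by apply: le_trans (trin _ _ _) _; rewrite !ler_pM ?mulr_ge0.
- rewrite (_ : Ck * Cl * E * dl = Ck * (Cl * dl) * E); last by ring.
  by apply: le_trans (trin _ _ _) _; rewrite !ler_pM ?mulr_ge0.
rewrite (_ : Ck * Cl * CS * dl = Ck * Cl * (CS * dl)); last by ring.
by apply: le_trans (trin _ _ _) _; rewrite !ler_pM ?mulr_ge0.
Qed.

(** Second differences mix the paths of the point and of both directions, so all three are put under
    one control. *)
Definition conf (W : R) (x u u' : point) : Prop := exists om,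
  [/\ control T om, om T <= W, pt_ctrl om x 1, dir_ctrl W om u 1 & dir_ctrl W om u' 1].

Lemma feature_derivatives W : 1 <= W -> exists2 C : R, 0 <= C & forall x u u', conf W x u u' ->
  [/\ forall b : R, `|b| <= 1 -> forall h : R, `|h| <= 1 ->
        `|feature (x + b *: u' + h *: u) - feature (x + b *: u') -
          h *: dder feature u (x + b *: u')| <= 2 * C * h ^+ 2 &
      forall b : R, `|b| <= 1 ->
        `|dder feature u (x + b *: u') - dder feature u x -
          b *: dder (dder feature u) u' x| <= 2 * C * b ^+ 2].
Proof.
move=> W1; have [C C0 HC] := feature_bdiff W1; exists C => // x u u' [om [om_c omW xc uc u'c]].
have bF := HC om om_c omW.
have Dp := @pt_ctrlD W om; have Zc := @dir_ctrlZ W om.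
split=> [b b1|].
  have xb : pt_ctrl om (x + b *: u') (1 + `|b| * 1) by apply: Dp xc (Zc _ _ _ u'c).
  by have [] := dder_rate Dp Zc C0 bF xb uc _ => //; rewrite mulr1; lra.
have bD := bdiff_dder Dp Zc C0 bF uc.
by have [] := dder_rate Dp Zc C0 bD xc u'c _ => //; lra.
Qed.

(* Conversion checks that unfold these constants do not terminate in practice. *)
Opaque feature dder.

Definition quot1 (h : R) (u x : point) : H := h^-1 *: (feature (x + h *: u) - feature x).
(** The inner step is [h ^+ 2], so that the error of the inner quotients, once divided by the outer
    step [h], is still of order [h]. *)
Definition quot2 (h : R) (u u' x : point) : H :=
  h^-1 *: (quot1 (h ^+ 2) u (x + h *: u') - quot1 (h ^+ 2) u x).

Let sub_sub (a b c a' : H) : a - b - (c - a') = (a - c) - (b - a').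
Proof. hring. Qed.

Lemma quotient_rate W : 1 <= W -> exists2 C : R, 0 <= C & forall h : R, 0 < h -> h <= 1 ->
  forall x u u', conf W x u u' ->
    `|dder feature u x - quot1 h u x| <= C * h /\
    `|dder (dder feature u) u' x - quot2 h u u' x| <= C * h.
Proof.
move=> W1; have [C C0 HC] := feature_derivatives W1.
have q1 (D a : H) (h K : R) : 0 < h -> `|a - h *: D| <= K * h ^+ 2 -> `|D - h^-1 *: a| <= K * h.
  move=> h0 hD; have -> : D - h^-1 *: a = - (h^-1 *: (a - h *: D)).
    by rewrite scalerBr scalerA mulVf ?gt_eqF// scale1r opprB.
  rewrite normrN normrZ gtr0_norm ?invr_gt0// ler_pdivrMl//.
  by apply: le_trans hD _; rewrite expr2 mulrCA.
(* [2 C] for the outer quotient plus [2 C] for each of the two inner ones. *)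
exists (6 * C); first by rewrite mulr_ge0.
move=> h h0 h1 x u u' xuu; have [D1 D2] := HC x u u' xuu.
have h_1 : `|h| <= 1 by rewrite gtr0_norm.
have d1 y (b : R) : `|b| <= 1 -> y = x + b *: u' -> forall h', 0 < h' -> h' <= 1 ->
    `|dder feature u y - quot1 h' u y| <= 2 * C * h'.
  move=> b1 -> h' h'0 h'1; apply: q1 => //; apply: D1 => //.
  by rewrite gtr0_norm.
have x0 : x = x + (0 : R) *: u' by rewrite scale0r addr0.
split.
  have b0 : `|0 : R| <= 1 by rewrite normr0.
  apply: le_trans (d1 x 0 b0 x0 h h0 h1) _.
  by rewrite ler_wpM2r ?(ltW h0)// ler_wpM2r// ler_nat.
have h2 : 0 < h ^+ 2 by rewrite exprn_gt0.
have h21 : h ^+ 2 <= 1 by rewrite exprn_ile1// ltW.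
have b0 : `|0 : R| <= 1 by rewrite normr0.
have e1 := d1 x 0 b0 x0 _ h2 h21.
have e2 := d1 _ h h_1 (erefl _) _ h2 h21.
have e3 := q1 _ _ _ _ h0 (D2 h h_1).
rewrite /quot2; set G1 := quot1 _ _ _ in e2 *; set G0 := quot1 _ _ _ in e1 *.
set A1 := dder feature u (x + h *: u') in e2 e3; set A0 := dder feature u x in e1 e3.
move: (dder (dder feature u) u' x) e3 => D e3; clearbody A1 A0 G1 G0.
apply: le_trans (ler_distD (h^-1 *: (A1 - A0)) _ _) _.
rewrite -scalerBr normrZ gtr0_norm ?invr_gt0//.
have e4 : `|A1 - A0 - (G1 - G0)| <= 2 * C * h ^+ 2 + 2 * C * h ^+ 2.
  rewrite sub_sub.
  by apply: le_trans (ler_normB _ _) _; rewrite lerD.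
have e5 : h^-1 * `|A1 - A0 - (G1 - G0)| <= 4 * C * h.
  rewrite ler_pdivrMl//; apply: le_trans e4 _.
  by rewrite le_eqVlt; apply/orP; left; apply/eqP; ring.
by apply: le_trans (lerD e3 e5) _; lra.
Qed.

Lemma conf_move W x u u' (a b : R) : 1 <= W -> `|a| <= 1 -> `|b| <= 1 -> conf W x u u' ->
  exists om, [/\ control T om, om T <= W & pt_ctrl om (x + b *: u' + a *: u) 3].
Proof.
move=> W1 a1 b1 [om [om_c omW xc uc u'c]]; exists om; split=> //.
have h := pt_ctrlD (pt_ctrlD xc (dir_ctrlZ b u'c)) (dir_ctrlZ a uc).
have [_ o_le _] := om_c.
move=> s t s0 st tT; apply: le_trans (h s t s0 st tT) _.
rewrite ler_wpM2r ?subr_ge0 ?o_le//; lra.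
Qed.

(** The derivatives are uniform limits of difference quotients, and for a fixed step these are
    Lipschitz with respect to [near_point] because the feature is. *)
Lemma derivatives_near W (eps : R) : 1 <= W -> 0 < eps -> exists2 dl, 0 < dl &
  forall x x' u u', conf W x u u' -> conf W x' u u' -> near_point T dl x x' ->
  [/\ `|feature x - feature x'| <= eps, `|dder feature u x - dder feature u x'| <= eps &
      `|dder (dder feature u) u' x - dder (dder feature u) u' x'| <= eps].
Proof.
move=> W1 eps0; have [C C0 HC] := quotient_rate W1; have [L L0 HL] := feature_lipschitz W1.
pose h := Num.min 1 (eps / (4 * (C + 1))).
have C1 : 0 < C + 1 by rewrite ltr_wpDl.
have h0 : 0 < h by rewrite lt_min ltr01 divr_gt0// mulr_gt0.
have h1 : h <= 1 by rewrite ge_min lexx.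
have Ch : C * h <= eps / 4.
  have : h <= eps / (4 * (C + 1)) by rewrite ge_min lexx orbT.
  rewrite ler_pdivlMr ?mulr_gt0// => hh; rewrite ler_pdivlMr//.
  apply: le_trans hh; rewrite (mulrC C) -mulrA ler_wpM2l ?(ltW h0)//; lra.
have fin : C * h + (eps / 2 + C * h) <= eps by lra.
have half : eps / 2 <= eps by lra.
have h2 : 0 < h ^+ 2 by rewrite exprn_gt0.
have h21 : h ^+ 2 <= 1 by rewrite exprn_ile1// ltW.
(* The sum of the absolute values of the coefficients of [feature] in [quot2], in [quot1] and in
   [feature] itself: one Lipschitz constant, up to [L], for all three. *)
pose M := h^-1 * ((h ^+ 2)^-1 * 2) * 2 + h^-1 * 2 + 1.
have M0 : 0 < M.
  by rewrite ltr_wpDl// addr_ge0// ?mulr_ge0 ?invr_ge0 ?(ltW h0) ?(ltW h2).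
have L1 : 0 < L + 1 by rewrite ltr_wpDl.
pose dl := eps / 2 / (M * (L + 1)).
have dl0 : 0 < dl by rewrite !divr_gt0// mulr_gt0.
exists dl => // x x' u u' cx cx' nx.
have Pn a b : `|a| <= 1 -> `|b| <= 1 ->
    `|feature (x + b *: u' + a *: u) - feature (x' + b *: u' + a *: u)| <= L * dl.
  move=> a1 b1; have [om [z1 z2 z3]] := conf_move W1 a1 b1 cx.
  have [om' [z1' z2' z3']] := conf_move W1 a1 b1 cx'.
  by apply: HL z1 z1' z2 z2' z3 z3' _; do 2! apply: near_point_shift.
have LM : L * dl * M <= eps / 2.
  have e5 (m : R) : 0 < m -> L * (eps / 2 / (m * (L + 1))) * m = eps / 2 * (L / (L + 1)).
    by move=> m0; field; rewrite !gt_eqF.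
  rewrite /dl e5// ler_piMr ?(ltW (divr_gt0 _ _))//.
  by rewrite ler_pdivrMr// mul1r lerDl.
have Ld0 : 0 <= L * dl by rewrite mulr_ge0// ltW.
have M1 : 1 <= M.
  by rewrite lerDr addr_ge0// ?mulr_ge0 ?invr_ge0 ?(ltW h0) ?(ltW h2).
have i0 : 0 <= h^-1 by rewrite invr_ge0 ltW.
have i2 : 0 <= (h ^+ 2)^-1 by rewrite invr_ge0 ltW.
have n0 : `|0 : R| <= 1 by rewrite normr0.
have nh : `|h| <= 1 by rewrite gtr0_norm.
have nh2 : `|h ^+ 2| <= 1 by rewrite gtr0_norm.
have Q1 (a b : R) : 0 < a -> a <= 1 -> `|b| <= 1 ->
    `|quot1 a u (x + b *: u') - quot1 a u (x' + b *: u')| <= a^-1 * 2 * (L * dl).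
  move=> a0 a1 b1; rewrite /quot1 -scalerBr normrZ gtr0_norm ?invr_gt0// -mulrA.
  rewrite ler_wpM2l ?invr_ge0 ?(ltW a0)// mulr_natl mulr2n.
  rewrite sub_sub.
  apply: le_trans (ler_normB _ _) (lerD (Pn a b _ b1) _); first by rewrite gtr0_norm.
  by have := Pn 0 b n0 b1; rewrite scale0r !addr0.
have Q10 (a : R) : 0 < a -> a <= 1 -> `|quot1 a u x - quot1 a u x'| <= a^-1 * 2 * (L * dl).
  by move=> a0 a1; have := Q1 a 0 a0 a1 n0; rewrite scale0r !addr0.
have split4 (A A' B B' : H) : `|A - B| <= C * h -> `|A' - B'| <= C * h -> `|B - B'| <= L * dl * M ->
    `|A - A'| <= eps.
  move=> ab ab' bb'; apply: le_trans (ler_distD B _ _) _.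
  apply: le_trans (lerD ab (ler_distD B' _ _)) _; rewrite [X in _ + (_ + X)]distrC.
  apply: le_trans (lerD (lexx _) (lerD (le_trans bb' LM) ab')) _.
  exact: fin.
have [r1 r2] := HC h h0 h1 x u u' cx; have [r1' r2'] := HC h h0 h1 x' u u' cx'.
split.
- have := Pn 0 0 n0 n0; rewrite !scale0r !addr0 => /le_trans; apply.
  by apply: le_trans (le_trans LM half); rewrite ler_peMr.
- apply: split4 r1 r1' _; apply: le_trans (Q10 h h0 h1) _.
  rewrite mulrC ler_wpM2l// /M -addrA addrCA lerDl.
  by rewrite addr_ge0// !mulr_ge0.
apply: split4 r2 r2' _; rewrite /quot2 -scalerBr normrZ gtr0_norm ?invr_gt0//.
apply: (@le_trans _ _ (h^-1 * ((h ^+ 2)^-1 * 2 * (L * dl) + (h ^+ 2)^-1 * 2 * (L * dl)))).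
  rewrite ler_wpM2l//.
  rewrite sub_sub.
  exact: le_trans (ler_normB _ _) (lerD (Q1 _ _ h2 h21 nh) (Q10 _ h2 h21)).
rewrite (_ : h^-1 * _ = L * dl * (h^-1 * ((h ^+ 2)^-1 * 2) * 2)); last by ring.
by rewrite ler_wpM2l// /M -addrA lerDl addr_ge0// mulr_ge0.
Qed.

Definition bounded_conf (W : R) (q : point * point * point) : Prop :=
  [/\ conf W q.1.1 q.1.2 q.2, `|q.1.1.1| <= W & `|q.1.1.2 0| <= W].

Lemma af_feature W : 1 <= W -> af (fun x : point => (exists om, [/\ control T om, om T <= W &
    pt_ctrl om x 3]) /\ `|x.1| <= 3 * W /\ `|x.2 0| <= 3 * W) (fun=> 1) feature.
Proof.
move=> W1; have W0 : 0 <= W by exact: le_trans W1.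
have W30 : 0 <= 3 * W by rewrite mulr_ge0.
apply: (af_trilinear (B2 := Cl) (B3 := sig_const W) tri1 tri2 tri3 triZ trin) => //.
- exact: expR_ge0.
- by move=> x _; have := fbl (us := [::]) isT (x.2 0); rewrite big_nil mulr1.
- move=> x [[om [z1 z2 z3]] _]; apply: (path_sig_norm W1 z1 z2 _ z3).
  by rewrite ler_nat.
- have a := @af_lipschitz_ball _ _ _ (rk_sec Hk) Ck (3 * W) Ck0 W30
     (fun x y => fd_bound_lipschitz x y fbk).
  by apply: (af_comp (phi := fst)) a => x [_ [x1 _]].
- have a := @af_lipschitz_ball _ _ _ (rk_sec Hl) Cl (3 * W) Cl0 W30
     (fun x y => fd_bound_lipschitz x y fbl).
  by apply: (af_comp (phi := fun x : point => x.2 0)) a => x [_ [_ x2]].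
have := @af_path_sig _ T e g Hg TV Cf Tge0 fbg (3 * W) W30.
apply: (af_comp (phi := snd)) => x [[om [[z o_le uc] z2 z3]] _]; split=> //.
(* [bounded_path] asks for Lipschitz constant 1, so the factor 3 is moved into the control. *)
exists (fun t => 3 * om t); split.
- split; first by rewrite z mulr0.
    by move=> s t s0 st tT; rewrite ler_wpM2l// o_le.
  move=> r r0; have r3 : 0 < r / 3 by rewrite divr_gt0.
  have [rho rho0 Hr] := uc _ r3; exists rho => // s t s0 st tT h.
  by have := Hr s t s0 st tT h; rewrite ltr_pdivlMr// mulrC mulrBr.
- by rewrite ler_wpM2l.
by move=> s t s0 st tT; rewrite mul1r -mulrBr; exact: z3.
Qed.

Lemma af_moved_feature W (a b : R) : 1 <= W -> `|a| <= 1 -> `|b| <= 1 ->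
  af (bounded_conf W) (fun=> 1) (fun q => feature (q.1.1 + b *: q.2 + a *: q.1.2)).
Proof.
move=> W1 a1 b1; have := af_feature W1.
apply: (af_comp (phi := fun q : point * point * point => q.1.1 + b *: q.2 + a *: q.1.2)).
move=> [[x u] u'] [/= cx x1 x2]; split=> //; split; first exact: conf_move cx.
have [om [_ _ _ [u1 u2 _] [u1' u2' _]]] := cx.
have W0 : 0 <= W by exact: le_trans W1.
rewrite mulr1 in u2 u2'.
split=> /=.
  apply: le_trans (ler_normD _ _) _; apply: le_trans (lerD (ler_normD _ _) (lexx _)) _.
  rewrite !normrZ.
  have h1 : `|b| * `|u'.1| <= 1 * 1 by rewrite ler_pM.
  have h2 : `|a| * `|u.1| <= 1 * 1 by rewrite ler_pM.
  by lra.
suff : `|x.2 0 + b *: u'.2 0 + a *: u.2 0| <= 3 * W by [].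
apply: le_trans (ler_normD _ _) _; apply: le_trans (lerD (ler_normD _ _) (lexx _)) _.
rewrite !normrZ.
have h1 : `|b| * `|u'.2 0| <= 1 * W by rewrite ler_pM.
have h2 : `|a| * `|u.2 0| <= 1 * W by rewrite ler_pM.
by lra.
Qed.

(** Difference quotients with fixed step are finite combinations of features at moved points, and
    they approximate the derivatives uniformly. *)
Lemma af_derivatives W : 1 <= W ->
  [/\ af (bounded_conf W) (fun=> 1) (fun q => feature q.1.1),
      af (bounded_conf W) (fun=> 1) (fun q => dder feature q.1.2 q.1.1) &
      af (bounded_conf W) (fun=> 1) (fun q => dder (dder feature q.1.2) q.2 q.1.1)].
Proof.
move=> W1; have [C C0 HC] := quotient_rate W1.
have n0 : `|0 : R| <= 1 by rewrite normr0.
have mv := @af_moved_feature W _ _ W1.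
have afZ (F : point * point * point -> H) (c : R) : af (bounded_conf W) (fun=> 1) F ->
    af (bounded_conf W) (fun=> 1) (fun q => c *: F q).
  by apply: (af_scale (M := `|c|) (s := fun=> c)).
have afB (F G : point * point * point -> H) : af (bounded_conf W) (fun=> 1) F ->
    af (bounded_conf W) (fun=> 1) G -> af (bounded_conf W) (fun=> 1) (fun q => F q - G q).
  move=> aF aG; have := af_add aF (afZ _ (-1) aG).
  by congr af; apply/funext => q; rewrite scaleN1r.
have choose (eps : R) : 0 < eps -> exists h : R, [/\ 0 < h, h <= 1 & C * h <= eps].
  move=> eps0; have C1 : 0 < C + 1 by rewrite ltr_wpDl.
  exists (Num.min 1 (eps / (C + 1))); split; first by rewrite lt_min ltr01 divr_gt0.
    by rewrite ge_min lexx.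
  apply: (@le_trans _ _ (C * (eps / (C + 1)))); first by rewrite ler_wpM2l// ge_min lexx orbT.
  by rewrite mulrCA ler_piMr ?(ltW eps0)// ler_pdivrMr// mul1r lerDl.
have ext (F G : point * point * point -> H) : F =1 G -> af (bounded_conf W) (fun=> 1) F ->
  af (bounded_conf W) (fun=> 1) G by move=> /funext ->.
have a0 b : `|b| <= 1 -> af (bounded_conf W) (fun=> 1) (fun q => feature (q.1.1 + b *: q.2)).
  by move=> b1; apply: ext (mv 0 b n0 b1) => q; rewrite scale0r addr0.
have a00 : af (bounded_conf W) (fun=> 1) (fun q => feature q.1.1).
  by apply: ext (a0 0 n0) => q; rewrite scale0r addr0.
have aQ (a b : R) : 0 < a -> a <= 1 -> `|b| <= 1 ->
    af (bounded_conf W) (fun=> 1) (fun q => quot1 a q.1.2 (q.1.1 + b *: q.2)).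
  move=> a_0 a_1 b1; apply: afZ; apply: afB; last exact: a0.
  by apply: mv => //; rewrite gtr0_norm.
have aQ0 (a : R) : 0 < a -> a <= 1 ->
    af (bounded_conf W) (fun=> 1) (fun q => quot1 a q.1.2 q.1.1).
  by move=> a_0 a_1; apply: ext (aQ a 0 a_0 a_1 n0) => q; rewrite scale0r addr0.
split=> //.
- apply: af_approx => eps /choose [h [h0 h1 Ch]].
  exists (fun q => quot1 h q.1.2 q.1.1); first exact: aQ0.
  move=> [[x u] u'] [cx _ _]; rewrite mulr1; apply: le_trans Ch.
  by have [] := HC h h0 h1 _ _ _ cx.
apply: af_approx => eps /choose [h [h0 h1 Ch]].
have h2 : 0 < h ^+ 2 by rewrite exprn_gt0.
have h21 : h ^+ 2 <= 1 by rewrite exprn_ile1// ltW.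
exists (fun q => quot2 h q.1.2 q.2 q.1.1).
  by apply: afZ; apply: afB; [apply: aQ => //; rewrite gtr0_norm|exact: aQ0].
move=> [[x u] u'] [cx _ _]; rewrite mulr1; apply: le_trans Ch.
by have [] := HC h h0 h1 _ _ _ cx.
Qed.

End FeatureMap.

Section FiniteEvaluations.
Context (R : realType) (S : Type) (K : S -> S -> R) (H : rkhs K).

(** Each vector of the finite family is replaced by a combination of sections, against which [h]
    pairs through its values; the coefficients are absorbed in their common bound [C]. *)
Lemma af_evaluations (I : Type) (P : I -> Prop) (F : I -> H) : af P (fun=> 1) F ->
  forall eps : R, 0 < eps -> exists s : seq (R * S), forall i, P i -> forall h : H,
    `|inner h (F i)| <= eps * `|h| + \sum_(q <- s) `|q.1| * `|rk_ev h q.2|.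
Proof.
move=> aF eps eps0; have e2 : 0 < eps / 2 by rewrite divr_gt0.
have [J [v [C [C0 HC]]]] := aF _ e2.
(* All [#|J|] replacements, each with a coefficient at most [C], have to fit into [eps / 2]. *)
have n1 : 0 < C * #|J|%:R + 1 by rewrite ltr_wpDl// mulr_ge0.
have e3 := divr_gt0 e2 n1.
have /choice[s Hs] : forall j, exists s, `|v j - rk_comb H s| < eps / 2 / (C * #|J|%:R + 1).
  by move=> j; exact: rk_comb_dense.
exists [seq (C * q.1, q.2) | q <- flatten [seq s j | j <- enum J]] => i Pi h.
have [c [c1 c2]] := HC i Pi; rewrite mulr1 in c2.
have c1' j : `|c j| <= C by have := c1 j; rewrite mulr1.
have -> : inner h (F i) = inner h (F i - \sum_j c j *: v j) +
    (\sum_j c j * inner h (v j - rk_comb H (s j)) + \sum_j c j * inner h (rk_comb H (s j))).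
  rewrite -big_split /= (eq_bigr (fun j => inner h (c j *: v j))); last first.
    by move=> j _; rewrite innerBr innerZr; ring.
  by rewrite -inner_sumr innerBr subrK.
apply: le_trans (ler_normD _ _) _; apply: le_trans (lerD (lexx _) (ler_normD _ _)) _.
rewrite addrA; apply: lerD.
  rewrite [eps]splitr mulrDl; apply: lerD.
    by apply: le_trans (inner_CS _ _) _; rewrite mulrC ler_wpM2r.
  apply: le_trans (ler_norm_sum _ _ _) _.
  apply: (@le_trans _ _ (\sum_(j : J) C * (`|h| * (eps / 2 / (C * #|J|%:R + 1))))).
    apply: ler_sum => j _; rewrite normrM ler_pM//.
    by apply: le_trans (inner_CS _ _) _; rewrite ler_wpM2l// ltW.
  rewrite sumr_const -[leLHS]mulr_natl.
  rewrite (_ : _ * _ = (eps / 2) * `|h| * ((C * #|J|%:R) / (C * #|J|%:R + 1))); last by ring.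
  have q0 : 0 <= eps / 2 * `|h| by rewrite mulr_ge0// ltW.
  have q1 : C * #|J|%:R / (C * #|J|%:R + 1) <= 1 by rewrite ler_pdivrMr// mul1r lerDl.
  by rewrite ler_piMr.
rewrite big_map big_flatten big_map big_enum /=.
apply: le_trans (ler_norm_sum _ _ _) _; apply: ler_sum => j _.
rewrite normrM inner_comb; apply: le_trans (ler_pM _ _ (c1' j) (ler_norm_sum _ _ _)) _ => //.
rewrite mulr_sumr; apply: ler_sum => q _.
by rewrite normrM mulrA normrM (ger0_norm C0).
Qed.

End FiniteEvaluations.

(** * The topology of C^N *)

Section Directions.
Context (R : realType) (T p : R) (d e : nat).
Hypothesis T0 : 0 < T.
Notation point := ('rV[R]_(1 + d) * (R -> 'rV[R]_e))%type.
Notation state := (state T p d e).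

Definition dir_vector (dir : direction R d e) : point :=
  match dir with
  | Dx i => (row_mx 0 (delta_mx 0 i), 0)
  | Dpath eta => (0, checkp eta)
  end.
Definition time_vector : point := (row_mx (const_mx 1) 0, 0).

Lemma point_of_move (w : state) dir (eps : R) :
  point_of (move_state w dir eps) = point_of w + eps *: dir_vector dir.
Proof.
case: dir => [i|eta]; congr pair => /=.
- rewrite /time_space scale_row_mx scaler0 add_row_mx addr0.
  by congr row_mx; apply/rowP => j; rewrite !mxE.
- by rewrite scaler0 addr0.
- by rewrite scaler0 addr0.
Qed.

Lemma point_of_time (w : state) (h : R) :
  point_of (State T p (st_t w + h) (st_x w) (st_path w)) = point_of w + h *: time_vector.
Proof.
congr pair => /=; last by rewrite scaler0 addr0.
rewrite /time_space scale_row_mx scaler0 add_row_mx addr0; congr row_mx.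
by apply/rowP => j; rewrite !mxE mulr1.
Qed.

Definition dir_le (v : R) (dir : direction R d e) : Prop :=
  if dir is Dpath eta then BV 0 T eta /\ (pvar_norm 1 0 T eta <= v%:E)%E else True.

Lemma admissible_dir_le dir : admissible T dir -> exists2 v, 0 <= v & dir_le v dir.
Proof.
case: dir => [i _|eta /= eBV]; first by exists 0.
have fin : pvar_norm 1 0 T eta \is a fin_num.
  rewrite ge0_fin_numE ?pvar_norm_ge0// /pvar_norm; apply: lte_add_pinfty; first exact: ltry.
  by case: eBV.
exists (fine (pvar_norm 1 0 T eta)); first by rewrite fine_ge0// pvar_norm_ge0.
by split=> //; rewrite fineK.
Qed.

Lemma dir_le_mono v v' dir : v <= v' -> dir_le v dir -> dir_le v' dir.
Proof.
by move=> vv; case: dir => //= eta [h1 h2]; split=> //; apply: le_trans h2 _; rewrite lee_fin.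
Qed.

(** Time is added to the directions, so that the same estimates serve [Dt]. *)
Definition dir_point (v : R) (u : point) : Prop :=
  u = time_vector \/ exists2 dir, dir_le v dir & u = dir_vector dir.

Lemma check_sub_le (a b : 'rV[R]_e) : `|check a - check b| <= `|a - b|.
Proof.
apply: norm_row_le => // i; rewrite !mxE; case: ifP => _; first by rewrite subrr normr0.
by have := coord_le_norm (a - b) i; rewrite !mxE.
Qed.

Lemma control0 : control T (fun=> 0 : R).
Proof.
split=> // r r0; exists 1 => // s t _ _ _ _.
by rewrite subrr.
Qed.

Lemma dir_point_control v u : 0 <= v -> dir_point v u -> exists om,
  [/\ control T om, om T <= e%:R * v, `|u.1| <= 1, `|u.2 0| <= v & lipc T om 1 u.2].
Proof.
move=> v0 H; have ev : 0 <= e%:R * v by rewrite mulr_ge0.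
have zero (a : 'rV[R]_(1 + d)) : `|a| <= 1 -> exists om,
    [/\ control T om, om T <= e%:R * v, `|a| <= 1, `|(0 : R -> 'rV[R]_e) 0| <= v &
      lipc T om 1 (0 : R -> 'rV[R]_e)].
  exists (fun=> 0); split=> //; [exact: control0|by rewrite normr0|].
  by move=> s t _ _ _; rewrite subrr normr0 subrr mulr0.
case: H => [->|[[i _ ->|eta [eBV ev1] ->]]] /=.
- apply: zero; apply: norm_row_mx_le; last by rewrite normr0.
  by apply: norm_row_le => // i; rewrite mxE normr1.
- apply: zero; apply: norm_row_mx_le; first by rewrite normr0.
  exact: norm_delta_mx.
have [[om [om_c omT lo]] e0] := bounded_path_pvar_norm T0 eBV ev1.
exists om; split=> //; first by rewrite normr0.
  apply: le_trans e0; have := check_sub_le (eta 0) 0.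
  rewrite subr0 (_ : check 0 = 0) ?subr0//.
  by apply/rowP => i; rewrite !mxE if_same.
move=> s t s0 st tT; apply: le_trans (lo s t s0 st tT).
exact: check_sub_le.
Qed.

(** The three controls are added, and [W] exceeds all the bounds at once: time, space, starting
    points and variations. *)
Lemma state_conf (X : set state) (r v : R) : 1 < p -> X `<=` @Omega R T p d e -> compact X ->
  (forall w, X w -> (pvar_norm 1 0 T (st_path w) <= r%:E)%E) -> 0 <= v ->
  exists2 W : R, 1 <= W & forall w, X w -> forall u u', dir_point v u -> dir_point v u' ->
    bounded_conf T W (point_of w, u, u').
Proof.
move=> p1 XO cX Xr v0; have [rho Hrho] := compact_state_bounded T0 p1 cX.
pose W := 1 + T + `|rho| + `|r| + v + e%:R * `|r| + e%:R * v + e%:R * v.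
have ev : 0 <= e%:R * v by rewrite mulr_ge0.
have er : 0 <= e%:R * `|r| by rewrite mulr_ge0.
have T1 := ltW T0; have a1 := normr_ge0 rho; have a2 := normr_ge0 r.
have [W1 WT Wrho] : [/\ 1 <= W, T <= W & rho <= W].
  by have := ler_norm rho; rewrite /W; split; lra.
have [Wom Wv Wr] : [/\ e%:R * `|r| + e%:R * v + e%:R * v <= W, v <= W & `|r| <= W].
  by rewrite /W; split; lra.
clearbody W; exists W => //.
move=> w Xw u u' Du Du'.
have [tT wBV _] := XO _ Xw.
have Xr' : (pvar_norm 1 0 T (st_path w) <= `|r|%:E)%E.
  by apply: le_trans (Xr _ Xw) _; rewrite lee_fin ler_norm.
have [[om [om_c omT lo]] c0] := bounded_path_pvar_norm T0 wBV Xr'.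
have [om1 [om1_c om1T n1 n2 lo1]] := dir_point_control v0 Du.
have [om2 [om2_c om2T n1' n2' lo2]] := dir_point_control v0 Du'.
have [_ le0 _] := om_c; have [_ le1 _] := om1_c; have [_ le2 _] := om2_c.
split=> /=.
- exists (fun t => om t + om1 t + om2 t); split.
  + by do 2! apply: controlD => //.
  + by apply: le_trans Wom; rewrite !lerD.
  + apply: lipc_mono om_c ler01 (lexx _) _ lo => s t s0 st tT'.
    by have := le1 s t s0 st tT'; have := le2 s t s0 st tT'; lra.
  + split=> //; first by rewrite mulr1 (le_trans n2).
    apply: lipc_mono om1_c ler01 (lexx _) _ lo1 => s t s0 st tT'.
    by have := le0 s t s0 st tT'; have := le2 s t s0 st tT'; lra.
  split=> //; first by rewrite mulr1 (le_trans n2').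
  apply: lipc_mono om2_c ler01 (lexx _) _ lo2 => s t s0 st tT'.
  by have := le0 s t s0 st tT'; have := le1 s t s0 st tT'; lra.
- apply: norm_row_mx_le; last exact: le_trans (Hrho _ Xw) Wrho.
  apply: norm_row_le => [|i]; first exact: le_trans W1.
  by rewrite mxE; case/andP: tT => t0 tT; rewrite ger0_norm// (le_trans tT).
by apply: le_trans c0 _.
Qed.

End Directions.

Section PointwiseNorm.
Context (R : realType) (T p : R) (d e : nat).
Notation state := (state T p d e).
Implicit Types (u v w : state -> R) (X : set state).

(* Pairs of directions whose second derivative enters the norm of C^N. *)
Definition norm_pair (dir dir' : direction R d e) : Prop :=
  match dir, dir' with Dpath _, Dx _ => False | _, _ => True end.

(** The norm of C^N without suprema and Euclidean sums. *)
Definition Nle X u (b : R) : Prop := forall y, X y ->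
  [/\ `|u y| <= b, `|Dt u y| <= b,
      forall dir, dir_le T 1 dir -> `|Ddir dir u y| <= b &
      forall dir dir', dir_le T 1 dir -> dir_le T 1 dir' -> norm_pair dir dir' ->
        `|Ddir dir' (Ddir dir u) y| <= b].

Lemma sup_over_ge0 X F : (0 <= sup_over X F)%E.
Proof. by apply: ereal_sup_ubound; left. Qed.

Lemma sup_over_le X F (b : R) : 0 <= b ->
  (forall y eta eta', X y -> BV 0 T eta /\ (pvar_norm 1 0 T eta <= 1)%E ->
     BV 0 T eta' /\ (pvar_norm 1 0 T eta' <= 1)%E -> F y eta eta' <= b) ->
  (sup_over X F <= b%:E)%E.
Proof.
move=> b0 H; apply: ge_ereal_sup => _ [->|[y [eta [eta' [Xy h h' ->]]]]]; rewrite lee_fin//.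
exact: H.
Qed.

Lemma sup_over_ubound X F y eta eta' (b : R) : (sup_over X F <= b%:E)%E -> X y ->
  dir_le T 1 (@Dpath R d e eta) -> dir_le T 1 (@Dpath R d e eta') -> F y eta eta' <= b.
Proof.
move=> H Xy h h'; rewrite -lee_fin; apply: le_trans H; apply: ereal_sup_ubound; right.
exists y, eta, eta'; split; [exact: Xy|exact: h|exact: h'|reflexivity].
Qed.

Lemma le_sqrt_sum n (a : 'I_n -> R) (b : R) i :
  Num.sqrt (\sum_(j < n) a j ^+ 2) <= b -> `|a i| <= b.
Proof.
apply: le_trans; rewrite -sqrtr_sqr ler_wsqrtr// (bigD1 i)//= lerDl.
by apply: sumr_ge0 => j _; exact: sqr_ge0.
Qed.

Lemma le_sqrt_sum2 m n (a : 'I_m -> 'I_n -> R) (b : R) i j :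
  Num.sqrt (\sum_(i < m) \sum_(j < n) a i j ^+ 2) <= b -> `|a i j| <= b.
Proof.
apply: le_trans; rewrite -sqrtr_sqr ler_wsqrtr// (bigD1 i)//= (bigD1 j)//= -addrA lerDl addr_ge0//.
  by apply: sumr_ge0 => k _; exact: sqr_ge0.
by apply: sumr_ge0 => k _; apply: sumr_ge0 => k' _; exact: sqr_ge0.
Qed.

Lemma sqrt_sum_le n (a : 'I_n -> R) (b : R) : 0 <= b -> (forall i, `|a i| <= b) ->
  Num.sqrt (\sum_(j < n) a j ^+ 2) <= n%:R * b.
Proof.
move=> b0 ab; have nb : 0 <= n%:R * b by rewrite mulr_ge0.
rewrite -(ger0_norm nb) -sqrtr_sqr ler_wsqrtr//.
apply: (@le_trans _ _ (\sum_(j < n) b ^+ 2)).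
  apply: ler_sum => j _; rewrite -(real_normK (num_real (a j))).
  by rewrite ler_pXn2r// nnegrE.
rewrite sumr_const card_ord -[leLHS]mulr_natl exprMn ler_wpM2r ?sqr_ge0// -natrX ler_nat.
by case: n {a ab nb} => // n; rewrite expnS expn1 leq_pmulr.
Qed.

Lemma sqrt_sum2_le m n (a : 'I_m -> 'I_n -> R) (b : R) : 0 <= b -> (forall i j, `|a i j| <= b) ->
  Num.sqrt (\sum_(i < m) \sum_(j < n) a i j ^+ 2) <= m%:R * n%:R * b.
Proof.
move=> b0 ab; rewrite -mulrA.
rewrite (eq_bigr (fun i => Num.sqrt (\sum_(j < n) a i j ^+ 2) ^+ 2)); last first.
  by move=> i _; rewrite sqr_sqrtr// sumr_ge0// => j _; exact: sqr_ge0.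
apply: sqrt_sum_le => [|i]; first by rewrite mulr_ge0.
by rewrite ger0_norm ?sqrtr_ge0//; exact: sqrt_sum_le.
Qed.

Lemma adde7_lt (N1 N2 N3 N4 N5 N6 N7 : \bar R) (eps : R) :
  (0 <= N1)%E -> (0 <= N2)%E -> (0 <= N3)%E -> (0 <= N4)%E -> (0 <= N5)%E -> (0 <= N6)%E ->
  (0 <= N7)%E -> (N1 + N2 + N3 + N4 + N5 + N6 + N7 < eps%:E)%E ->
  exists2 b, b < eps & [/\ (N1 <= b%:E)%E, (N2 <= b%:E)%E & (N3 <= b%:E)%E] /\
    [/\ (N4 <= b%:E)%E, (N5 <= b%:E)%E, (N6 <= b%:E)%E & (N7 <= b%:E)%E].
Proof.
move=> g1 g2 g3 g4 g5 g6 g7.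
have h2 := adde_ge0 g1 g2; have h3 := adde_ge0 h2 g3; have h4 := adde_ge0 h3 g4.
have h5 := adde_ge0 h4 g5; have h6 := adde_ge0 h5 g6; have h7 := adde_ge0 h6 g7.
move: (_ + N7)%E (leeDl (N1 + N2 + N3 + N4 + N5 + N6)%E g7) (leeDr N7 h6) h7 => N k6 l7 N0 Neps.
have Nf : N \is a fin_num by rewrite ge0_fin_numE// (lt_trans Neps (ltry _)).
have k5 := le_trans (leeDl _ g6) k6; have l6 := le_trans (leeDr _ h5) k6.
have k4 := le_trans (leeDl _ g5) k5; have l5 := le_trans (leeDr _ h4) k5.
have k3 := le_trans (leeDl _ g4) k4; have l4 := le_trans (leeDr _ h3) k4.
have k2 := le_trans (leeDl _ g3) k3; have l3 := le_trans (leeDr _ h2) k3.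
have l1 := le_trans (leeDl _ g2) k2; have l2 := le_trans (leeDr _ g1) k2.
by exists (fine N); [rewrite -lte_fin fineK|rewrite fineK].
Qed.

Context (eta0 : pathT R e).
Hypothesis eta0_le : dir_le T 1 (@Dpath R d e eta0).

(** Every supremum in [normN] ranges over pairs of directions as well; without [eta0] all of them
    would be over the empty set, hence 0. *)
Lemma Nle_of_normN X u (eps : R) : (normN X u < eps%:E)%E -> exists2 b, b < eps & Nle X u b.
Proof.
have g F := sup_over_ge0 X F.
move=> /(adde7_lt (g _) (g _) (g _) (g _) (g _) (g _) (g _)) [b be [[l1 l2 l3] [l4 l5 l6 l7]]].
exists b => // y Xy; split.
- exact: (sup_over_ubound l1 Xy eta0_le eta0_le).
- exact: (sup_over_ubound l2 Xy eta0_le eta0_le).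
- case=> [i _|eta h].
    exact: le_sqrt_sum (sup_over_ubound l3 Xy eta0_le eta0_le).
  exact: (sup_over_ubound l6 Xy h eta0_le).
case=> [i|eta] [j|eta'] h h' // _.
- exact: (le_sqrt_sum2 i j (sup_over_ubound l4 Xy eta0_le eta0_le)).
- exact: (le_sqrt_sum i (sup_over_ubound l5 Xy h' eta0_le)).
exact: (sup_over_ubound l7 Xy h h').
Qed.

(** One summand per term of [normN], in the same order: the Euclidean norm of [n] numbers bounded by
    [b] is at most [n b]. *)
Definition norm_const : R := 1 + 1 + d%:R + d%:R * d%:R + d%:R + 1 + 1.

Lemma normN_le X u (b : R) : 0 <= b -> Nle X u b -> (normN X u <= (norm_const * b)%:E)%E.
Proof.
move=> b0 H; rewrite /norm_const !mulrDl !EFinD !mul1r /normN.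
have db : 0 <= d%:R * b by rewrite mulr_ge0.
have dirx i : dir_le T 1 (@Dx R d e i) by [].
apply: leeD; last first.
  apply: sup_over_le => // y eta eta' Xy h h'; have [_ _ _ k] := H y Xy.
  exact: (k (Dpath eta) (Dpath eta') h h' I).
apply: leeD; last first.
  apply: sup_over_le => // y eta eta' Xy h h'; have [_ _ k _] := H y Xy.
  exact: (k (Dpath eta) h).
apply: leeD; last first.
  apply: sup_over_le => // y eta eta' Xy h h'; have [_ _ _ k] := H y Xy.
  by apply: sqrt_sum_le => // i; exact: (k (Dx i) (Dpath eta) _ h I).
apply: leeD; last first.
  apply: sup_over_le => [|y eta eta' Xy h h']; first by rewrite !mulr_ge0.
  have [_ _ _ k] := H y Xy.
  by apply: sqrt_sum2_le => // i j; exact: (k (Dx i) (Dx j) (dirx i) (dirx j) I).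
apply: leeD; last first.
  apply: sup_over_le => // y eta eta' Xy h h'; have [_ _ k _] := H y Xy.
  by apply: sqrt_sum_le => // i; exact: (k (Dx i)).
by apply: leeD; apply: sup_over_le => // y eta eta' Xy h h'; have [] := H y Xy.
Qed.

End PointwiseNorm.

Section CNDifference.
Context (R : realType) (T p : R) (d e : nat) (X : set (state T p d e)).
Hypothesis T0 : 0 < T.
Notation state := (state T p d e).
Implicit Types a b c : state -> R.

Lemma Ddir_sub dir a b w : derivable_dir dir a w -> derivable_dir dir b w ->
  Ddir dir (fun y => a y - b y) w = Ddir dir a w - Ddir dir b w.
Proof. by move=> da db; rewrite /Ddir !derive1E; exact: deriveB da db. Qed.

Lemma CN_sub a b : is_CN X a -> is_CN X b -> forall w, X w ->
  [/\ Dt (fun y => a y - b y) w = Dt a w - Dt b w,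
      forall dir, admissible T dir ->
        Ddir dir (fun y => a y - b y) w = Ddir dir a w - Ddir dir b w &
      forall dir dir', admissible T dir -> admissible T dir' ->
        Ddir dir' (Ddir dir (fun y => a y - b y)) w =
        Ddir dir' (Ddir dir a) w - Ddir dir' (Ddir dir b) w].
Proof.
move=> [_ [ta _] xa xxa] [_ [tb _] xb xxb] w Xw; split.
- rewrite /Dt; case: ifP => [wT|_]; last by rewrite subrr.
  have -> : time_quotient (fun y => a y - b y) w = time_quotient a w - time_quotient b w.
    apply/funext => h; rewrite -[RHS]/(time_quotient a w h - time_quotient b w h).
    by rewrite /time_quotient; ring.
  exact: limB (ta _ Xw wT) (tb _ Xw wT).
- by move=> dir adir; apply: Ddir_sub; [exact: (xa _ adir).1|exact: (xb _ adir).1].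
move=> dir dir' adir adir'.
have [na da] := (xxa _ _ adir adir').1 _ Xw; have [nb db] := (xxb _ _ adir adir').1 _ Xw.
(* The outer derivative sees the inner one at moved states, which is where the neighbourhood clause
   of [derivable_dir2] enters. *)
have nab : \forall h \near (0 : R), Ddir dir (fun y => a y - b y) (move_state w dir' h) =
    Ddir dir a (move_state w dir' h) - Ddir dir b (move_state w dir' h).
  by apply: filterS2 na nb => h; exact: Ddir_sub.
rewrite -Ddir_sub// /Ddir !derive1E; exact: near_eq_derive nab.
Qed.

Lemma dir_le_admissible v dir : dir_le T v dir -> @admissible R T d e dir.
Proof. by case: dir => //= eta []. Qed.

Lemma Nle_mono a s t : s <= t -> Nle X a s -> Nle X a t.
Proof.
move=> st Ha w Xw; have [h1 h2 h3 h4] := Ha w Xw.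
split=> [||dir l|dir dir' l l' P]; apply: le_trans st; [exact: h1|exact: h2|exact: h3|exact: h4].
Qed.

(** [Ddir] and [Dt] are total and additive only where the derivatives exist, hence the hypotheses
    [is_CN]. *)
Lemma Nle_triangle a b c s t : is_CN X a -> is_CN X b -> is_CN X c ->
  Nle X (fun y => a y - b y) s -> Nle X (fun y => b y - c y) t ->
  Nle X (fun y => a y - c y) (s + t).
Proof.
move=> Ca Cb Cc Hs Ht w Xw; have [h1 h2 h3 h4] := Hs w Xw; have [k1 k2 k3 k4] := Ht w Xw.
have [ab1 ab2 ab3] := CN_sub Ca Cb Xw; have [bc1 bc2 bc3] := CN_sub Cb Cc Xw.
have [ac1 ac2 ac3] := CN_sub Ca Cc Xw.
have tri (x y z : R) : `|x - y| <= s -> `|y - z| <= t -> `|x - z| <= s + t.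
  by move=> xy yz; apply: le_trans (ler_distD y _ _) _; exact: lerD.
split=> [||dir l|dir dir' l l' P].
- exact: tri h1 k1.
- by rewrite ac1; rewrite ab1 in h2; rewrite bc1 in k2; exact: tri h2 k2.
- have A := dir_le_admissible l; rewrite ac2//.
  by have := h3 _ l; have := k3 _ l; rewrite ab2// bc2// => kk hh; exact: tri hh kk.
have A := dir_le_admissible l; have A' := dir_le_admissible l'; rewrite ac3//.
by have := h4 _ _ l l' P; have := k4 _ _ l l' P; rewrite ab3// bc3// => kk hh; exact: tri hh kk.
Qed.

Lemma Nle_sym a b s : is_CN X a -> is_CN X b ->
  Nle X (fun y => a y - b y) s -> Nle X (fun y => b y - a y) s.
Proof.
move=> Ca Cb Hs w Xw; have [h1 h2 h3 h4] := Hs w Xw.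
have [ab1 ab2 ab3] := CN_sub Ca Cb Xw; have [ba1 ba2 ba3] := CN_sub Cb Ca Xw.
split=> [||dir l|dir dir' l l' P].
- by rewrite distrC.
- by rewrite ba1 distrC -ab1.
- by have A := dir_le_admissible l; rewrite ba2// distrC -ab2//; exact: h3.
have A := dir_le_admissible l; have A' := dir_le_admissible l'.
by rewrite ba3// distrC -ab3//; exact: h4.
Qed.

Hypotheses (XO : X `<=` @Omega R T p d e).

(* A multiple of the path of any point of X is an admissible direction of norm
   at most 1. *)
Lemma unit_direction w : X w -> exists eta, dir_le T 1 (@Dpath R d e eta).
Proof.
move=> Xw; have [_ [wc wv [i i0 wm]] _] := XO Xw.
set c := st_path w in wc wv wm *.
have fin : pvar 1 0 T c \is a fin_num by rewrite ge0_fin_numE ?poweR_ge0.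
pose r := fine (pvar 1 0 T c) + enorm (c 0).
have v0 : 0 <= fine (pvar 1 0 T c) by rewrite fine_ge0 ?poweR_ge0.
have r0 : 0 <= r by rewrite addr_ge0 ?enorm_ge0.
have r1 : 0 < r + 1 by rewrite ltr_wpDl.
(* The [+ 1] spares a proof that the norm is not 0; a positive factor preserves strict
   monotonicity. *)
pose q := (r + 1)^-1; have q0 : 0 < q by rewrite invr_gt0.
have enormZ (v : 'rV[R]_e) : enorm (q *: v) = q * enorm v.
  rewrite /enorm (eq_bigr (fun i => q ^+ 2 * v 0 i ^+ 2)); last first.
    by move=> j _; rewrite !mxE exprMn.
  by rewrite -mulr_sumr sqrtrM ?sqr_ge0// sqrtr_sqr gtr0_norm.
have pv : (pvar 1 0 T (fun s => q *: c s) <= (q * fine (pvar 1 0 T c))%:E)%E.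
  rewrite {1}/pvar invr1 poweRe1; last first.
    apply: ereal_sup_ge; exists (pvar_sum 1 0 T (fun s => q *: c s) [:: T])%:E.
      by exists [:: T] => //; split; rewrite /= ?T0.
    by rewrite lee_fin pvar_sum_ge0.
  apply: ge_ereal_sup => _ [s ps <-]; rewrite lee_fin.
  have -> : pvar_sum 1 0 T (fun s => q *: c s) s = q * pvar_sum 1 0 T c s.
    rewrite /pvar_sum mulr_sumr; apply: eq_bigr => j _.
    by rewrite -scalerBr !powRr1 ?enorm_ge0// enormZ.
  rewrite ler_wpM2l ?(ltW q0)// -lee_fin fineK//.
  by have := pvar_sum_le c ltr01 ps; rewrite invr1 powRr1 ?pvar_sum_ge0.
exists (fun s => q *: c s); split.
  split.
  - move=> x; apply: cvgZr; exact: wc.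
  - exact: le_lt_trans pv (ltry _).
  exists i => //; case: wm => wm; [left|right] => x y xT yT xy; rewrite !mxE ltr_pM2l//; exact: wm.
rewrite /pvar_norm enormZ; apply: le_trans (leeD (lexx _) pv) _.
rewrite -EFinD lee_fin -mulrDr addrC -/r /q ler_pdivrMl// mulr1.
by rewrite lerDl.
Qed.

Lemma CN_nbhsP (u : CN X) (N : set (CN X)) :
  nbhs u N <-> exists2 eps : R, 0 < eps & forall v : CN X, Nle X (fun w => v w - u w) eps -> N v.
Proof.
have le_normN (f : state -> R) (eps : R) : (normN X f < eps%:E)%E -> exists2 b, b < eps & Nle X f b.
  (* For empty [X] no unit direction is available, but [Nle] is vacuous. *)
  move=> h; have [Xe|/set0P[w Xw]] := eqVneq X set0.
    by exists (eps - 1); [rewrite ltrBlDr ltrDl|move=> w; rewrite Xe].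
  by have [eta le] := unit_direction Xw; exact: (Nle_of_normN le) h.
have nc : 0 < norm_const R d.
  by rewrite /norm_const ltr_wpDl// !addr_ge0// mulr_ge0.
split.
  rewrite nbhsE => -[V [Vo Vu] VN]; have [eps eps0 He] := Vo u Vu.
  have e0 : 0 < eps / (2 * norm_const R d) by rewrite divr_gt0// mulr_gt0.
  exists (eps / (2 * norm_const R d)) => // v Hv; apply: VN; apply: He.
  apply: le_lt_trans (normN_le (ltW e0) Hv) _; rewrite lte_fin.
  rewrite (_ : _ * _ = eps / 2); last by field; rewrite gt_eqF.
  by rewrite ltr_pdivrMr// ltr_pMr// ltr1n.
move=> [eps eps0 He]; rewrite nbhsE /=.
(* As radii stay strictly below [eps], the triangle inequality leaves room around each element, so
   the set is open. *)
exists [set v : CN X | exists2 b, b < eps & Nle X (fun w => v w - u w) b].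
  split.
    move=> v [b be Hb]; exists (eps - b); first by rewrite subr_gt0.
    move=> v' /le_normN[b' be' Hb']; exists (b' + b); first by rewrite -ltrBrDr.
    exact: Nle_triangle (CN_prop v') (CN_prop v) (CN_prop u) Hb' Hb.
  exists 0 => //.
  move=> w Xw; have [h1 h2 h3] := CN_sub (CN_prop u) (CN_prop u) Xw.
  split=> [||dir l|dir dir' l l' P].
  - by rewrite subrr normr0.
  - by rewrite h1 subrr normr0.
  - by rewrite h2 ?subrr ?normr0//; exact: dir_le_admissible l.
  by rewrite h3 ?subrr ?normr0//; [exact: dir_le_admissible l|exact: dir_le_admissible l'].
by move=> v [b /ltW be /(Nle_mono be)]; exact: He.
Qed.

End CNDifference.

(** * Compactness for an abstract smooth feature map *)

Section SmoothFeature.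
Context (R : realType) (T p : R) (d e : nat) (X : set (state T p d e))
  (K : {s | X s} -> {s | X s} -> R) (H : rkhs K).
Notation state := (state T p d e).
Notation point := ('rV[R]_(1 + d) * (R -> 'rV[R]_e))%type.
Notation dvec := (@dir_vector R d e).
Notation tvec := (time_vector R d e).
Context (Phi : point -> H) (D1 : point -> point -> H) (D2 : point -> point -> point -> H)
  (E : H -> state -> R).
Hypotheses (T0 : 0 < T) (p1 : 1 < p) (XO : X `<=` @Omega R T p d e)
  (EE : forall h w, E h w = inner h (Phi (point_of w)))
  (Phi_sec : forall h a, inner h (Phi (point_of (sval a))) = rk_ev h a).
Hypothesis Phi_derivatives : forall v : R, 0 <= v -> exists2 C : R, 0 <= C &
  forall w u u', X w -> dir_point T v u -> dir_point T v u' ->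
  [/\ forall b : R, `|b| <= 1 -> forall h : R, `|h| <= 1 ->
        `|Phi (point_of w + b *: u' + h *: u) - Phi (point_of w + b *: u') -
          h *: D1 u (point_of w + b *: u')| <= C * h ^+ 2 &
      forall b : R, `|b| <= 1 ->
        `|D1 u (point_of w + b *: u') - D1 u (point_of w) - b *: D2 u u' (point_of w)| <= C * b ^+ 2].
Hypothesis Phi_near : forall v eps : R, 0 <= v -> 0 < eps -> exists2 dl : R, 0 < dl &
  forall w w' u u', X w -> X w' -> dir_point T v u -> dir_point T v u' ->
  near_point T dl (point_of w) (point_of w') ->
  [/\ `|Phi (point_of w) - Phi (point_of w')| <= eps,
      `|D1 u (point_of w) - D1 u (point_of w')| <= eps &
      `|D2 u u' (point_of w) - D2 u u' (point_of w')| <= eps].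

Lemma inner_quadratic (h a b D : H) (C t : R) : `|a - b - t *: D| <= C * t ^+ 2 ->
  `|inner h a - inner h b - t * inner h D| <= `|h| * C * t ^+ 2.
Proof.
rewrite -innerZr -!innerBr => k; apply: le_trans (inner_CS _ _) _.
by rewrite -mulrA ler_wpM2l.
Qed.

Lemma common_size dir dir' : admissible T dir -> admissible T dir' ->
  exists2 v : R, 0 <= v & dir_point T v (dvec dir) /\ dir_point T v (dvec dir').
Proof.
move=> /admissible_dir_le[v v0 l] /admissible_dir_le[v' v0' l'].
exists (Num.max v v'); first by rewrite le_max v0.
split; right; [exists dir => //; apply: dir_le_mono l|exists dir' => //; apply: dir_le_mono l'].
  by rewrite le_max lexx.
by rewrite le_max lexx orbT.
Qed.

(** A second derivative needs the first one at states moved by [b] along [dir'], possibly outside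
    [X]; this is the role of the shift [b *: u'] in [Phi_derivatives]. *)
Lemma derivative_moved h w dir dir' (b : R) : X w -> admissible T dir -> admissible T dir' ->
  `|b| <= 1 -> derivable_dir dir (E h) (move_state w dir' b) /\
  Ddir dir (E h) (move_state w dir' b) = inner h (D1 (dvec dir) (point_of w + b *: dvec dir')).
Proof.
move=> Xw ad ad' b1; have [v v0 [l l']] := common_size ad ad'.
have [C C0 HC] := Phi_derivatives v0; have [q _] := HC _ _ _ Xw l l'.
have Q t : `|t| <= 1 -> `|E h (move_state (move_state w dir' b) dir t) -
    E h (move_state (move_state w dir' b) dir 0) -
    t * inner h (D1 (dvec dir) (point_of w + b *: dvec dir'))| <= `|h| * C * t ^+ 2.
  move=> t1; rewrite !EE !point_of_move scale0r addr0; apply: inner_quadratic.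
  exact: q.
by have [] := quadratic_remainder Q.
Qed.

Lemma move_state0 (w : state) dir : move_state w dir 0 = w.
Proof.
case: w => t x c; case: dir => [i|eta] /=; congr State; first by rewrite scale0r addr0.
by apply/funext => s; rewrite scale0r addr0.
Qed.

Lemma first_derivative h w dir : X w -> admissible T dir ->
  derivable_dir dir (E h) w /\ Ddir dir (E h) w = inner h (D1 (dvec dir) (point_of w)).
Proof.
move=> Xw ad; have b0 : `|0 : R| <= 1 by rewrite normr0.
by have := derivative_moved h Xw ad ad b0; rewrite move_state0 scale0r addr0.
Qed.

Lemma second_derivative h w dir dir' : X w -> admissible T dir -> admissible T dir' ->
  derivable_dir2 dir dir' (E h) w /\
  Ddir dir' (Ddir dir (E h)) w = inner h (D2 (dvec dir) (dvec dir') (point_of w)).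
Proof.
move=> Xw ad ad'; have [v v0 [l l']] := common_size ad ad'.
have [C C0 HC] := Phi_derivatives v0; have [_ q] := HC _ _ _ Xw l l'.
have b0 : `|0 : R| <= 1 by rewrite normr0.
have Q t : `|t| <= 1 -> `|Ddir dir (E h) (move_state w dir' t) -
    Ddir dir (E h) (move_state w dir' 0) -
    t * inner h (D2 (dvec dir) (dvec dir') (point_of w))| <= `|h| * C * t ^+ 2.
  move=> t1; rewrite !(derivative_moved h Xw ad ad' _).2// scale0r addr0.
  by apply: inner_quadratic; exact: q.
have [Q1 Q2 _] := quadratic_remainder Q; split=> //; split=> //.
apply/nbhs_ballP; exists 1; first exact: ltr01.
move=> t; rewrite -ball_normE /ball_ /= sub0r normrN => /ltW t1.
exact: (derivative_moved h Xw ad ad' t1).1.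
Qed.

Lemma time_derivative h w : X w -> time_quotient (E h) w t @[t --> 0^'+] -->
  inner h (D1 tvec (point_of w)).
Proof.
move=> Xw; have [C C0 HC] := Phi_derivatives (lexx 0).
have l : dir_point T (0 : R) tvec by left.
have [q _] := HC _ _ _ Xw l l.
pose f t := E h (State T p (st_t w + t) (st_x w) (st_path w)).
have f0 : f 0 = E h w by rewrite /f addr0; case: w {Xw q f}.
have Q t : `|t| <= 1 -> `|f t - f 0 - t * inner h (D1 tvec (point_of w))| <= `|h| * C * t ^+ 2.
  move=> t1; rewrite f0 /f !EE point_of_time; apply: inner_quadratic.
  by have := q 0 _ t t1; rewrite scale0r addr0 normr0; exact.
have [_ _] := quadratic_remainder Q.
by rewrite /time_quotient -f0.
Qed.

Lemma Dt_smooth h w : X w ->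
  Dt (E h) w = if st_t w < T then inner h (D1 tvec (point_of w)) else 0.
Proof.
by move=> Xw; rewrite /Dt; case: ifP => // _; apply: cvg_lim => //; exact: time_derivative.
Qed.

Lemma inner_sub_lt (h a b : H) (eps : R) : 0 < eps -> `|a - b| <= eps / (`|h| + 1) ->
  `|inner h a - inner h b| < eps.
Proof.
move=> eps0 ab; have h1 : 0 < `|h| + 1 by rewrite ltr_wpDl.
rewrite -innerBr; apply: le_lt_trans (inner_CS _ _) _.
apply: le_lt_trans (ler_wpM2l (normr_ge0 h) ab) _.
by rewrite mulrCA -[ltRHS]mulr1 ltr_pM2l// ltr_pdivrMr// mul1r ltrDl.
Qed.

Lemma smooth_is_CN h : is_CN X (E h).
Proof.
have e1 (eps : R) : 0 < eps -> 0 < eps / (`|h| + 1) by move=> eps0; rewrite divr_gt0// ltr_wpDl.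
have l0 : dir_point T (0 : R) tvec by left.
split.
- apply: within_continuous_near => // w Xw eps eps0.
  have [dl dl0 Hd] := Phi_near (lexx 0) (e1 _ eps0); exists dl => // w' Xw' ww'.
  have [k _ _] := Hd _ _ _ _ Xw Xw' l0 l0 ww'; rewrite !EE; exact: inner_sub_lt.
- split=> [w Xw wT|]; first by apply/cvg_ex; eexists; exact: time_derivative Xw.
  apply: within_continuous_near => // w [Xw wT] eps eps0.
  have [dl dl0 Hd] := Phi_near (lexx 0) (e1 _ eps0); exists dl => // w' [Xw' wT'] ww'.
  have [_ k _] := Hd _ _ _ _ Xw Xw' l0 l0 ww'; rewrite !Dt_smooth// wT wT'; exact: inner_sub_lt.
- move=> dir ad; split=> [w Xw|]; first exact: (first_derivative h Xw ad).1.
  have [v v0 [l _]] := common_size ad ad.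
  apply: within_continuous_near => // w Xw eps eps0.
  have [dl dl0 Hd] := Phi_near v0 (e1 _ eps0); exists dl => // w' Xw' ww'.
  have [_ k _] := Hd _ _ _ _ Xw Xw' l l ww'.
  rewrite (first_derivative h Xw ad).2 (first_derivative h Xw' ad).2; exact: inner_sub_lt.
move=> dir dir' ad ad'; split=> [w Xw|]; first exact: (second_derivative h Xw ad ad').1.
have [v v0 [l l']] := common_size ad ad'.
apply: within_continuous_near => // w Xw eps eps0.
have [dl dl0 Hd] := Phi_near v0 (e1 _ eps0); exists dl => // w' Xw' ww'.
have [_ _ k] := Hd _ _ _ _ Xw Xw' l l' ww'.
rewrite (second_derivative h Xw ad ad').2 (second_derivative h Xw' ad ad').2; exact: inner_sub_lt.
Qed.

Hypothesis Phi_evaluations : forall eps : R, 0 < eps -> exists s : seq (R * {s | X s}),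
  forall w u u', X w -> dir_point T 1 u -> dir_point T 1 u' -> forall h : H,
  [/\ `|inner h (Phi (point_of w))| <= eps * `|h| + \sum_(q <- s) `|q.1| * `|rk_ev h q.2|,
      `|inner h (D1 u (point_of w))| <= eps * `|h| + \sum_(q <- s) `|q.1| * `|rk_ev h q.2| &
      `|inner h (D2 u u' (point_of w))| <= eps * `|h| + \sum_(q <- s) `|q.1| * `|rk_ev h q.2|].

Lemma smooth_Nle (eps : R) : 0 < eps -> exists s : seq (R * {s | X s}), forall h h' : H,
  Nle X (fun w => E h w - E h' w)
    (eps * `|h - h'| + \sum_(q <- s) `|q.1| * `|rk_ev h q.2 - rk_ev h' q.2|).
Proof.
move=> eps0; have [s Hs] := Phi_evaluations eps0; exists s => h h'.
rewrite (_ : (fun w => _) = E (h - h')); last first.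
  by apply/funext => w; rewrite !EE innerBl.
rewrite (eq_bigr (fun q => `|q.1| * `|rk_ev (h - h') q.2|)); last first.
  by move=> q _; rewrite -!rk_repr innerBl.
set b := (X in Nle _ _ X); have b0 : 0 <= b.
  by rewrite addr_ge0 ?mulr_ge0 ?(ltW eps0)// sumr_ge0// => q _; rewrite mulr_ge0.
have lt : dir_point T (1 : R) tvec by left.
move=> w Xw; have [k1 k2 _] := Hs w _ _ Xw lt lt (h - h').
split=> [||dir l|dir dir' l l' _].
- by rewrite EE.
- by rewrite Dt_smooth//; case: ifP => // _; rewrite normr0.
- have L : dir_point T 1 (dvec dir) by right; exists dir.
  by rewrite (first_derivative _ Xw (dir_le_admissible l)).2; have [] := Hs w _ _ Xw L L (h - h').
have L : dir_point T 1 (dvec dir) by right; exists dir.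
have L' : dir_point T 1 (dvec dir') by right; exists dir'.
rewrite (second_derivative _ Xw (dir_le_admissible l) (dir_le_admissible l')).2.
by have [] := Hs w _ _ Xw L L' (h - h').
Qed.

Context (Y : set H) (M : R).
Hypotheses (M0 : 0 <= M) (YM : forall h, Y h -> `|h| <= M).
Let A : set (CN X) := [set u : CN X | exists2 h, Y h & CN_fun u = E h].
Let EC (h : H) : CN X := MkCN (smooth_is_CN h).

(** Elements of the closure are not known to come from [H]; they are traded for nearby elements of
    [Y], for which the RKHS norm bound is available. *)
Lemma closure_approx (u : CN X) : closure A u -> forall eps : R, 0 < eps ->
  exists2 h, Y h & Nle X (fun w => E h w - u w) eps.
Proof.
move=> cu eps eps0.
have [|v [[h Yh vh] Hv]] := cu [set v : CN X | Nle X (fun w => v w - u w) eps].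
  by apply/(CN_nbhsP T0 XO); exists eps.
by exists h; [exact: Yh|move: Hv; rewrite /= vh].
Qed.

Lemma approx_at (u : CN X) h (eps : R) (a : {s | X s}) : Nle X (fun w => E h w - u w) eps ->
  `|rk_ev h a - u (sval a)| <= eps.
Proof.
by move=> k; have [+ _ _ _] := k _ (svalP a); rewrite EE Phi_sec.
Qed.

Lemma closure_bounded (u : CN X) (a : {s | X s}) : closure A u ->
  `|u (sval a)| <= M * `|rk_sec H a| + 1.
Proof.
move=> cu; have [h Yh k] := closure_approx cu ltr01.
have h1 := approx_at a k; rewrite distrC in h1.
have -> : u (sval a) = rk_ev h a + (u (sval a) - rk_ev h a) by rewrite addrC subrK.
apply: le_trans (ler_normD _ _) _; apply: lerD h1.
rewrite -rk_repr; apply: le_trans (inner_CS _ _) _.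
by rewrite ler_wpM2r// YM.
Qed.

Section PointwiseLimit.
Context (F : set_system (CN X)) (FU : UltraFilter F) (FA : F (closure A)).

(** The values at [a] stay in a compact interval and so have a cluster value; for an ultrafilter it
    is a limit, since a set or its complement belongs to [F]. *)
Lemma ultra_limit (a : {s | X s}) : exists q : R, forall eps : R, 0 < eps ->
  F [set u : CN X | `|u (sval a) - q| < eps].
Proof.
have FF : ProperFilter F by exact: ultra_proper.
pose c := M * `|rk_sec H a| + 1.
pose at_a (u : CN X) : R := u (sval a).
have Fc : F (at_a @^-1` [set` `[- c, c]]).
  apply: filterS FA => u /(closure_bounded a); rewrite ler_norml => cu.
  by rewrite /preimage /= in_itv.
have [q [_ cl]] := @segment_compact R (- c) c (fmap at_a F) _ Fc.
exists q => eps eps0.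
have [//|nF] := in_ultra_setVsetC [set u : CN X | `|u (sval a) - q| < eps] FU.
have [x [/= nx qx]] := cl [set x : R | ~ `|x - q| < eps] (ball q eps) nF (nbhsx_ballx _ _ eps0).
by exfalso; apply: nx; move: qx; rewrite -ball_normE /= distrC.
Qed.

Lemma ultra_converges : (closure A `&` [set u | F --> u]) !=set0.
Proof.
have FF : ProperFilter F by exact: ultra_proper.
have /choice[f Hf] := ultra_limit.
have Hs (s : seq (R * {s | X s})) (eps : R) : 0 < eps ->
    F [set u : CN X | \sum_(q <- s) `|q.1| * `|u (sval q.2) - f q.2| < eps].
  elim: s eps => [|q s IH] eps eps0.
    by apply: filterS FA => u _ /=; rewrite big_nil.
  have e2 : 0 < eps / 2 by rewrite divr_gt0.
  have q1 : 0 < `|q.1| + 1 by rewrite ltr_wpDl.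
  apply: filterS2 (IH _ e2) (Hf q.2 _ (divr_gt0 e2 q1)) => u /= k1 k2.
  rewrite big_cons [eps]splitr; apply: ler_ltD k1.
  apply: (@le_trans _ _ ((`|q.1| + 1) * `|u (sval q.2) - f q.2|)).
    by rewrite ler_wpM2r// lerDl.
  by rewrite mulrC -ler_pdivlMr// ltW.
have est (s : seq (R * {s | X s})) (eps dl : R) (u : CN X) h :
    Nle X (fun w => E h w - u w) dl -> dl * \sum_(q <- s) `|q.1| <= eps ->
    \sum_(q <- s) `|q.1| * `|u (sval q.2) - f q.2| < eps ->
    \sum_(q <- s) `|q.1| * `|rk_ev h q.2 - f q.2| <= 2 * eps.
  move=> Hu dls us; rewrite mulrDl mul1r; apply: le_trans (lerD dls (ltW us)).
  rewrite mulr_sumr -big_split /=; apply: ler_sum => q _.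
  rewrite [dl * _]mulrC -mulrDr ler_wpM2l//.
  apply: le_trans (ler_distD (u (sval q.2)) _ _) _; rewrite lerD2r.
  exact: approx_at.
have small (s : seq (R * {s | X s})) (eps : R) : 0 < eps -> exists dl : R,
    [/\ 0 < dl, dl <= eps & dl * \sum_(q <- s) `|q.1| <= eps].
  move=> eps0; pose m := \sum_(q <- s) `|q.1|.
  have m0 : 0 <= m by apply: sumr_ge0.
  have m1 : 0 < m + 1 by rewrite ltr_wpDl.
  exists (eps / (m + 1)); rewrite divr_gt0// ler_pdivrMr// ler_peMr ?(ltW eps0) ?lerDr//.
  by rewrite -/m mulrAC ler_pdivrMr// ler_wpM2l ?(ltW eps0)// lerDl.
(* The pointwise limit [f] has norm at most [M] as a functional: at the points of [s] it is close to
   some [u] of the closure, which is close to an element of [Y]. *)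
have [s|h [hf hM _]] := @rk_bounded_functional _ _ _ H f M M0.
  apply: le_of_eps => eps eps0; have e2 : 0 < eps / 2 by rewrite divr_gt0.
  have [dl [dl0 _ dls]] := small s _ e2.
  have [u [us cu]] := filter_ex (filterI (Hs s _ e2) FA).
  have [h Yh k] := closure_approx cu dl0.
  have := est s _ _ _ _ k dls us; rewrite mulrC divfK// => k2.
  have -> : \sum_(q <- s) q.1 * f q.2 =
      inner h (rk_comb H s) - \sum_(q <- s) q.1 * (rk_ev h q.2 - f q.2).
    rewrite inner_comb -sumrB; apply: eq_bigr => q _.
    by rewrite mulrBr opprB addrC subrK.
  apply: le_trans (ler_normB _ _) _; apply: lerD.
    by apply: le_trans (inner_CS _ _) _; rewrite ler_wpM2r// YM.
  apply: le_trans k2; apply: le_trans (ler_norm_sum _ _ _) _.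
  by apply: ler_sum => q _; rewrite normrM.
have FN (N : set (CN X)) : nbhs (EC h) N -> F N.
  move=> /(CN_nbhsP T0 XO)[eps eps0 HN].
  have e4 : 0 < eps / 4 by rewrite divr_gt0.
  have M1 : 0 < 2 * M + 1 by rewrite ltr_wpDl// mulr_ge0.
  (* The errors are [eps / 4] for passing from [u] to [h'], [eps / 4] for the norm term with
     [|h' - h| <= 2 M + 1], and [eps / 2] for the evaluations. *)
  have [s Hes] := smooth_Nle (divr_gt0 e4 M1).
  have [dl [dl0 dle dls]] := small s _ e4.
  apply: filterS2 (Hs s _ e4) FA => u us cu; apply: HN.
  have [h' Yh' k] := closure_approx cu dl0.
  have k1 := Nle_sym (smooth_is_CN h') (CN_prop u) k.
  have k2 := Nle_triangle (CN_prop u) (smooth_is_CN h') (smooth_is_CN h) k1 (Hes h' h).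
  apply: Nle_mono k2.
  have k3 : eps / 4 / (2 * M + 1) * `|h' - h| <= eps / 4.
    have h2 : `|h' - h| <= 2 * M + 1.
      apply: le_trans (ler_normB _ _) _; apply: le_trans (lerD (YM Yh') hM) _; lra.
    apply: le_trans (ler_wpM2l _ h2) _; last by rewrite divfK ?gt_eqF.
    by rewrite ltW// divr_gt0.
  have := est s _ _ _ _ k dls us.
  rewrite (eq_bigr (fun q => `|q.1| * `|rk_ev h' q.2 - rk_ev h q.2|)); last first.
    by move=> q _; rewrite hf.
  by lra.
(* [F] contains the closure and every neighbourhood of the limit, which therefore lies in the
   closure. *)
exists (EC h); split=> //; apply: closed_closure => N /FN FNN.
have [u [cu Nu]] := filter_ex (filterI FA FNN).
by exists u.
Qed.

End PointwiseLimit.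

Lemma smooth_compact : compact (closure A).
Proof. by rewrite compact_ultra => F FU FA; exact: ultra_converges. Qed.

End SmoothFeature.

Theorem lemma4p7 (R : realType) (T p : R) (d e : nat)
    (hT : 0 < T) (hp : 1 < p)
    (X : set (state T p d e))
    (X_Omega : X `<=` @Omega R T p d e)
    (X_compact : compact X)
    (X_bounded : exists2 r : R, 0 < r &
       forall w, X w -> (pvar_norm 1 0 T (st_path w) <= r%:E)%E)
    (g : 'rV[R]_e -> 'rV[R]_e -> R) (Hg : rkhs g) (TV : tensor_algebra Hg)
    (g_psd : psd_kernel g)
    (g_lip : lipschitz (rk_sec Hg))
    (k : 'rV[R]_(1 + d) -> 'rV[R]_(1 + d) -> R) (Hk : rkhs k)
    (k_univ : cc_universal Hk)
    (l : 'rV[R]_e -> 'rV[R]_e -> R) (Hl : rkhs l)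
    (l_univ : cc_universal Hl)
    (hG : assumptionG g)
    (hFk : assumptionF (rk_sec Hk)) (hFl : assumptionF (rk_sec Hl))
    (H : rkhs (restrict_kernel (@kappa R T p d e g Hg TV k l) X))
    (Y : set H)
    (Y_bounded_H : exists M : R, forall h, Y h -> `|h| <= M)
    (Y_bounded_CN : exists M : R, forall h, Y h ->
       is_CN X (rk_extend h) /\ (normN X (rk_extend h) <= M%:E)%E) :
  compact (closure
    [set u : CN X | exists2 h, Y h & CN_fun u = rk_extend h]).
Proof.
have [Cf _ fbg] := assumptionG_fd_bound Hg hG.
have [Ck _ fbk] := assumptionF_fd_bound hFk.
have [Cl _ fbl] := assumptionF_fd_bound hFl.
have [r _ Xr] := X_bounded.
have conf_X v : 0 <= v -> exists2 W : R, 1 <= W & forall w, X w -> forall u u',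
    dir_point T v u -> dir_point T v u' -> bounded_conf T W (point_of w, u, u').
  exact: (state_conf hT hp X_Omega X_compact Xr).
have ext h w := rk_extendE Hk Hl (H := H) h w.
have sec h a := feature_at Hk Hl (H := H) h a.
have der (W : R) (W1 : 1 <= W) := feature_derivatives H hT fbg fbk fbl W1.
have near (W eps : R) (W1 : 1 <= W) (eps0 : 0 < eps) := derivatives_near H hT fbg fbk fbl W1 eps0.
have afd (W : R) (W1 : 1 <= W) := af_derivatives H hT fbg fbk fbl W1.
have [M YM] := Y_bounded_H.
(* From here on the feature map is known through these estimates alone. *)
move: ext sec der near afd; set Phi := feature _ _ _; clearbody Phi => ext sec der near afd.
(* [|M|] because [M] may be negative when [Y] is empty. *)
apply: (@smooth_compact _ _ _ _ _ _ _ _ Phi (fun u x => dder Phi u x)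
  (fun u u' x => dder (dder Phi u) u' x) _ hT hp X_Omega ext sec _ _ _ Y `|M|) => //.
- move=> v /conf_X[W W1 HW]; have [C C0 HC] := der W W1.
  exists (2 * C); first by rewrite mulr_ge0.
  by move=> w u u' Xw Du Du'; have [c _ _] := HW w Xw u u' Du Du'; exact: HC.
- move=> v eps /conf_X[W W1 HW] eps0; have [dl dl0 Hd] := near W eps W1 eps0.
  exists dl => // w w' u u' Xw Xw' Du Du' ww'.
  have [c _ _] := HW w Xw u u' Du Du'; have [c' _ _] := HW w' Xw' u u' Du Du'.
  exact: Hd.
- move=> eps eps0; have [W W1 HW] := conf_X 1 ler01.
  have [a0 a1 a2] := afd W W1.
  have [s0 H0] := af_evaluations a0 eps0; have [s1 H1] := af_evaluations a1 eps0.
  have [s2 H2] := af_evaluations a2 eps0.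
  (* Concatenation only enlarges the sums, so one list serves all three estimates. *)
  exists (s0 ++ s1 ++ s2) => w u u' Xw Du Du' h.
  have c := HW w Xw u u' Du Du'.
  have S0 (s : seq (R * {s | X s})) : 0 <= \sum_(q <- s) `|q.1| * `|rk_ev h q.2|.
    by apply: sumr_ge0 => q _; rewrite mulr_ge0.
  rewrite !big_cat /=; split.
  + by apply: le_trans (H0 _ c h) _; rewrite lerD2l lerDl addr_ge0.
  + by apply: le_trans (H1 _ c h) _; rewrite lerD2l addrCA lerDl addr_ge0.
  by apply: le_trans (H2 _ c h) _; rewrite lerD2l addrA lerDr addr_ge0.
by move=> h /YM h1; apply: le_trans h1 (ler_norm _).
Qed.
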